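(* Let $E$ be a complex Banach space, $k\in(1,+\infty]$, and let $(\mathcal{P}_\Theta({}^{j}E))_{j=0}^\infty$ be a holomorphy type from $E$ to $\mathbb C$ that is both a $\pi_1$-holomorphy type and a $\pi_{2,k}$-holomorphy type. Suppose that $Exp_{\Theta'}^{k'}(E')$ is closed under division and let $L$ be a convolution operator on $Exp_{\Theta,0}^k(E)$. Then the vector subspace of $Exp_{\Theta,0}^k(E)$ generated by $$\mathcal L=\{P\cdot e^{\varphi}\in Exp_{\Theta,0}^k(E): P\in\mathcal P_\Theta({}^nE),\ n\in\mathbb N_0,\ \varphi\in E',\ L(P\cdot e^{\varphi})=0\}$$ is dense in $\ker L=\{f\in Exp_{\Theta,0}^k(E): Lf=0\}$.
   Context: $E$ is a complex Banach space, $E'$ its topological dual, $\mathbb{N}_0=\mathbb{N}\cup\{0\}$; $k'$ is the conjugate exponent, $\frac1k+\frac1{k'}=1$ (with $k'=1$ for $k=+\infty$). $\mathcal{P}({}^jE)$ is the Banach space of continuous $j$-homogeneous polynomials $E\to\mathbb{C}$ with the sup norm on the unit ball; $\check P$ is the symmetric $j$-linear form associated to $P\in\mathcal P({}^jE)$; $\mathcal{P}_f({}^jE)$ is the span of $\{\phi^j:\phi\in E'\}$; $\mathcal H(E)$ is the space of entire functions on $E$. If $f(x)=\sum_m P_m(x-a)$ is the Taylor expansion of $f$ at $a$, then $\hat d^m f(a)=m!P_m$. A holomorphy type $\Theta$ from $E$ to $\mathbb C$ is a sequence of Banach spaces $(\mathcal P_\Theta({}^jE))_{j=0}^\infty$,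 with norms denoted $\|\cdot\|_\Theta$, such that: (1) each $\mathcal P_\Theta({}^jE)$ is a vector subspace of $\mathcal P({}^jE)$, and $\mathcal P_\Theta({}^0E)=\mathbb C$ as a normed space; (2) there is $\sigma\ge 1$ such that for all $k\le j$ in $\mathbb N_0$, $a\in E$ and $P\in\mathcal P_\Theta({}^jE)$, one has $\hat d^kP(a)\in\mathcal P_\Theta({}^kE)$ and $\|\frac1{k!}\hat d^kP(a)\|_\Theta\le\sigma^j\|P\|_\Theta\|a\|^{j-k}$. $\Theta$ is a $\pi_1$-holomorphy type if: (i) $\mathcal P_f({}^jE)\subset\mathcal P_\Theta({}^jE)$ and there is $K>0$ such that $\|b\,\phi^j\|_\Theta\le K^j\|\phi\|^j|b|$ for all $\phi\in E'$, $b\in\mathbb C$, $j\in\mathbb N_0$; (ii) $\mathcal P_f({}^jE)$ is dense in $(\mathcal P_\Theta({}^jE),\|\cdot\|_\Theta)$ for every $j$. For $k\in[1,+\infty)$, $Exp_{\Theta,0}^k(E)$ is the space of all $f\in\mathcal H(E)$ with $\hat d^jf(0)\in\mathcal P_\Theta({}^jE)$ for all $j\in\mathbb N_0$ and $\|f\|_{\Theta,k,\rho}=\sum_{j=0}^\infty\rho^{-j}\left(\frac{j}{ke}\right)^{j/k}\left\|\frac1{j!}\hat d^jf(0)\right\|_\Theta<\infty$ for all $\rho>0$ (the weight being $1$ for $j=0$), with the topology given by the norms $\|\cdot\|_{\Theta,k,\rho}$, $\rho>0$. For $k=+\infty$, $Exp_{\Theta,0}^\infty(E)$ is the space of all $f\in\mathcal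 H(E)$ with $\hat d^jf(0)\in\mathcal P_\Theta({}^jE)$ for all $j$ and $\lim_{j\to\infty}\|\frac1{j!}\hat d^jf(0)\|_\Theta^{1/j}=0$, with the topology given by the norms $p^\infty_{\Theta,\rho}(f)=\sum_j\rho^{-j}\|\frac1{j!}\hat d^jf(0)\|_\Theta$, $\rho>0$. These are Fréchet spaces. $\Theta$ is a $\pi_{2,k}$-holomorphy type if for each $T\in[Exp_{\Theta,0}^k(E)]'$: (1) for all $m\le j$ in $\mathbb N_0$ and $P\in\mathcal P_\Theta({}^jE)$ with associated symmetric $j$-linear form $B=\check P$, the polynomial $T(\widehat{B\cdot^m}):E\to\mathbb C$, $y\mapsto T\big(x\mapsto B(x,\dots,x,y,\dots,y)\big)$ ($x$ taken $m$ times, $y$ taken $j-m$ times), belongs to $\mathcal P_\Theta({}^{j-m}E)$; (2) whenever $C>0$ and $\rho>0$ satisfy $|T(f)|\le C\|f\|_{\Theta,k,\rho}$ (if $k<\infty$), respectively $|T(f)|\le Cp^\infty_{\Theta,\rho}(f)$ (if $k=\infty$), for all $f\in Exp_{\Theta,0}^k(E)$, there is $M>0$ such that for all $m\le j$ in $\mathbb{N}_0$ and $P\in\mathcal P_\Theta({}^jE)$, with $B=\check P$, one has $\|T(\widehat{B\cdot^m})\|_\Theta\le CM^j\rho^{-m}\left(\frac{m}{ke}\right)^{m/k}\|P\|_\Theta$ if $k<\infty$, respectively $\|T(\widehat{B\cdot^m})\|_\Theta\le CM^j\rho^{-m}\|P\|_\Theta$ if $k=\infty$. For a $\pi_1$-holomorphy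 type, the Borel transform $\mathcal B_\Theta:[\mathcal P_\Theta({}^mE)]'\to\mathcal P({}^mE')$, $\mathcal B_\Theta T(\phi)=T(\phi^m)$, is injective; $\mathcal P_{\Theta'}({}^mE')$ denotes its range, with norm $\|\mathcal B_\Theta T\|_{\Theta'}=\|T\|$. For $q\in[1,\infty)$, $Exp_{\Theta'}^{q}(E')$ $(=Exp_{\Theta',\infty}^q(E'))$ is the space of all $f\in\mathcal H(E')$ with $\hat d^jf(0)\in\mathcal P_{\Theta'}({}^jE')$ for all $j\in\mathbb N_0$ and $\sum_{j=0}^\infty\rho^{-j}\left(\frac{j}{qe}\right)^{j/q}\left\|\frac1{j!}\hat d^jf(0)\right\|_{\Theta'}<\infty$ for some $\rho>0$. A collection $\mathcal F(U)$ of holomorphic functions on an open set $U$ is closed under division if whenever $f,g\in\mathcal F(U)$, $g\ne0$, and $h$ is holomorphic on $U$ with $f=h\cdot g$ on $U$, then $h\in\mathcal F(U)$. A convolution operator on $Exp_{\Theta,0}^k(E)$ is a continuous linear map $L$ of $Exp_{\Theta,0}^k(E)$ into itself such that $d(Lf)(\cdot)a=L(df(\cdot)a)$ for all $a\in E$ and $f$, where $df(\cdot)a$ is the function $x\mapsto\hat d^1f(x)(a)$. *)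

(* Defs.v *)
From HB Require Import structures.
From mathcomp Require Import all_boot all_order all_algebra.
From mathcomp Require Import all_fingroup.
From mathcomp Require Import complex.
From mathcomp Require Import all_classical all_reals all_analysis.

Set Implicit Arguments.
Unset Strict Implicit.
Unset Printing Implicit Defensive.
Set Warnings "-redundant-canonical-projection".

Import Order.TTheory GRing.Theory Num.Theory numFieldNormedType.Exports.

Local Open Scope classical_set_scope.
Local Open Scope ring_scope.
Local Open Scope complex_scope.

(* R[i] as a normed module over itself. *)
HB.instance Definition _ (R : realType) := NormedModule.copy R[i] R[i]^o.

(* In a normed module over R[i] the norm `|x| is a nonnegative element of
   R[i]; nrm x is the corresponding element of R. *)
Definition nrm (R : realType) (V : normedModType R[i]) (x : V) : R := complex.Re `|x|.

Definition opnorm (R : realType) (F : Type) (X : set F) (n : F -> R)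
    (T : F -> R[i]) : R :=
  sup [set nrm (T f) | f in [set f | X f /\ n f <= 1]].

Section Dual.
Variables (R : realType) (V : normedModType R[i]).

Definition dual_pred : {pred V -> R[i]} :=
  [pred f | `[< linear f /\ continuous f >]].

Lemma dual_submod_closed : submod_closed dual_pred.
Proof.
split=> [|a f g].
  apply/asboolP; split=> [b x y|x]; last exact: cst_continuous.
  have E0 z : (0 : V -> R[i]) z = 0 by [].
  by rewrite !E0 scaler0 addr0.
move=> /asboolP[lf cf] /asboolP[lg cg]; apply/asboolP; split.
  have E z : (a *: f + g) z = a *: f z + g z by [].
  move=> b x y; rewrite !E lf lg !scalerDr !scalerA [a * b]mulrC.
  by rewrite -!addrA; congr (_ + _); rewrite addrCA.
by move=> x; apply: continuousD; [apply: continuousZr; exact: cf | exact: cg].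
Qed.

HB.instance Definition _ :=
  GRing.isSubmodClosed.Build R[i] (V -> R[i]) dual_pred dual_submod_closed.

Record dual := Dual { dual_fun :> V -> R[i]; dual_funP : dual_fun \in dual_pred }.

HB.instance Definition _ := [isSub for dual_fun].
HB.instance Definition _ := [Choice of dual by <:].
HB.instance Definition _ := [SubChoice_isSubLmodule of dual by <:].

Definition dual_norm (phi : dual) : R[i] := (opnorm setT (@nrm R V) phi)%:C.

Lemma nrmE (W : normedModType R[i]) (x : W) : (nrm x)%:C = `|x|.
Proof. by rewrite RRe_real// normr_real. Qed.

Lemma nrm_ge0 (W : normedModType R[i]) (x : W) : 0 <= nrm x.
Proof. by rewrite -ler0c nrmE. Qed.

Lemma nrmZ (W : normedModType R[i]) (a : R[i]) (x : W) :
  nrm (a *: x) = nrm a * nrm x.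
Proof. by apply: complexI; rewrite rmorphM/= !nrmE normrZ. Qed.

Lemma nrmD (W : normedModType R[i]) (x y : W) : nrm (x + y) <= nrm x + nrm y.
Proof. by rewrite -lecR rmorphD/= !nrmE ler_normD. Qed.

Lemma dual_linear (phi : dual) : linear phi.
Proof. by case: phi => f /= /asboolP[]. Qed.

Lemma dual_continuous (phi : dual) : continuous phi.
Proof. by case: phi => f /= /asboolP[]. Qed.

Lemma dual_bounded (phi : dual) :
  exists M : R, forall x : V, nrm (phi x) <= M * nrm x.
Proof.
pose mx := GRing.isLinear.Build _ _ _ _ (phi : V -> R[i]) (@dual_linear phi).
pose f : {linear V -> R[i]} := HB.pack (phi : V -> R[i]) mx.
have fc : {for 0, continuous f} by exact: dual_continuous.
have /linear_boundedP/pinfty_ex_gt0[M M0 fM] := continuous_linear_bounded 0 fc.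
exists (complex.Re M) => x; rewrite -lecR rmorphM/= !nrmE RRe_real ?gtr0_real//.
exact: fM.
Qed.

Lemma dual_has_sup (phi : dual) :
  has_sup [set nrm (phi x) | x in [set x : V | setT x /\ nrm x <= 1]].
Proof.
split.
  exists (nrm (phi 0)); exists 0 => //; split => //.
  by rewrite /nrm normr0 ler01.
have [M phiM] := dual_bounded phi.
exists `|M| => _ [x [_ x1] <-]; apply: (le_trans (phiM x)).
rewrite (le_trans (ler_norm _))// normrM [`|nrm x|]ger0_norm ?nrm_ge0//.
by rewrite ler_piMr.
Qed.

Lemma dual_norm_ub (phi : dual) (x : V) :
  nrm x <= 1 -> nrm (phi x) <= opnorm setT (@nrm R V) phi.
Proof. by move=> x1; apply: sup_upper_bound (dual_has_sup phi) _ _; exists x. Qed.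

Lemma opnorm_le (phi : dual) (c : R) :
  (forall x : V, nrm x <= 1 -> nrm (phi x) <= c) ->
  opnorm setT (@nrm R V) phi <= c.
Proof.
move=> H; apply: ge_sup; first by have [] := dual_has_sup phi.
by move=> _ [x [_ x1] <-]; exact: H.
Qed.

Lemma dual_ler_normD (phi psi : dual) :
  dual_norm (phi + psi) <= dual_norm phi + dual_norm psi.
Proof.
rewrite /dual_norm -rmorphD lecR; apply: opnorm_le => x x1.
by apply: (le_trans (nrmD _ _)); apply: lerD; exact: dual_norm_ub.
Qed.

Lemma dual_normrZ (a : R[i]) (phi : dual) :
  dual_norm (a *: phi) = `|a| * dual_norm phi.
Proof.
have le1 b psi : opnorm setT (@nrm R V) (b *: psi : dual) <=
    nrm b * opnorm setT (@nrm R V) psi.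
  apply: opnorm_le => x x1; rewrite [X in nrm X](_ : _ = b *: psi x)// nrmZ.
  by rewrite ler_wpM2l ?nrm_ge0// dual_norm_ub.
rewrite /dual_norm -nrmE -rmorphM/=; congr (_%:C).
apply/eqP; rewrite eq_le le1/=.
have [->|a0] := eqVneq a 0.
  rewrite {1}/nrm normr0 /= mul0r scale0r.
  by apply: le_trans (dual_norm_ub (0 : dual) (_ : nrm 0 <= 1)); rewrite ?nrm_ge0// /nrm normr0 ler01.
have na0 : 0 < nrm a by rewrite -ltcR nrmE normr_gt0.
rewrite -ler_pdivlMl//; have := le1 a^-1 (a *: phi).
rewrite scalerA mulVf// scale1r; congr (_ <= _ * _).
by apply: complexI; rewrite nrmE normfV fmorphV/= nrmE.
Qed.

Lemma dual_normr0_eq0 (phi : dual) : dual_norm phi = 0 -> phi = 0.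
Proof.
move=> /complexI n0; apply: val_inj; apply/funext => x /=.
have phi0 y : nrm y <= 1 -> phi y = 0.
  move=> y1; apply/normr0_eq0; rewrite -nrmE; congr (_%:C).
  by apply/eqP; rewrite eq_le nrm_ge0 andbT -n0 dual_norm_ub.
have [->|x0] := eqVneq x 0; first by rewrite phi0// /nrm normr0 ler01.
have nx0 : `|x| != 0 by rewrite normr_eq0.
have lZ a y : phi (a *: y) = a *: phi y.
  have := dual_linear phi a y 0.
  rewrite addr0 => ->; by rewrite (phi0 0) ?addr0// /nrm normr0 ler01.
have := phi0 (`|x|^-1 *: x); rewrite lZ => H; apply/eqP.
have /eqP : `|x|^-1 *: phi x = 0.
  by apply: H; rewrite -lecR nrmE normrZ normfV normr_id mulVf.
by rewrite scaler_eq0 invr_eq0 (negbTE nx0).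
Qed.

HB.instance Definition _ := Lmodule_isNormed.Build R[i] dual
  dual_ler_normD dual_normrZ dual_normr0_eq0.

End Dual.

(* A vector space of functions V -> R[i], given by its carrier, with the
   topology defined by a family of (semi)norms.  The values of snorm outside
   the carrier are irrelevant. *)
Record snspace (R : realType) (V : Type) := SNSpace {
  carrier : set (V -> R[i]);
  sidx : Type;
  snorm : sidx -> (V -> R[i]) -> R }.

Section SeminormedSpaces.
Variables (R : realType) (V : Type).
Implicit Types (S : snspace R V) (f g : V -> R[i]).

Definition is_subspace (X : set (V -> R[i])) : Prop :=
  X 0 /\ forall (a : R[i]) f g, X f -> X g -> X (a *: f + g).

Definition linear_on (W : lmodType R[i]) (X : set (V -> R[i]))
    (T : (V -> R[i]) -> W) : Prop :=
  forall (a : R[i]) f g, X f -> X g -> T (a *: f + g) = a *: T f + T g.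

Definition sn_nbhs S f : set_system (V -> R[i]) :=
  [set U | exists (n : nat) (i : 'I_n -> sidx S) (e : R), 0 < e /\
     [set g | carrier S g /\ forall k, snorm (i k) (g - f) < e] `<=` U].

(* Topological dual; only the values of a functional on the carrier matter. *)
Definition sn_dual S : set ((V -> R[i]) -> R[i]) :=
  [set T | linear_on (carrier S) T /\
     forall f, carrier S f -> T @ sn_nbhs S f --> T f].

Definition sn_endo S (L : (V -> R[i]) -> V -> R[i]) : Prop :=
  [/\ forall f, carrier S f -> carrier S (L f),
      linear_on (carrier S) L &
      forall f, carrier S f ->
        sn_nbhs S (L f) `<=` L @ sn_nbhs S f].

Definition sn_dense S (X Y : set (V -> R[i])) : Prop :=
  X `<=` Y /\ forall f, Y f -> forall U, sn_nbhs S f U -> X `&` U !=set0.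

Definition fspan (X : set (V -> R[i])) : set (V -> R[i]) :=
  [set f | exists (n : nat) (c : 'I_n -> R[i]) (g : 'I_n -> V -> R[i]),
     (forall i, X (g i)) /\ f = \sum_(i < n) c i *: g i].

Definition normed_snspace (X : set (V -> R[i])) (n : (V -> R[i]) -> R) :=
  SNSpace X (fun _ : unit => n).

Definition is_banach (X : set (V -> R[i])) (n : (V -> R[i]) -> R) : Prop :=
  [/\ is_subspace X,
      (forall f, X f -> 0 <= n f) /\ (forall f, X f -> n f = 0 -> f = 0),
      (forall a f, X f -> n (a *: f) = nrm a * n f),
      (forall f g, X f -> X g -> n (f + g) <= n f + n g) &
      forall u : nat -> V -> R[i], (forall i, X (u i)) ->
        (forall e : R, 0 < e -> exists N : nat, forall p q : nat,
           (N <= p)%N -> (N <= q)%N -> n (u p - u q) < e) ->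
        exists2 l, X l & n (u i - l) @[i --> \oo] --> (0 : R)].

End SeminormedSpaces.

Section Holomorphy.
Variables (R : realType) (V : normedModType R[i]).

Definition update (j : nat) (u : 'I_j -> V) (i : 'I_j) (x : V) : 'I_j -> V :=
  fun l => if l == i then x else u l.

Definition multilinear (j : nat) (A : ('I_j -> V) -> R[i]) : Prop :=
  forall (u : 'I_j -> V) (i : 'I_j) (a : R[i]) (x y : V),
    A (update u i (a *: x + y)) = a * A (update u i x) + A (update u i y).

Definition symmetric_form (j : nat) (A : ('I_j -> V) -> R[i]) : Prop :=
  forall (s : 'S_j) (u : 'I_j -> V), A (u \o s) = A u.

(* A is the symmetric j-linear form associated to P (it is unique). *)
Definition polar_form (j : nat) (P : V -> R[i]) (A : ('I_j -> V) -> R[i]) : Prop :=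
  [/\ multilinear A, symmetric_form A & forall x, P x = A (fun=> x)].

Definition homog_poly (j : nat) : set (V -> R[i]) :=
  [set P | continuous P /\ exists A, @polar_form j P A].

Definition taylor_expansion (f : V -> R[i]) (a : V) (P : nat -> V -> R[i]) : Prop :=
  (forall m, homog_poly m (P m)) /\
  exists2 r : R, 0 < r &
    {uniform ball a r%:C, (fun n x => \sum_(m < n) P m (x - a)) @ \oo --> f}.

Definition entire : set (V -> R[i]) :=
  [set f | forall a, exists P, taylor_expansion f a P].

(* A Taylor expansion is unique when it exists, so the choice is harmless. *)
Definition taylor (f : V -> R[i]) (a : V) : nat -> V -> R[i] :=
  xget (fun=> 0) [set P | taylor_expansion f a P].

Definition dhat (m : nat) (f : V -> R[i]) (a : V) : V -> R[i] :=
  m`!%:R *: taylor f a m.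

Definition taylor_coef (f : V -> R[i]) (j : nat) : V -> R[i] :=
  (j`!%:R)^-1 *: dhat j f 0.

Definition finite_poly (j : nat) : set (V -> R[i]) :=
  fspan [set (fun x => phi x ^+ j) | phi in [set: dual V]].

End Holomorphy.

(* The weight (j/(ke))^(j/k); it is 1 for k = +oo, and also for j = 0, since
   x `^ 0 = 1 for every x. *)
Definition weight (R : realType) (k : \bar R) (j : nat) : R :=
  if k is r%:E then (j%:R / (r * expR 1)) `^ (j%:R / r) else 1.

Section Types.
Variables (R : realType) (E : normedModType R[i]).

(* The data of a sequence of normed spaces of functions, P_Theta(^j E). *)
Record poly_spaces := PolySpaces {
  pcar : nat -> set (E -> R[i]);
  pnorm : nat -> (E -> R[i]) -> R }.

Variable Th : poly_spaces.

Definition pspace (j : nat) : snspace R E := normed_snspace (pcar Th j) (pnorm Th j).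

Definition holomorphy_type : Prop :=
  [/\ forall j, is_banach (pcar Th j) (pnorm Th j) /\ pcar Th j `<=` homog_poly j,
      pcar Th 0 = range (fun (c : R[i]) (_ : E) => c) /\
        (forall c : R[i], pnorm Th 0 (fun=> c) = nrm c) &
      exists2 sigma : R, 1 <= sigma &
        forall (k j : nat) (a : E) (P : E -> R[i]), (k <= j)%N -> pcar Th j P ->
          pcar Th k (dhat k P a) /\
          pnorm Th k ((k`!%:R)^-1 *: dhat k P a) <=
            sigma ^+ j * pnorm Th j P * nrm a ^+ (j - k)].

Definition pi1_type : Prop :=
  [/\ forall j, finite_poly (V := E) j `<=` pcar Th j,
      exists2 K : R, 0 < K &
        forall (phi : dual E) (b : R[i]) (j : nat),
          pnorm Th j (fun x => b * phi x ^+ j) <= K ^+ j * nrm phi ^+ j * nrm b &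
      forall j, sn_dense (pspace j) (finite_poly j) (pcar Th j)].

Definition exp_term (k : \bar R) (rho : R) (f : E -> R[i]) : R ^nat :=
  fun j => rho ^- j * weight k j * pnorm Th j (taylor_coef f j).

(* ||f||_{Theta,k,rho} for k < +oo and p^oo_{Theta,rho}(f) for k = +oo. *)
Definition exp_norm (k : \bar R) (rho : R) (f : E -> R[i]) : R :=
  limn (series (exp_term k rho f)).

Definition exp_car (k : \bar R) : set (E -> R[i]) :=
  [set f | [/\ entire f, forall j, pcar Th j (dhat j f 0) &
     if k is r%:E then
       forall rho : R, 0 < rho -> cvgn (series (exp_term k rho f))
     else
       pnorm Th j (taylor_coef f j) `^ (j%:R)^-1 @[j --> \oo] --> (0 : R)]].

Definition Exp0 (k : \bar R) : snspace R E :=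
  SNSpace (exp_car k) (fun rho : {posnum R} => exp_norm k rho%:num).

(* With B = the polar form of P: y |-> T (x |-> B(x,..,x,y,..,y)), x taken m times. *)
Definition contraction (T : (E -> R[i]) -> R[i]) (j m : nat)
    (B : ('I_j -> E) -> R[i]) : E -> R[i] :=
  fun y => T (fun x => B (fun i => if (i < m)%N then x else y)).

Definition pi2_type (k : \bar R) : Prop :=
  forall T, sn_dual (Exp0 k) T ->
    (forall (m j : nat) P B, (m <= j)%N -> pcar Th j P -> @polar_form R E j P B ->
       pcar Th (j - m) (contraction T m B)) /\
    (forall C rho : R, 0 < C -> 0 < rho ->
       (forall f, exp_car k f -> nrm (T f) <= C * exp_norm k rho f) ->
       exists2 M : R, 0 < M &
         forall (m j : nat) P B, (m <= j)%N -> pcar Th j P -> @polar_form R E j P B ->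
           pnorm Th (j - m) (contraction T m B) <=
             C * M ^+ j * rho ^- m * weight k m * pnorm Th j P).

Definition borel (m : nat) (T : (E -> R[i]) -> R[i]) : dual E -> R[i] :=
  fun phi => T (fun x => phi x ^+ m).

Definition pcar' (m : nat) : set (dual E -> R[i]) :=
  borel m @` sn_dual (pspace m).

(* ||B T||_{Theta'} = ||T||; for a pi_1 type all T with borel m T = Q agree on
   P_Theta(^m E), so the choice of T does not matter. *)
Definition pnorm' (m : nat) (Q : dual E -> R[i]) : R :=
  opnorm (pcar Th m) (pnorm Th m)
    (xget (fun=> 0) [set T | sn_dual (pspace m) T /\ borel m T = Q]).

Definition Exp' (q : R) : set (dual E -> R[i]) :=
  [set f | [/\ entire f, forall j, pcar' j (dhat j f 0) &
     exists2 rho : R, 0 < rho & cvgn (series (fun j =>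
       rho ^- j * weight q%:E j * pnorm' j (taylor_coef f j)))]].

Definition conv_op (k : \bar R) (L : (E -> R[i]) -> E -> R[i]) : Prop :=
  sn_endo (Exp0 k) L /\
  forall (a : E) f, exp_car k f ->
    (fun x => dhat 1 (L f) x a) = L (fun x => dhat 1 f x a).

End Types.

Definition division_closed (R : realType) (V : normedModType R[i])
    (F : set (V -> R[i])) : Prop :=
  forall f g h : V -> R[i], F f -> F g -> g <> 0 -> entire h ->
    (forall x, f x = h x * g x) -> F h.

Definition cexp (R : realType) (z : R[i]) : R[i] :=
  limn (series [sequence z ^+ n / n`!%:R]_n).

Definition exp_solutions (R : realType) (E : normedModType R[i])
    (Th : poly_spaces E) (k : \bar R) (L : (E -> R[i]) -> E -> R[i]) :
    set (E -> R[i]) :=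
  [set f | [/\ exp_car Th k f,
     (exists (n : nat) (P : E -> R[i]) (phi : dual E),
        pcar Th n P /\ f = (fun x => P x * cexp (phi x))) & L f = 0]].

(* Main.v *)
Require Import Defs.
From mathcomp Require Import all_boot all_order all_algebra.
From mathcomp Require Import complex perm.
From mathcomp Require Import all_classical all_reals all_analysis.
From mathcomp Require Import ring lra.

(** The kernel of L is approximated by solutions P exp phi because every
    continuous functional X that kills these solutions kills the kernel: by the
    Hahn-Banach theorem, applied to one norm of the space, this is the density
    claim.

    A functional T on the space is studied through its Borel transform
    phi -> T (exp phi) on the dual of E.  It is entire, its Taylor terms are the
    Borel transforms of the restrictions of T / j! to the j-homogeneous
    polynomials ([borel_line], [borel_tcoef]), and it determines T, since powers
    of functionals are dense among the polynomials of each degree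
    ([borel_injective]).  The weights for k and for its conjugate exponent
    multiply to j! up to geometric factors ([weight_conjugate]), and therefore the
    transforms of functionals are exactly the functions with the dual growth
    condition ([borel_in_Exp'], [Exp'_functional]).

    Let G be the transform of g -> L g 0.  Since L commutes with directional
    derivatives, L (exp phi) satisfies the first-order equations of a multiple of
    exp phi, so L (exp phi) = G(phi) exp phi ([op_expdual]).  Expanding in powers
    of z at phi + z psi shows that L (psi^n exp phi) = 0 for n < d if G vanishes to
    the order d at phi in the direction psi ([op_expmon]).  These functions are
    thus solutions; X kills them, and the values X (psi^n exp phi) / n! are the
    Taylor coefficients of the transform F of X along the same line.  Hence F vanishes on
    each line to at least the order of G ([borel_ord]), the quotient h = F / G is
    entire ([line_division]), by closedness under division it satisfies the dual
    growth condition, and it is the transform of some functional S.  The functional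
    g -> X g - S (L g) has the transform F - h G = 0, so X = S o L vanishes on the
    kernel of L ([vanish_on_kernel]).  If G = 0, all exponentials are solutions and
    X = 0.

    The complex analysis is done without contour integrals.  A function is
    holomorphic near a disc in the sense of [apx] if polynomials approximate it
    uniformly there, and Taylor coefficients are computed by means over the
    vertices of regular polygons, which are exact for polynomials
    ([avg_poly]).  This yields Cauchy's estimates, and then division of entire
    functions on a disc by removing the finitely many zeros of the divisor
    ([ent_division]).  In a normed space, a locally bounded function that is
    holomorphic on complex lines has an expansion into homogeneous polynomials,
    polarized by its iterated directional derivatives ([line_holo_entire]).  The
    quotient F / G is recovered from its values on small circles on which G has no
    zero, where it depends holomorphically on the centre ([local_quotient]). *)

Set Implicit Arguments.
Unset Strict Implicit.
Unset Printing Implicit Defensive.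

Import Order.TTheory GRing.Theory Num.Theory numFieldNormedType.Exports.

Local Open Scope classical_set_scope.
Local Open Scope ring_scope.

(** * Norms of complex numbers and convergence *)

Section ComplexNorm.
Variable R : realType.
Implicit Types (x y z : R[i]) (u v : nat -> R[i]).

Lemma nrm0 (V : normedModType R[i]) : nrm (0 : V) = 0.
Proof. by rewrite /nrm normr0. Qed.

Lemma nrmN (V : normedModType R[i]) (x : V) : nrm (- x) = nrm x.
Proof. by rewrite /nrm normrN. Qed.

Lemma nrm_eq0 (V : normedModType R[i]) (x : V) : (nrm x == 0) = (x == 0).
Proof.
apply/eqP/eqP => [h|->]; last exact: nrm0.
by apply/normr0_eq0; rewrite -nrmE h.
Qed.

Lemma nrmB (V : normedModType R[i]) (x y : V) : nrm (x - y) <= nrm x + nrm y.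
Proof. by rewrite (le_trans (nrmD _ _))// nrmN. Qed.

Lemma nrm_distC (V : normedModType R[i]) (x y : V) : nrm (x - y) = nrm (y - x).
Proof. by rewrite -nrmN opprB. Qed.

Lemma nrm_tri (V : normedModType R[i]) (x y z : V) :
  nrm (x - z) <= nrm (x - y) + nrm (y - z).
Proof. by apply: le_trans (nrmD _ _); rewrite addrA subrK. Qed.

Lemma nrm_subl (V : normedModType R[i]) (x y : V) : nrm x - nrm y <= nrm (x - y).
Proof. by rewrite lerBlDr (le_trans _ (nrmD _ _))// subrK. Qed.

Lemma nrm_sum (V : normedModType R[i]) (I : Type) (s : seq I) (P : pred I) (F : I -> V) :
  nrm (\sum_(i <- s | P i) F i) <= \sum_(i <- s | P i) nrm (F i).
Proof.
elim/big_ind2 : _ => //; first by rewrite nrm0.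
by move=> a b c d ab cd; apply: (le_trans (nrmD _ _)); exact: lerD.
Qed.

Lemma nrm1 : nrm (1 : R[i]) = 1.
Proof. by rewrite /nrm normr1. Qed.

Lemma nrmM x y : nrm (x * y) = nrm x * nrm y.
Proof. exact: nrmZ. Qed.

Lemma nrmX x n : nrm (x ^+ n) = nrm x ^+ n.
Proof. by elim: n => [|n IH]; rewrite ?expr0 ?nrm1// !exprS nrmM IH. Qed.

Lemma nrmV x : nrm x^-1 = (nrm x)^-1.
Proof.
have [->|x0] := eqVneq x 0; first by rewrite invr0 nrm0 invr0.
have nx : nrm x != 0 by rewrite nrm_eq0.
by apply: (mulfI nx); rewrite -nrmM !divff// nrm1.
Qed.

Lemma nrm_gt0 (V : normedModType R[i]) (x : V) : (0 < nrm x) = (x != 0).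
Proof. by rewrite lt_neqAle nrm_ge0 andbT eq_sym nrm_eq0. Qed.

Lemma nrm_small_eq0 (V : normedModType R[i]) (x : V) :
  (forall e : R, 0 < e -> nrm x <= e) -> x = 0.
Proof.
move=> h; apply/eqP; rewrite -nrm_eq0 eq_le nrm_ge0 andbT.
by apply/ler_addgt0Pr => e e0; rewrite add0r h.
Qed.

Lemma nrm_small_eq (V : normedModType R[i]) (x y : V) :
  (forall e : R, 0 < e -> nrm (x - y) <= e) -> x = y.
Proof. by move=> h; apply/eqP; rewrite -subr_eq0; apply/eqP; exact: nrm_small_eq0. Qed.

Lemma mulr_fit (C d : R) : 0 <= C -> 0 <= d -> C * (d / (C + 1)) <= d.
Proof.
move=> C0 d0; have C1 : 0 < C + 1 by rewrite ltr_wpDl.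
by rewrite mulrCA ler_piMr// ler_pdivrMr// mul1r lerDl.
Qed.

Lemma nrmc (r : R) : nrm r%:C%C = `|r|.
Proof. by rewrite /nrm normc_def/= expr0n addr0 sqrtr_sqr. Qed.

Lemma nrm_nat (n : nat) : nrm (n%:R : R[i]) = n%:R.
Proof. by rewrite -(rmorph_nat (real_complex R)) nrmc normr_nat. Qed.

Lemma Re_le_nrm z : `|complex.Re z| <= nrm z.
Proof. by rewrite -lecR nrmE; exact: normc_ge_Re. Qed.

Lemma Im_le_nrm z : `|complex.Im z| <= nrm z.
Proof.
have -> : complex.Im z = complex.Re (z * - 'i%C) by case: z => a b /=; ring.
rewrite (le_trans (Re_le_nrm _))// nrmM nrmN.
have -> : nrm ('i%C : R[i]) = 1.
  by rewrite /nrm normc_def/= expr0n expr1n add0r sqrtr1.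
by rewrite mulr1.
Qed.

Lemma nrm_le_ReIm z : nrm z <= `|complex.Re z| + `|complex.Im z|.
Proof.
rewrite {1}(complexE z) (le_trans (nrmD _ _))// nrmc lerD2l nrmM nrmc.
have -> : nrm ('i%C : R[i]) = 1.
  by rewrite /nrm normc_def/= expr0n expr1n add0r sqrtr1.
by rewrite mul1r.
Qed.

(** The norm of a complex normed space takes its values in the complex numbers;
    measuring the distance by nrm gives estimates in the ordered field R. *)
Definition ncvg (V : normedModType R[i]) (u : nat -> V) (l : V) :=
  forall e : R, 0 < e -> exists n0, forall n, (n0 <= n)%N -> nrm (u n - l) <= e.

Lemma complex_complete u :
  (forall e : R, 0 < e -> exists n0, forall m n, (n0 <= m)%N -> (n0 <= n)%N ->
     nrm (u m - u n) <= e) -> exists l, ncvg u l.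
Proof.
move=> cu.
have real_part (p : R[i] -> R) : (forall x y, p (x - y) = p x - p y) ->
    (forall x, `|p x| <= nrm x) -> cvgn (p \o u).
  move=> pB pn; apply/cauchy_cvgP/cauchy_ballP => e e0; near_simpl.
  have [n0 hn0] := cu (e / 2) (divr_gt0 e0 (ltr0n _ 2)).
  exists ([set n | (n0 <= n)%N], [set n | (n0 <= n)%N]); first by split; exists n0.
  move=> [m n] [/= m0 nn0]; rewrite /ball/= -pB.
  apply: (le_lt_trans (pn _)); apply: (le_lt_trans (hn0 _ _ m0 nn0)).
  by rewrite ltr_pdivrMr// ltr_pMr// ltr1n.
have ReB x y : complex.Re (x - y) = complex.Re x - complex.Re y by case: x; case: y.
have ImB x y : complex.Im (x - y) = complex.Im x - complex.Im y by case: x; case: y.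
have cr := real_part _ ReB Re_le_nrm; have ci := real_part _ ImB Im_le_nrm.
exists (Complex (limn (@complex.Re R \o u)) (limn (@complex.Im R \o u))) => e e0.
have e20 : 0 < e / 2 by rewrite divr_gt0.
have /cvgrPdist_le/(_ _ e20)[n1 _ h1] := cr.
have /cvgrPdist_le/(_ _ e20)[n2 _ h2] := ci.
exists (maxn n1 n2) => n; rewrite geq_max => /andP[/h1 + /h2] /=.
rewrite distrC => a1; rewrite distrC => a2.
apply: (le_trans (nrm_le_ReIm _)); rewrite ReB ImB/= [leRHS]splitr; exact: lerD.
Qed.

Lemma ncvg_unique (V : normedModType R[i]) (u : nat -> V) l l' :
  ncvg u l -> ncvg u l' -> l = l'.
Proof.
move=> h h'; apply: nrm_small_eq => e e0.
have e20 : 0 < e / 2 by rewrite divr_gt0.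
have [n1 h1] := h _ e20; have [n2 h2] := h' _ e20.
rewrite (le_trans (nrm_tri _ (u (maxn n1 n2)) _))// [leRHS]splitr lerD//.
  by rewrite nrm_distC h1// leq_maxl.
by rewrite h2// leq_maxr.
Qed.

Lemma ncvg_le (V : normedModType R[i]) (u : nat -> V) l (c : V) (M : R) :
  ncvg u l -> (exists n0, forall n, (n0 <= n)%N -> nrm (u n - c) <= M) -> nrm (l - c) <= M.
Proof.
move=> h [n0 h0]; apply/ler_addgt0Pr => e e0.
have [n1 h1] := h _ e0.
rewrite (le_trans (nrm_tri _ (u (maxn n0 n1)) _))// addrC lerD//.
  by rewrite h0// leq_maxl.
by rewrite nrm_distC h1// leq_maxr.
Qed.

Lemma ncvg_lin (a : R[i]) u v l l' : ncvg u l -> ncvg v l' -> ncvg (fun n => a * u n + v n) (a * l + l').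
Proof.
move=> hu hv e e0; have a1 : 0 < nrm a + 1 by rewrite ltr_wpDl ?nrm_ge0.
have [n1 h1] := hu _ (divr_gt0 (divr_gt0 e0 (ltr0n R 2)) a1).
have [n2 h2] := hv _ (divr_gt0 e0 (ltr0n R 2)).
exists (maxn n1 n2) => n; rewrite geq_max => /andP[/h1 a2 /h2 a3].
have -> : a * u n + v n - (a * l + l') = a * (u n - l) + (v n - l') by ring.
rewrite (le_trans (nrmD _ _))// [leRHS]splitr lerD// nrmM (le_trans (ler_wpM2l (nrm_ge0 _) a2))//.
by rewrite mulr_fit ?nrm_ge0 ?divr_ge0 ?(ltW e0).
Qed.

End ComplexNorm.

(** * Discrete Cauchy integrals *)

Section Averages.
Variable R : realType.
Implicit Types (a c z w : R[i]) (f g : R[i] -> R[i]) (p : {poly R[i]}).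

(** A primitive root of unity of order 2^(k+1): its 2^k-th power is -1. *)
Definition rou (k : nat) : R[i] := (2 ^ k)%N.-root (-1).

Lemma rouX k : rou k ^+ (2 ^ k)%N = -1.
Proof. by rewrite rootCK// expn_gt0. Qed.

Lemma rou_order k : rou k ^+ (2 ^ k.+1)%N = 1.
Proof. by rewrite expnSr exprM rouX sqrrN expr1n. Qed.

Lemma nrm_rou k : nrm (rou k) = 1.
Proof.
apply/eqP; rewrite -(@pexpr_eq1 _ _ (2 ^ k.+1)%N) ?nrm_ge0 ?expn_gt0//.
by rewrite -nrmX rou_order nrm1.
Qed.

Lemma rou_neq0 k : rou k != 0.
Proof. by rewrite -nrm_eq0 nrm_rou oner_eq0. Qed.

Lemma rou_neq1 k j : ~~ (2 ^ k.+1 %| j)%N -> rou k ^+ j != 1.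
Proof.
move=> kj; apply/eqP => wj1.
have j0 : (0 < j)%N by case: j kj {wj1} => //; rewrite dvdn0.
have [m m2 jE] := pfactor_coprime (isT : prime 2) j0.
have ak : (logn 2 j <= k)%N.
  by rewrite leqNgt; apply: contra kj => kj; rewrite pfactor_dvdn.
have : rou k ^+ (j * 2 ^ (k - logn 2 j))%N = 1 by rewrite exprM wj1 expr1n.
rewrite {1}jE -mulnA -expnD subnKC// mulnC exprM rouX -signr_odd.
have -> : odd m by rewrite -coprime2n.
by rewrite expr1 => /eqP; rewrite eq_sym -subr_eq0 opprK (pnatr_eq0 _ 2).
Qed.

Lemma rou_sum k j :
  \sum_(l < 2 ^ k.+1) (rou k ^+ l) ^+ j =
    if (2 ^ k.+1 %| j)%N then (2 ^ k.+1)%N%:R else 0.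
Proof.
case: ifPn => [/dvdnP[m ->]|/rou_neq1 w1].
  rewrite (eq_bigr (fun=> 1)); first by rewrite sumr_const card_ord.
  by move=> l _; rewrite mulnC exprM [X in X ^+ m]exprAC rou_order !expr1n.
apply: (mulfI (_ : rou k ^+ j - 1 != 0)); first by rewrite subr_eq0.
rewrite mulr0 (eq_bigr (fun l : 'I__ => (rou k ^+ j) ^+ l)); last first.
  by move=> l _; rewrite exprAC.
by rewrite -subrX1 exprAC rou_order expr1n subrr.
Qed.

(** The mean of f(z) / z^n over the 2^(k+1) points of a regular polygon on the
    circle through c: a discrete Cauchy integral, exact on polynomials of
    degree smaller than the number of vertices. *)
Definition avg (k : nat) f c (n : nat) : R[i] :=
  (2 ^ k.+1)%N%:R^-1 * \sum_(l < 2 ^ k.+1) f (c * rou k ^+ l) / (c * rou k ^+ l) ^+ n.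

(** Summing the powers w^(i + N - n) over the N-th roots of unity w selects the
    index i = n, and N > i, n excludes any other multiple of N. *)
Lemma avg_poly k p c n : c != 0 -> (size p <= 2 ^ k.+1)%N -> (n < 2 ^ k.+1)%N ->
  avg k (horner p) c n = p`_n.
Proof.
move=> c0 sp nk; rewrite /avg.
have N0 : (2 ^ k.+1)%N%:R != 0 :> R[i] by rewrite pnatr_eq0 -lt0n expn_gt0.
set N := (2 ^ k.+1)%N in N0 *.
have w0 l : rou k ^+ l != 0 by rewrite expf_neq0// rou_neq0.
have E (l : 'I_N) : p.[c * rou k ^+ l] / (c * rou k ^+ l) ^+ n =
    \sum_(i < N) p`_i * c ^+ i / c ^+ n * (rou k ^+ l) ^+ (i + (N - n)).
  rewrite (horner_coef_wide _ sp) mulr_suml; apply: eq_bigr => i _.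
  have -> : (rou k ^+ l) ^+ (i + (N - n)) = (rou k ^+ l) ^+ i / (rou k ^+ l) ^+ n.
    apply: (mulIf (expf_neq0 n (w0 l))); rewrite divfK ?expf_neq0 ?rou_neq0//.
    by rewrite -exprD -addnA subnK 1?ltnW// exprD [X in _ * X]exprAC rou_order expr1n mulr1.
  rewrite !exprMn; field; by rewrite !expf_neq0// rou_neq0.
rewrite (eq_bigr _ (fun l _ => E l)) exchange_big/=.
under eq_bigr do rewrite -mulr_sumr rou_sum.
rewrite (bigD1 (Ordinal nk))//= big1 ?addr0.
  rewrite subnKC 1?ltnW// dvdnn; field; by rewrite ?N0 ?c0 ?expf_neq0.
move=> i ni; case: ifPn => [|_]; last by rewrite mulr0.
move=> /dvdnP[[|[|m]]].
- by rewrite mul0n => /eqP; rewrite addn_eq0 subn_eq0 leqNgt nk andbF.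
- rewrite mul1n => iN; case/eqP: ni; apply: val_inj => /=; apply/eqP.
  by rewrite -(eqn_add2r (N - n)) iN subnKC// ltnW.
- move=> iN; have : (i + (N - n) < N + N)%N.
    by rewrite (leq_ltn_trans (leq_add (leqnn i) (leq_subr n N)))// ltn_add2r ltn_ord.
  by rewrite iN addnn -mul2n ltn_mul2r andbF.
Qed.

Lemma nrm_vertex k c l : nrm (c * rou k ^+ l) = nrm c.
Proof. by rewrite nrmM nrmX nrm_rou expr1n mulr1. Qed.

Lemma avg_bound k f c n (M : R) :
  (forall z, nrm z = nrm c -> nrm (f z) <= M) -> nrm (avg k f c n) <= M / nrm c ^+ n.
Proof.
move=> fM; rewrite /avg nrmM nrmV nrm_nat.
have N0 : (0 : R) < (2 ^ k.+1)%N%:R by rewrite ltr0n expn_gt0.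
rewrite ler_pdivrMl// (le_trans (nrm_sum _ _ _))//.
rewrite (le_trans (ler_sum _ (_ : forall i, true -> _ <= M / nrm c ^+ n)))//.
  by move=> i _; rewrite nrmM nrmV nrmX nrm_vertex ler_wpM2r ?invr_ge0 ?exprn_ge0 ?nrm_ge0// fM// nrm_vertex.
by rewrite sumr_const card_ord mulr_natl.
Qed.

Lemma avg_lin k a f g c n :
  avg k (fun z => a * f z + g z) c n = a * avg k f c n + avg k g c n.
Proof.
rewrite /avg mulrCA -mulrDr; congr (_ * _); rewrite mulr_sumr -big_split/=.
by apply: eq_bigr => l _; rewrite mulrDl mulrA.
Qed.

Lemma avgB k f g c n : avg k (fun z => f z - g z) c n = avg k f c n - avg k g c n.
Proof.
have -> : (fun z => f z - g z) = (fun z => -1 * g z + f z).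
  by apply/funext => z; rewrite mulN1r addrC.
by rewrite avg_lin mulN1r addrC.
Qed.

Lemma avg_dist k f g c n (M : R) :
  (forall z, nrm z = nrm c -> nrm (f z - g z) <= M) ->
  nrm (avg k f c n - avg k g c n) <= M / nrm c ^+ n.
Proof. by move=> fg; rewrite -avgB; exact: avg_bound. Qed.

Lemma ltn_pow2 n : (n < 2 ^ n.+1)%N.
Proof. by apply: (@ltn_trans n.+1) => //; apply: ltn_expl. Qed.

(** Cauchy's estimate: the discrete integral with enough vertices is exact. *)
Lemma poly_coef_bound p c n (M : R) : c != 0 ->
  (forall z, nrm z = nrm c -> nrm p.[z] <= M) -> nrm p`_n <= M / nrm c ^+ n.
Proof.
move=> c0 pM; rewrite -(@avg_poly (maxn n (size p)) p c n)//; first exact: avg_bound.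
  by rewrite (leq_trans (leq_maxr n _))// ltnW// ltn_pow2.
by rewrite (leq_ltn_trans (leq_maxl n (size p)))// ltn_pow2.
Qed.

End Averages.

(** * Uniform limits of polynomials on a disc *)

Section Approximable.
Variable R : realType.
Implicit Types (c z w : R[i]) (f g : R[i] -> R[i]) (p : {poly R[i]}) (r e M : R).

(** Holomorphy near the closed disc of radius r, in the form of Runge: f is a
    uniform limit of polynomials there.  Products, translations, inverses and
    uniform limits of such functions are immediate, with no double series. *)
Definition apx f r := forall e, 0 < e ->
  exists p, forall z, nrm z <= r -> nrm (f z - p.[z]) <= e.

Lemma apx_ext f g r : (forall z, nrm z <= r -> f z = g z) -> apx f r -> apx g r.
Proof.
move=> fg af e e0; have [p hp] := af e e0.
by exists p => z zr; rewrite -fg//; exact: hp.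
Qed.

Lemma apx_le f r r' : r' <= r -> apx f r -> apx f r'.
Proof.
move=> rr af e e0; have [p hp] := af e e0.
by exists p => z zr; apply: hp; exact: le_trans rr.
Qed.

Lemma apx_poly p r : apx (horner p) r.
Proof. by move=> e e0; exists p => z _; rewrite subrr nrm0 ltW. Qed.

Lemma apx_cst c r : apx (fun=> c) r.
Proof. by apply: apx_ext (@apx_poly c%:P r) => z _; rewrite hornerC. Qed.

Lemma apx_id r : apx (fun z => z) r.
Proof. by apply: apx_ext (@apx_poly 'X r) => z _; rewrite hornerX. Qed.

Lemma apx_lim f r :
  (forall e, 0 < e -> exists2 g, apx g r & forall z, nrm z <= r -> nrm (f z - g z) <= e) ->
  apx f r.
Proof.
move=> h e e0; have e20 : 0 < e / 2 by rewrite divr_gt0.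
have [g ag fg] := h _ e20; have [p hp] := ag _ e20.
exists p => z zr; rewrite (le_trans (nrm_tri _ (g z) _))// [leRHS]splitr.
by rewrite lerD ?fg ?hp.
Qed.

Lemma apxD f g r : apx f r -> apx g r -> apx (fun z => f z + g z) r.
Proof.
move=> af ag e e0; have e20 : 0 < e / 2 by rewrite divr_gt0.
have [p hp] := af _ e20; have [q hq] := ag _ e20.
exists (p + q) => z zr; rewrite hornerD opprD addrACA (le_trans (nrmD _ _))//.
by rewrite [leRHS]splitr lerD ?hp ?hq.
Qed.

Lemma horner_bound p r : 0 <= r ->
  exists2 M, 0 <= M & forall z, nrm z <= r -> nrm p.[z] <= M.
Proof.
move=> r0; exists (\sum_(i < size p) nrm p`_i * r ^+ i).
  by apply: sumr_ge0 => i _; rewrite mulr_ge0 ?nrm_ge0 ?exprn_ge0.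
move=> z zr; rewrite horner_coef (le_trans (nrm_sum _ _ _))//.
by apply: ler_sum => i _; rewrite nrmM nrmX ler_wpM2l ?nrm_ge0// lerXn2r ?nnegrE ?nrm_ge0.
Qed.

Lemma apx_bounded f r : apx f r ->
  exists2 M, 0 <= M & forall z, nrm z <= r -> nrm (f z) <= M.
Proof.
move=> af; have [p hp] := af 1 ltr01.
have [r0|r0] := leP 0 r; last first.
  by exists 0 => // z zr; have := nrm_ge0 z; rewrite leNgt (le_lt_trans zr r0).
have [M M0 hM] := horner_bound p r0.
exists (1 + M) => [|z zr]; first by rewrite addr_ge0.
rewrite -[f z](subrK p.[z]) (le_trans (nrmD _ _))// lerD ?hp ?hM//.
Qed.

Lemma apxM f g r : apx f r -> apx g r -> apx (fun z => f z * g z) r.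
Proof.
move=> af ag; have [M M0 fM] := apx_bounded af.
move=> e e0.
have pos K : 0 <= K -> 0 < e / (2 * (K + 1)).
  by move=> K0; rewrite divr_gt0// mulr_gt0// ltr_wpDl.
have [q hq] := ag _ (pos M M0).
have [K K0 qK] : exists2 K, 0 <= K & forall z, nrm z <= r -> nrm q.[z] <= K.
  exact: apx_bounded (@apx_poly q r).
have [p hp] := af _ (pos K K0).
exists (p * q) => z zr; rewrite hornerM.
have -> : f z * g z - p.[z] * q.[z] = f z * (g z - q.[z]) + (f z - p.[z]) * q.[z] by ring.
rewrite (le_trans (nrmD _ _))// !nrmM [leRHS]splitr.
have half K' : 0 <= K' -> K' * (e / (2 * (K' + 1))) <= e / 2.
  move=> K'0; rewrite mulrA ler_pdivrMr; last by rewrite mulr_gt0// ltr_wpDl.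
  by rewrite mulrA divfK ?pnatr_eq0// mulrC ler_wpM2l ?ltW// ltrDl.
apply: lerD.
  apply: le_trans (half _ M0); apply: ler_pM => //; rewrite ?nrm_ge0 ?fM ?hq//.
by apply: le_trans (half _ K0); rewrite mulrC ler_pM ?nrm_ge0 ?qK ?hp.
Qed.

Lemma apxZ c f r : apx f r -> apx (fun z => c * f z) r.
Proof. by move=> af; apply: apxM => //; exact: apx_cst. Qed.

Lemma apxB f g r : apx f r -> apx g r -> apx (fun z => f z - g z) r.
Proof.
move=> af ag; apply: (@apx_ext (fun z => f z + -1 * g z)) => [z _|].
  by rewrite mulN1r.
by apply: apxD => //; exact: apxZ.
Qed.

Lemma apxX f n r : apx f r -> apx (fun z => f z ^+ n) r.
Proof.
move=> af; elim: n => [|n IH].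
  by apply: apx_ext (@apx_cst 1 r) => z _; rewrite expr0.
by apply: apx_ext (apxM af IH) => z _; rewrite exprS.
Qed.

Lemma apx_sum (I : Type) (s : seq I) (F : I -> R[i] -> R[i]) r :
  (forall i, apx (F i) r) -> apx (fun z => \sum_(i <- s) F i z) r.
Proof.
move=> aF; elim: s => [|i s IH].
  by apply: apx_ext (@apx_cst 0 r) => z _; rewrite big_nil.
by apply: apx_ext (apxD (aF i) IH) => z _; rewrite big_cons.
Qed.

Lemma apx_affine f (a b : R[i]) r r' : nrm a + nrm b * r' <= r -> apx f r ->
  apx (fun z => f (a + b * z)) r'.
Proof.
move=> ab af e e0; have [p hp] := af e e0.
exists (p \Po (a%:P + b *: 'X)) => z zr.
rewrite horner_comp hornerD hornerC hornerZ hornerX; apply: hp.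
apply: le_trans ab; rewrite (le_trans (nrmD _ _))// lerD2l nrmM.
by rewrite ler_wpM2l ?nrm_ge0.
Qed.

Lemma geometric_tail (t : R) m n : 0 <= t < 1 ->
  \sum_(m <= i < n) t ^+ i <= t ^+ m / (1 - t).
Proof.
move=> /andP[t0 t1]; have t1' : 0 < 1 - t by rewrite subr_gt0.
rewrite ler_pdivlMr// mulrC.
have [mn|nm] := leqP m n; last first.
  by rewrite big_geq ?mulr0 ?exprn_ge0// ltnW.
have -> : \sum_(m <= i < n) t ^+ i = t ^+ m * \sum_(i < n - m) t ^+ i.
  rewrite -{1}(add0n m) big_addn big_mkord mulr_sumr.
  by apply: eq_bigr => i _; rewrite exprD mulrC.
rewrite mulrCA ler_piMr ?exprn_ge0//.
have -> : (1 - t) * \sum_(i < n - m) t ^+ i = 1 - t ^+ (n - m).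
  by rewrite -[RHS]opprB subrX1 -mulNr opprB.
by rewrite gerBl exprn_ge0.
Qed.

(** The Taylor series of f at 0, with the Cauchy estimates and the geometric
    control of its remainders on the disc of radius r. *)
Definition pseries f (a : nat -> R[i]) r M :=
  (forall n, nrm (a n) * r ^+ n <= M) /\
  forall z N, nrm z < r -> nrm (f z - \sum_(n < N) a n * z ^+ n) <=
    M * ((nrm z / r) ^+ N / (1 - nrm z / r)).

Lemma ratio_bounds r z : 0 < r -> nrm z < r -> 0 <= nrm z / r < 1.
Proof. by move=> r0 zr; rewrite divr_ge0 ?nrm_ge0 ?(ltW r0)//= ltr_pdivrMr// mul1r. Qed.

(** By Cauchy's estimate the coefficients of approximating polynomials form
    Cauchy sequences. *)
Lemma apx_coefs f r : 0 < r -> apx f r -> exists a : nat -> R[i],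
  forall e, 0 < e -> exists p, (forall z, nrm z <= r -> nrm (f z - p.[z]) <= e) /\
    forall n, nrm (p`_n - a n) * r ^+ n <= 2 * e.
Proof.
move=> r0 af.
have [p hp] : exists p : nat -> {poly R[i]}, forall i z, nrm z <= r ->
    nrm (f z - (p i).[z]) <= i.+1%:R^-1.
  have /choice[p hp] : forall i : nat, exists q : {poly R[i]}, forall z, nrm z <= r ->
      nrm (f z - q.[z]) <= i.+1%:R^-1.
    by move=> i; apply: af; rewrite invr_gt0 ltr0n.
  by exists p.
have nr : nrm (r%:C%C : R[i]) = r by rewrite nrmc gtr0_norm.
have rc0 : r%:C%C != 0 :> R[i] by rewrite -nrm_eq0 nr gt_eqF.
have pij i j n : nrm ((p i)`_n - (p j)`_n) * r ^+ n <= i.+1%:R^-1 + j.+1%:R^-1.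
  rewrite -ler_pdivlMr ?exprn_gt0// -coefB -{1}nr.
  apply: (@poly_coef_bound R (p i - p j) _ n _ rc0) => z; rewrite nr => zr.
  rewrite hornerD hornerN (le_trans (nrm_tri _ (f z) _))// lerD//.
    by rewrite nrm_distC hp// zr.
  by rewrite hp// zr.
have inv_small e : 0 < e -> exists k, forall i, (k <= i)%N -> i.+1%:R^-1 <= e.
  move=> e0; exists (Num.truncn e^-1) => i ki.
  rewrite -[leRHS]invrK lef_pV2 ?posrE ?invr_gt0// ltW// (lt_le_trans (truncnS_gt _))//.
  by rewrite ler_nat ltnS.
have /choice[a ha] : forall n, exists l, ncvg (fun i => (p i)`_n) l.
  move=> n; apply: complex_complete => e e0.
  have er0 : 0 < e * r ^+ n / 2 by rewrite divr_gt0// mulr_gt0// exprn_gt0.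
  have [k hk] := inv_small _ er0.
  exists k => i j ki kj; rewrite -(ler_pM2r (exprn_gt0 n r0)).
  by rewrite (le_trans (pij i j n))// [leRHS]splitr lerD ?hk.
exists a => e e0; have [k hk] := inv_small e e0.
exists (p k); split=> [z zr|n]; first by rewrite (le_trans (hp k z zr))// hk.
rewrite -ler_pdivlMr ?exprn_gt0// nrm_distC.
apply: ncvg_le (ha n) _; exists k => i ki.
rewrite ler_pdivlMr ?exprn_gt0// (le_trans (pij i k n))//.
by rewrite mulr_natl mulr2n lerD ?hk.
Qed.

(** The difference of f and its N-th partial sum is compared with the tail of an
    approximating polynomial p, whose coefficients are bounded by (M + d) / r^n
    with the same d that bounds f - p. *)
Lemma apx_pseries f r M : 0 < r -> apx f r ->
  (forall z, nrm z = r -> nrm (f z) <= M) -> exists a, pseries f a r M.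
Proof.
move=> r0 af fM; have [a ha] := apx_coefs r0 af; exists a.
have nr : nrm (r%:C%C : R[i]) = r by rewrite nrmc gtr0_norm.
have rc0 : r%:C%C != 0 :> R[i] by rewrite -nrm_eq0 nr gt_eqF.
have pM e (p : {poly R[i]}) n : (forall z, nrm z <= r -> nrm (f z - p.[z]) <= e) ->
    nrm p`_n * r ^+ n <= M + e.
  move=> hp; rewrite -ler_pdivlMr ?exprn_gt0// -{1}nr.
  apply: (@poly_coef_bound R p _ n _ rc0) => z; rewrite nr => zr.
  have -> : p.[z] = f z - (f z - p.[z]) by rewrite opprB addrC subrK.
  by rewrite (le_trans (nrmB _ _))// lerD ?fM ?hp ?zr.
split=> [n|z N zr].
  apply/ler_addgt0Pr => e e0; have [p [hp pa]] := ha (e / 3) (divr_gt0 e0 (ltr0n _ 3)).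
  rewrite -[a n](subKr p`_n) (le_trans (ler_wpM2r (exprn_ge0 _ (ltW r0)) (nrmB _ _)))//.
  rewrite mulrDl (le_trans (lerD (pM _ _ n hp) (pa n)))//; lra.
have /andP[t0 t1] := ratio_bounds r0 zr; set t := nrm z / r in t0 t1 *.
have zt : nrm z = t * r by rewrite /t divfK// gt_eqF.
have t1' : 0 < 1 - t by rewrite subr_gt0.
set B := t ^+ N / (1 - t).
have B0 : 0 <= B by rewrite divr_ge0 ?exprn_ge0// ltW.
apply/ler_addgt0Pr => e e0.
set d := e / (1 + 2 * N%:R + B).
have D0 : 0 < 1 + 2 * N%:R + B by rewrite -addrA ltr_wpDr// addr_ge0// mulr_ge0.
have d0 : 0 < d by rewrite divr_gt0.
have [p [hp pa]] := ha d d0.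
have step n b : nrm (b * z ^+ n) = nrm b * r ^+ n * t ^+ n.
  by rewrite nrmM nrmX zt exprMn -mulrA [r ^+ n * _]mulrC.
have -> : f z - \sum_(n < N) a n * z ^+ n = (f z - p.[z]) +
    \sum_(n < N) (p`_n - a n) * z ^+ n + \sum_(N <= n < maxn N (size p)) p`_n * z ^+ n.
  rewrite (horner_coef_wide _ (leq_maxr N _)) -(big_mkord xpredT (fun n => p`_n * z ^+ n)).
  rewrite (@big_cat_nat _ _ _ N)//=; last exact: leq_maxl.
  rewrite big_mkord; under [X in _ + X + _]eq_bigr do rewrite mulrBl.
  by rewrite sumrB; ring.
apply: (@le_trans _ _ (d + 2 * d * N%:R + (M + d) * B)); last first.
  have -> : d + 2 * d * N%:R + (M + d) * B = M * B + d * (1 + 2 * N%:R + B) by ring.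
  by rewrite lerD2l /d divfK// gt_eqF.
rewrite (le_trans (nrmD _ _))// lerD//.
  rewrite (le_trans (nrmD _ _))// lerD//; first by rewrite hp// ltW.
  rewrite (le_trans (nrm_sum _ _ _))// (le_trans (ler_sum _ (_ : forall n, true -> _ <= 2 * d)))//.
    move=> n _; rewrite step (le_trans _ (pa n))// ler_piMr ?mulr_ge0 ?nrm_ge0 ?exprn_ge0 ?(ltW r0)//.
    by rewrite exprn_ile1// ltW.
  by rewrite sumr_const card_ord mulr_natr.
rewrite (le_trans (nrm_sum _ _ _))//.
have Md0 : 0 <= M + d.
  by apply: le_trans (pM _ _ 0%N hp); rewrite mulr_ge0 ?nrm_ge0 ?exprn_ge0 ?(ltW r0).
apply: (@le_trans _ _ ((M + d) * \sum_(N <= n < maxn N (size p)) t ^+ n)).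
  rewrite mulr_sumr; apply: ler_sum => n _; rewrite step ler_wpM2r ?exprn_ge0//; exact: pM.
by rewrite ler_wpM2l// geometric_tail// t0.
Qed.

Lemma pow_small (t e : R) : 0 <= t < 1 -> 0 < e -> exists N, forall n, (N <= n)%N -> t ^+ n <= e.
Proof.
move=> /andP[t0 t1] e0; have := @cvg_expr R t.
rewrite ger0_norm// => /(_ t1)/cvgrPdist_le/(_ _ e0)[N _ hN].
by exists N => n /hN; rewrite sub0r normrN ger0_norm// exprn_ge0.
Qed.

Lemma pseries_partial f a r M r' : 0 < r -> 0 <= r' < r -> pseries f a r M ->
  forall e, 0 < e -> exists N, forall n z, (N <= n)%N -> nrm z <= r' ->
    nrm (f z - \sum_(i < n) a i * z ^+ i) <= e.
Proof.
move=> r0 /andP[r'0 r'r] [aM fa] e e0; set t := r' / r.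
have t01 : 0 <= t < 1 by rewrite divr_ge0 ?(ltW r0)//= ltr_pdivrMr// mul1r.
have /andP[t0 t1] := t01; have t1' : 0 < 1 - t by rewrite subr_gt0.
have M0 : 0 <= M by apply: le_trans (aM 0%N); rewrite expr0 mulr1 nrm_ge0.
have eM0 : 0 < e * (1 - t) / (M + 1) by rewrite divr_gt0 ?mulr_gt0// ltr_wpDl.
have [N hN] := pow_small t01 eM0.
exists N => n z Nn zr.
have zr' : nrm z < r by exact: le_lt_trans r'r.
have zt : nrm z / r <= t by rewrite ler_wpM2r// invr_ge0 ltW.
have z0 : 0 <= nrm z / r by rewrite divr_ge0 ?nrm_ge0// ltW.
apply: (le_trans (fa z n zr')).
apply: (@le_trans _ _ (M * (t ^+ n / (1 - t)))).
  apply: ler_wpM2l => //; apply: ler_pM; rewrite ?exprn_ge0 ?invr_ge0 ?subr_ge0//.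
  - by rewrite (le_trans zt)// ltW.
  - by rewrite lerXn2r.
  - by rewrite lef_pV2 ?posrE// ?lerD2l ?lerN2// subr_gt0 (le_lt_trans zt).
rewrite mulrA ler_pdivrMr//.
apply: (@le_trans _ _ ((M + 1) * t ^+ n)).
  by rewrite ler_wpM2r ?exprn_ge0// lerDl.
by rewrite mulrC -ler_pdivlMr ?ltr_wpDl// hN.
Qed.

Lemma pseries_apx f a r M r' : 0 < r -> r' < r -> pseries f a r M -> apx f r'.
Proof.
move=> r0 r'r fa; have [r'0|r'0] := leP 0 r'; last first.
  move=> e e0; exists 0 => z zr; have := nrm_ge0 z.
  by rewrite leNgt (le_lt_trans zr r'0).
apply: apx_lim => e e0; have [N hN] := pseries_partial r0 (introT andP (conj r'0 r'r)) fa e0.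
exists (fun z => \sum_(i < N) a i * z ^+ i); last by move=> z; exact: hN.
by apply: apx_sum => i; apply: apxM; [exact: apx_cst|apply: apxX; exact: apx_id].
Qed.

Lemma pseries0 f a r M : 0 < r -> pseries f a r M -> f 0 = a 0%N.
Proof.
move=> r0 [_ /(_ 0 1%N)]; rewrite nrm0 => /(_ r0).
rewrite big_ord1 expr0 mulr1 mul0r expr1 mul0r mulr0 => h.
by apply/eqP; rewrite -subr_eq0 -nrm_eq0 eq_le h nrm_ge0.
Qed.

Lemma complex_of_nrm (r : R) : 0 <= r -> exists z : R[i], nrm z = r.
Proof. by move=> r0; exists r%:C%C; rewrite nrmc ger0_norm. Qed.

(** If the coefficients agree below n, the two remainders give
    |a n - b n| |z|^n = O(|z|^(n+1)) on small circles.  The values at 0 are not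
    compared, so that singularities can be removed. *)
Lemma pseries_unique f g a b r r' M M' d : 0 < r -> 0 < r' -> 0 < d ->
  pseries f a r M -> pseries g b r' M' ->
  (forall z, z != 0 -> nrm z < d -> f z = g z) -> a =1 b.
Proof.
move=> r0 r'0 d0 fa gb fg n.
elim/ltn_ind: n => n IH.
have bound h (c : nat -> R[i]) s K : 0 < s -> pseries h c s K -> exists L, 0 <= L /\
    forall z, nrm z <= s / 2 -> nrm (h z - \sum_(i < n.+1) c i * z ^+ i) <= L * nrm z ^+ n.+1.
  move=> s0 [cK hc].
  have K0 : 0 <= K by apply: le_trans (cK 0%N); rewrite expr0 mulr1 nrm_ge0.
  exists (2 * K / s ^+ n.+1); split.
    by rewrite divr_ge0 ?mulr_ge0// exprn_ge0// ltW.
  move=> z zs; apply: (le_trans (hc z n.+1 _)).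
    by rewrite (le_lt_trans zs)// ltr_pdivrMr// ltr_pMr// ltr1n.
  rewrite expr_div_n [leRHS](_ : _ = K * (nrm z ^+ n.+1 / s ^+ n.+1 * 2)); last by ring.
  rewrite ler_wpM2l// ler_wpM2l ?divr_ge0 ?exprn_ge0 ?nrm_ge0 ?(ltW s0)//.
  have h2 : nrm z / s <= 1 / 2 by rewrite ler_pdivrMr// mulrC mulrA mulr1.
  rewrite -[leRHS]invrK lef_pV2 ?posrE ?invr_gt0//; lra.
have [L [L0 hL]] := bound _ _ _ _ r0 fa; have [L' [L'0 hL']] := bound _ _ _ _ r'0 gb.
apply: nrm_small_eq => e e0.
pose s := Num.min (Num.min (r / 2) (r' / 2)) (Num.min (d / 2) (e / (L + L' + 1))).
have LL0 : 0 < L + L' + 1 by rewrite ltr_wpDl// addr_ge0.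
have s0 : 0 < s by rewrite !lt_min !divr_gt0.
have [z zs] := complex_of_nrm (ltW s0).
have z0 : z != 0 by rewrite -nrm_eq0 zs gt_eqF.
have zr : nrm z <= r / 2 by rewrite zs /s !ge_min lexx.
have zr' : nrm z <= r' / 2 by rewrite zs /s !ge_min lexx orbT.
have zd : nrm z < d.
  have d2 : d / 2 < d by rewrite ltr_pdivrMr// ltr_pMr// ltr1n.
  by rewrite zs /s !gt_min d2 !orbT.
have ze : nrm z * (L + L' + 1) <= e.
  by rewrite -ler_pdivlMr// zs /s !ge_min lexx !orbT.
apply: le_trans ze.
have zn0 : 0 < nrm z ^+ n by rewrite zs exprn_gt0.
rewrite -(ler_pM2r zn0) -nrmX -nrmM mulrBl.
have -> : a n * z ^+ n - b n * z ^+ n = (g z - \sum_(i < n.+1) b i * z ^+ i) -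
    (f z - \sum_(i < n.+1) a i * z ^+ i).
  have ab : \sum_(i < n) a i * z ^+ i = \sum_(i < n) b i * z ^+ i.
    by apply: eq_bigr => i _; rewrite IH.
  by rewrite !big_ord_recr/= ab (fg z z0 zd); ring.
rewrite (le_trans (nrmB _ _))// (le_trans (lerD (hL' z zr') (hL z zr)))//.
rewrite nrmX -mulrDl exprS mulrA ler_wpM2r ?exprn_ge0 ?nrm_ge0//.
by rewrite mulrC ler_wpM2l ?nrm_ge0// addrC lerDl.
Qed.

End Approximable.

(** * Series with bounded sums *)

Section RealSeries.
Variable R : realType.
Implicit Types (u b : nat -> R) (M : R).

Lemma geom_sum_le n : \sum_(i < n) (1 / 2 : R) ^+ i <= 2.
Proof.
rewrite -(big_mkord xpredT (fun i => (1 / 2 : R) ^+ i)).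
have t01 : 0 <= (1 / 2 : R) < 1 by lra.
rewrite (le_trans (geometric_tail 0 n t01))// expr0 mul1r.
rewrite -[leRHS]invrK lef_pV2 ?posrE ?invr_gt0//; lra.
Qed.

Lemma series_bounded_cvg u M : (forall n, 0 <= u n) ->
  (forall n, \sum_(i < n) u i <= M) -> cvgn (series u) /\ limn (series u) <= M.
Proof.
move=> u0 uM.
have cu : cvgn (series u).
  apply: nondecreasing_is_cvgn; first exact: nondecreasing_series.
  by exists M => _ [n _ <-]; rewrite /series/= big_mkord.
split=> //; apply: limr_le => //; near=> n; rewrite /series/= big_mkord; exact: uM.
Unshelve. all: by end_near. Qed.

Lemma series_partial_le u n : (forall n, 0 <= u n) -> cvgn (series u) ->
  \sum_(i < n) u i <= limn (series u).
Proof.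
move=> u0 cu; have := nondecreasing_cvgn_le (nondecreasing_series (fun n _ _ => u0 n)) cu n.
by rewrite /series/= big_mkord.
Qed.

Lemma series_term_le u n : (forall n, 0 <= u n) -> cvgn (series u) -> u n <= limn (series u).
Proof.
move=> u0 cu; apply: le_trans (series_partial_le n.+1 u0 cu).
by rewrite big_ord_recr/= lerDr sumr_ge0.
Qed.

Lemma dyadic_sum u M : 0 <= M -> (forall n, u n <= M * (1 / 2) ^+ n) ->
  forall n, \sum_(i < n) u i <= 2 * M.
Proof.
move=> M0 uM n; apply: (@le_trans _ _ (M * \sum_(i < n) (1 / 2) ^+ i)).
  by rewrite mulr_sumr; apply: ler_sum => i _; exact: uM.
by rewrite mulrC ler_wpM2r// geom_sum_le.
Qed.

Lemma cvg_series_bounded u : (forall n, 0 <= u n) -> cvgn (series u) -> exists M, forall n, u n <= M.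
Proof. by move=> u0 cu; exists (limn (series u)) => n; exact: series_term_le. Qed.

End RealSeries.

Section AbsoluteConvergence.
Variable R : realType.
Implicit Types (t u v : nat -> R[i]).

Lemma abs_summable_cvg t (B : R) : (forall n, \sum_(j < n) nrm (t j) <= B) ->
  exists l, ncvg (fun n => \sum_(j < n) t j) l.
Proof.
move=> tB; apply: complex_complete => e e0.
have t0 n : 0 <= nrm (t n) by exact: nrm_ge0.
have [ct _] := series_bounded_cvg t0 tB.
have /cvgrPdist_le/(_ _ e0)[N _ hN] := ct; exists N.
have est m n : (N <= m)%N -> (m <= n)%N -> nrm (\sum_(j < n) t j - \sum_(j < m) t j) <= e.
  move=> Nm mn; rewrite -!(big_mkord xpredT t) (@big_cat_nat _ _ _ m 0 n)//=.
  rewrite addrAC subrr add0r (le_trans (nrm_sum _ _ _))//.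
  have := hN m Nm; rewrite ger0_norm; last first.
    by rewrite subr_ge0 /series/= big_mkord; exact: series_partial_le.
  apply: le_trans; rewrite lerBrDr.
  have := series_partial_le n t0 ct; apply: le_trans.
  by rewrite /series/= -(big_mkord xpredT (fun j => nrm (t j))) (@big_cat_nat _ _ _ m 0 n)//= addrC.
move=> m n Nm Nn; have [mn|/ltnW nm] := leqP m n; last exact: est.
by rewrite nrm_distC est.
Qed.

End AbsoluteConvergence.

(** * Taylor coefficients in one variable *)

Section Coefficients.
Variable R : realType.
Implicit Types (c z w : R[i]) (f g : R[i] -> R[i]) (p : {poly R[i]}) (r e M : R).

(** The coefficients of the Taylor series of f at 0, whenever f has one. *)
Definition cf f : nat -> R[i] :=
  xget (fun=> 0) [set a | exists r M, 0 < r /\ pseries f a r M].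

Lemma cf_eq f a r M : 0 < r -> pseries f a r M -> cf f =1 a.
Proof.
move=> r0 fa; have [|r' [M' [r'0 fb]]] :=
  @xgetPex _ (fun=> 0) [set a | exists r M, 0 < r /\ pseries f a r M]; first by exists a, r, M.
exact: (pseries_unique r'0 r0 ltr01 fb fa).
Qed.

Lemma cfP f r M : 0 < r -> apx f r -> (forall z, nrm z = r -> nrm (f z) <= M) ->
  pseries f (cf f) r M.
Proof.
move=> r0 af fM; have [a fa] := apx_pseries r0 af fM.
by have -> : cf f = a by apply/funext; exact: cf_eq fa.
Qed.

Lemma apx_circle f r : apx f r ->
  exists2 M, 0 <= M & forall z, nrm z = r -> nrm (f z) <= M.
Proof.
by case/apx_bounded=> M M0 fM; exists M => // z zr; rewrite fM// zr.
Qed.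

Lemma cf_bound f r M n : 0 < r -> apx f r -> (forall z, nrm z = r -> nrm (f z) <= M) ->
  nrm (cf f n) * r ^+ n <= M.
Proof. by move=> r0 af fM; have [] := cfP r0 af fM. Qed.

Lemma cf0 f r : 0 < r -> apx f r -> cf f 0%N = f 0.
Proof.
move=> r0 af; have [M _ fM] := apx_circle af.
by rewrite (pseries0 r0 (cfP r0 af fM)).
Qed.

Lemma cf_near f g r r' d : 0 < r -> 0 < r' -> 0 < d -> apx f r -> apx g r' ->
  (forall z, z != 0 -> nrm z < d -> f z = g z) -> cf f =1 cf g.
Proof.
move=> r0 r'0 d0 af ag fg.
have [M _ fM] := apx_circle af; have [M' _ gM] := apx_circle ag.
exact: (pseries_unique r0 r'0 d0 (cfP r0 af fM) (cfP r'0 ag gM) fg).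
Qed.

Lemma apx_eq0 f g r r' d : 0 < r -> 0 < r' -> 0 < d -> apx f r -> apx g r' ->
  (forall z, z != 0 -> nrm z < d -> f z = g z) -> f 0 = g 0.
Proof.
by move=> r0 r'0 d0 af ag /(cf_near r0 r'0 d0 af ag) /(_ 0%N); rewrite (cf0 r0)// (cf0 r'0).
Qed.

Lemma apx_cf0 f r : 0 < r -> apx f r -> (forall n, cf f n = 0) ->
  forall z, nrm z < r -> f z = 0.
Proof.
move=> r0 af f0 z zr; have [M _ fM] := apx_circle af.
apply: nrm_small_eq0 => e e0.
have zz : 0 <= nrm z < r by rewrite nrm_ge0.
have [N /(_ N z (leqnn _) (lexx _))] := pseries_partial r0 zz (cfP r0 af fM) e0.
by rewrite big1 ?subr0// => i _; rewrite f0 mul0r.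
Qed.

(** A maximum principle with a constant, which the geometric series gives for
    free and which suffices for counting zeros. *)
Lemma weak_max_principle f r M : 0 < r -> apx f r ->
  (forall z, nrm z = r -> nrm (f z) <= M) ->
  forall z, nrm z < r -> nrm (f z) <= M / (1 - nrm z / r).
Proof.
move=> r0 af fM z zr; have [_ /(_ z 0%N zr)] := cfP r0 af fM.
by rewrite big_ord0 subr0 expr0 mul1r.
Qed.

(** Aliasing error of the discrete Cauchy integral: with more and more vertices
    it converges to the Taylor coefficient, at a rate that depends on f only
    through its bound M. *)
Lemma avg_cf f r M c n k : 0 < r -> apx f r ->
  (forall z, nrm z = r -> nrm (f z) <= M) -> c != 0 -> nrm c < r -> (n < 2 ^ k.+1)%N ->
  nrm (avg k f c n - cf f n) <=
    M * ((nrm c / r) ^+ (2 ^ k.+1) / (1 - nrm c / r)) / nrm c ^+ n.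
Proof.
move=> r0 af fM c0 cr nk; have [_ fa] := cfP r0 af fM.
set N := (2 ^ k.+1)%N in nk fa *.
set p := \poly_(i < N) cf f i.
have -> : cf f n = avg k (horner p) c n.
  by rewrite avg_poly// ?size_poly// coef_poly nk.
apply: avg_dist => z zc; rewrite -zc.
have -> : p.[z] = \sum_(i < N) cf f i * z ^+ i by rewrite horner_poly.
by apply: fa; rewrite zc.
Qed.

Lemma avg_lim f r c n : apx f r -> c != 0 -> nrm c < r -> ncvg (fun k => avg k f c n) (cf f n).
Proof.
move=> af c0 cr e e0; have r0 : 0 < r by apply: le_lt_trans cr; exact: nrm_ge0.
have [M M0 fM] := apx_circle af.
have t01 := ratio_bounds r0 cr; set t := nrm c / r in t01.
have /andP[t0 t1] := t01; have t1' : 0 < 1 - t by rewrite subr_gt0.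
have cn0 : 0 < nrm c ^+ n by rewrite exprn_gt0// nrm_gt0.
have e1 : 0 < e * nrm c ^+ n * (1 - t) / (M + 1).
  by rewrite divr_gt0 ?mulr_gt0// ltr_wpDl.
have [N hN] := pow_small t01 e1; exists (maxn N n) => k; rewrite geq_max => /andP[Nk nk].
have kk : (k < 2 ^ k.+1)%N by exact: ltn_pow2.
apply: le_trans (avg_cf r0 af fM c0 cr (leq_ltn_trans nk kk)) _.
rewrite ler_pdivrMr// mulrA ler_pdivrMr// -/t.
have := hN _ (leq_trans Nk (ltnW kk)); rewrite ler_pdivlMr ?ltr_wpDl// mulrC.
by apply: le_trans; rewrite ler_wpM2r ?exprn_ge0// lerDl.
Qed.

Arguments avg_lim {f r c} n _ _ _ _ _.

Lemma ncvg_cst (V : normedModType R[i]) (u : nat -> V) l :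
  (exists n0, forall n, (n0 <= n)%N -> u n = l) -> ncvg u l.
Proof.
by move=> [n0 h] e e0; exists n0 => n /h ->; rewrite subrr nrm0 ltW.
Qed.

Lemma small_point r : 0 < r -> exists c : R[i], c != 0 /\ nrm c < r.
Proof.
move=> r0; have [c cr] := complex_of_nrm (ltW (divr_gt0 r0 (ltr0n R 2))).
exists c; split; first by rewrite -nrm_gt0 cr divr_gt0.
by rewrite cr ltr_pdivrMr// ltr_pMr// ltr1n.
Qed.

Lemma cf_poly p n : cf (horner p) n = p`_n.
Proof.
have [c [c0 c1]] := small_point ltr01.
apply: (ncvg_unique (avg_lim n (apx_poly p 1) c0 c1)).
apply: ncvg_cst; exists (maxn n (size p)) => k; rewrite geq_max => /andP[nk pk].
have kk : (k < 2 ^ k.+1)%N by exact: ltn_pow2.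
by rewrite avg_poly// ?(leq_ltn_trans nk)// (leq_trans pk)// ltnW.
Qed.

Lemma cf_lin (a : R[i]) f g r n : 0 < r -> apx f r -> apx g r ->
  cf (fun z => a * f z + g z) n = a * cf f n + cf g n.
Proof.
move=> r0 af ag; have [c [c0 cr]] := small_point r0.
apply: (ncvg_unique (avg_lim n (apxD (apxZ a af) ag) c0 cr)).
rewrite (_ : (fun k => _) = (fun k => a * avg k f c n + avg k g c n)).
  exact: (ncvg_lin a (avg_lim n af c0 cr) (avg_lim n ag c0 cr)).
by apply/funext => k; exact: avg_lin.
Qed.

Lemma cfB f g r n : 0 < r -> apx f r -> apx g r ->
  cf (fun z => f z - g z) n = cf f n - cf g n.
Proof.
move=> r0 af ag; have -> : (fun z => f z - g z) = (fun z => -1 * g z + f z).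
  by apply/funext => z; rewrite mulN1r addrC.
by rewrite (cf_lin _ n r0 ag af) mulN1r addrC.
Qed.

Lemma cf_dist f g r M n : 0 < r -> apx f r -> apx g r ->
  (forall z, nrm z = r -> nrm (f z - g z) <= M) -> nrm (cf f n - cf g n) * r ^+ n <= M.
Proof.
by move=> r0 af ag fg; rewrite -(cfB n r0 af ag); apply: cf_bound (apxB af ag) _.
Qed.

Lemma cf_mulX f r n m : 0 < r -> apx f r -> cf (fun z => z ^+ m * f z) (m + n) = cf f n.
Proof.
move=> r0 af; have [c [c0 cr]] := small_point r0.
have azf : apx (fun z => z ^+ m * f z) r by apply: apxM => //; apply: apxX; exact: apx_id.
apply: (ncvg_unique (avg_lim (m + n) azf c0 cr)).
suff E k : avg k (fun z => z ^+ m * f z) c (m + n) = avg k f c n.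
  by move=> e /(avg_lim n af c0 cr _)[k0 h]; exists k0 => k /h; rewrite E.
rewrite /avg; congr (_ * _); apply: eq_bigr => l _.
have w0 : c * rou R k ^+ l != 0 by rewrite mulf_neq0// expf_neq0// rou_neq0.
by rewrite exprD invfM; field; rewrite !expf_neq0.
Qed.

Lemma cf_mulX_lt f r n m : 0 < r -> apx f r -> (n < m)%N -> cf (fun z => z ^+ m * f z) n = 0.
Proof.
move=> r0 af nm; have [M M0 fM] := apx_bounded af.
have azf : apx (fun z => z ^+ m * f z) r by apply: apxM => //; apply: apxX; exact: apx_id.
apply: nrm_small_eq0 => e e0.
pose s := Num.min (Num.min r 1) (e / (M + 1)).
have M1 : 0 < M + 1 by rewrite ltr_wpDl.
have s0 : 0 < s by rewrite !lt_min r0 ltr01 divr_gt0.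
have sr : s <= r by rewrite /s !ge_min lexx.
have s1 : s <= 1 by rewrite /s !ge_min lexx !orbT.
have se : s * (M + 1) <= e by rewrite -ler_pdivlMr// /s !ge_min lexx !orbT.
rewrite -(ler_pM2r (exprn_gt0 n s0)).
apply: (@le_trans _ _ (s ^+ m * M)).
  apply: cf_bound => //; first exact: apx_le azf.
  by move=> z zs; rewrite nrmM nrmX zs ler_wpM2l ?exprn_ge0 ?(ltW s0)// fM// zs.
rewrite -(subnK nm) addnS exprS exprD mulrAC.
apply: (@le_trans _ _ (s * M * s ^+ n)); last first.
  by rewrite ler_wpM2r ?exprn_ge0 ?(ltW s0)// (le_trans _ se)// ler_wpM2l ?lerDl// ltW.
rewrite ler_wpM2l ?mulr_ge0// ?(ltW s0)// ler_piMl ?exprn_ge0 ?(ltW s0)//.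
by rewrite exprn_ile1// ltW.
Qed.

(** Removable singularity: f / z^m has the coefficients of f shifted by m. *)
Lemma apx_divX f r r' m : 0 < r -> apx f r -> (forall i, (i < m)%N -> cf f i = 0) -> r' < r ->
  apx (fun z => if z == 0 then cf f m else f z / z ^+ m) r'.
Proof.
move=> r0 af f0 r'r; have [M M0 fM] := apx_bounded af.
have [aM fa] : pseries f (cf f) r M by apply: cfP => // z zr; rewrite fM// zr.
have rm0 : 0 < r ^+ m by rewrite exprn_gt0.
apply: (@pseries_apx _ _ (fun n => cf f (m + n)) r (M / r ^+ m)) => //; split=> [n|z N zr].
  by rewrite ler_pdivlMr// -mulrA -exprD addnC.
have t01 := ratio_bounds r0 zr.
have tt : 0 <= M / r ^+ m * ((nrm z / r) ^+ N / (1 - nrm z / r)).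
  case/andP: t01 => t0 t1.
  by rewrite mulr_ge0 ?divr_ge0 ?exprn_ge0 ?subr_ge0 ?nrm_ge0 ?(ltW t1) ?(ltW r0).
case: eqVneq => [z0|z0].
  case: N tt => [|N] tt.
    rewrite big_ord0 subr0 z0 nrm0 mul0r expr0 subr0 divr1 mulr1 ler_pdivlMr//; exact: aM.
  rewrite big_ord_recl expr0 mulr1 addn0 big1 ?addr0 ?subrr ?nrm0//.
  by move=> i _; rewrite z0 expr0n mulr0.
have zm0 : 0 < nrm z ^+ m by rewrite exprn_gt0// nrm_gt0.
rewrite -(ler_pM2r zm0) -nrmX -nrmM mulrBl divfK ?expf_neq0//.
have -> : (\sum_(i < N) cf f (m + i) * z ^+ i) * z ^+ m = \sum_(i < m + N) cf f i * z ^+ i.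
  rewrite big_split_ord/= [X in _ = X + _]big1 ?add0r; last first.
    by move=> i _; rewrite f0// mul0r.
  by rewrite mulr_suml; apply: eq_bigr => i _; rewrite -mulrA -exprD addnC.
rewrite (le_trans (fa z (m + N)%N zr))// nrmX exprD le_eqVlt; apply/orP; left; apply/eqP.
rewrite !expr_div_n; clear -r0 zr; move: (nrm z) zr => t tr; field.
by rewrite !expf_neq0 ?gt_eqF ?subr_gt0.
Qed.

End Coefficients.
Arguments avg_lim {R f r c} n _ _ _ _ _.

(** * Division of entire functions of one variable *)

Section Division.
Variable R : realType.
Implicit Types (c z w : R[i]) (f g : R[i] -> R[i]) (p : {poly R[i]}) (r e M : R).

Lemma bolzano_weierstrass (u : nat -> R[i]) r : (forall n, nrm (u n) <= r) ->
  exists2 l, nrm l <= r & forall d n0, 0 < d -> exists2 n, (n0 <= n)%N & nrm (u n - l) <= d.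
Proof.
move=> ur.
pose K := `[- r, r]%classic `*` `[- r, r]%classic : set (R * R)%type.
have cK : compact K by apply: compact_setX; exact: segment_compact.
pose F := (fun n => (complex.Re (u n), complex.Im (u n))) @ \oo.
have KF : F K.
  exists 0%N => // n _; split; rewrite /= in_itv/= -ler_norml.
    exact: le_trans (Re_le_nrm _) (ur n).
  exact: le_trans (Im_le_nrm _) (ur n).
have [[a b] [Kab]] := cK F _ KF; rewrite cluster_cvgE => -[G PG [Gab FG]].
have close d n0 : 0 < d -> exists2 n, (n0 <= n)%N & nrm (u n - Complex a b) <= d.
  move=> d0; have d20 : 0 < d / 2 by rewrite divr_gt0.
  have nb : G (ball (a, b) (d / 2)) by apply: Gab; exact: nbhsx_ballx.
  have nt : G [set (complex.Re (u n), complex.Im (u n)) | n in [set n | (n0 <= n)%N]].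
    by apply: FG; exists n0 => // n /= nn; exists n.
  have [x [/= [ba bb] [n /= nn nE]]] := filter_ex (filterI nb nt).
  exists n => //; rewrite (le_trans (nrm_le_ReIm _))// [leRHS]splitr.
  move: ba bb; rewrite -nE /ball/= => ba bb.
  have ReB : complex.Re (u n - Complex a b) = complex.Re (u n) - a by case: (u n).
  have ImB : complex.Im (u n - Complex a b) = complex.Im (u n) - b by case: (u n).
  by rewrite ReB ImB lerD// distrC ltW.
exists (Complex a b) => //; apply/ler_addgt0Pr => e e0.
have [n _ un] := close e 0%N e0.
rewrite -[Complex a b](subKr (u n)) (le_trans (nrmB _ _))// lerD//.
Qed.

Lemma poly_lipschitz p r : 0 <= r -> exists2 K, 0 <= K & forall z w,
  nrm z <= r -> nrm w <= r -> nrm (p.[z] - p.[w]) <= K * nrm (z - w).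
Proof.
move=> r0; elim/poly_ind: p => [|p c [K K0 IH]].
  by exists 0 => // z w _ _; rewrite !horner0 subrr nrm0 mul0r.
have [M M0 pM] := horner_bound p r0.
exists (r * K + M) => [|z w zr wr]; first by rewrite addr_ge0// mulr_ge0.
rewrite !hornerE.
have -> : p.[z] * z + c - (p.[w] * w + c) = z * (p.[z] - p.[w]) + p.[w] * (z - w) by ring.
rewrite (le_trans (nrmD _ _))// !nrmM mulrDl lerD//.
  by rewrite -mulrA ler_pM ?nrm_ge0 ?IH.
by rewrite ler_wpM2r ?nrm_ge0 ?pM.
Qed.

Lemma apx_unifcont f r : 0 <= r -> apx f r -> forall e, 0 < e -> exists2 d, 0 < d &
  forall z w, nrm z <= r -> nrm w <= r -> nrm (z - w) <= d -> nrm (f z - f w) <= e.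
Proof.
move=> r0 af e e0; have e30 : 0 < e / 3 by rewrite divr_gt0.
have [p hp] := af _ e30; have [K K0 pK] := poly_lipschitz p r0.
have K1 : 0 < K + 1 by rewrite ltr_wpDl.
exists (e / 3 / (K + 1)) => [|z w zr wr zw]; first by rewrite divr_gt0.
have pzw : nrm (p.[z] - p.[w]) <= e / 3.
  rewrite (le_trans (pK z w zr wr))// (le_trans (ler_wpM2l K0 zw))//.
  by rewrite mulr_fit ?nrm_ge0 ?(ltW e30).
have -> : f z - f w = (f z - p.[z]) + (p.[z] - p.[w]) - (f w - p.[w]) by ring.
rewrite (le_trans (nrmB _ _))// (le_trans (lerD (nrmD _ _) (hp w wr)))//.
have := hp z zr; lra.
Qed.

Lemma zero_free_min f r : 0 <= r -> apx f r -> (forall z, nrm z <= r -> f z != 0) ->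
  exists2 m, 0 < m & forall z, nrm z <= r -> m <= nrm (f z).
Proof.
move=> r0 af f0; apply: contrapT => nomin.
have small (n : nat) : exists z, nrm z <= r /\ nrm (f z) < n.+1%:R^-1.
  apply: contrapT => no; apply: nomin; exists n.+1%:R^-1; first by rewrite invr_gt0.
  by move=> z zr; rewrite leNgt; apply/negP => fz; apply: no; exists z.
have [u hu] := choice small.
have [l lr ul] := bolzano_weierstrass (fun n => (hu n).1).
have /eqP := f0 l lr; apply; apply: nrm_small_eq0 => e e0.
have e20 : 0 < e / 2 by rewrite divr_gt0.
have [d d0 fd] := apx_unifcont r0 af e20.
have [n ne un] := ul d (Num.truncn (e / 2)^-1) d0.
have [ur fu] := hu n.
have := fd _ _ ur lr un; rewrite nrm_distC => h.
rewrite -[f l](subrK (f (u n))) (le_trans (nrmD _ _))// [leRHS]splitr lerD//.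
rewrite (le_trans (ltW fu))// -[leRHS]invrK lef_pV2 ?posrE ?invr_gt0//.
by rewrite ltW// (lt_le_trans (truncnS_gt _))// ler_nat ltnS.
Qed.

(** The partial sums of the geometric series converge uniformly. *)
Lemma apx_geometric h r : apx h r -> (forall z, nrm z <= r -> nrm (h z) <= 1 / 2) ->
  apx (fun z => (1 - h z)^-1) r.
Proof.
move=> ah h2; apply: apx_lim => e e0.
have t01 : 0 <= (1 / 2 : R) < 1 by lra.
have e20 : 0 < e / 2 by rewrite divr_gt0.
have [N /(_ _ (leqnn _)) hN] := pow_small t01 e20.
exists (fun z => \sum_(i < N) h z ^+ i); first by apply: apx_sum => i; exact: apxX.
move=> z zr; have hz := h2 z zr.
have d0 : 1 / 2 <= nrm (1 - h z).
  by have := nrm_subl (1 : R[i]) (h z); rewrite nrm1; lra.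
have dn0 : 1 - h z != 0 by rewrite -nrm_gt0 (lt_le_trans _ d0)// divr_gt0.
have -> : (1 - h z)^-1 - \sum_(i < N) h z ^+ i = h z ^+ N / (1 - h z).
  apply: (mulIf dn0); rewrite mulrBl mulVf// divfK//.
  rewrite -[X in _ * X]opprB mulrN mulrC -subrX1; ring.
rewrite nrmM nrmX nrmV ler_pdivrMr ?(lt_le_trans _ d0) ?divr_gt0//.
apply: (@le_trans _ _ ((1 / 2) ^+ N)); first by rewrite lerXn2r ?nnegrE ?nrm_ge0.
rewrite (le_trans hN)// ler_wpM2l ?(ltW e0)//; lra.
Qed.

(** The function z -> v (t z) deforms v into the constant v 0 through functions
    that are bounded away from 0.  When t moves by a small fixed amount, the
    inverse changes by a convergent geometric series, so finitely many steps
    lead from the inverse of the constant to the inverse of v. *)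
Lemma apxV v r : 0 <= r -> apx v r -> (forall z, nrm z <= r -> v z != 0) ->
  apx (fun z => (v z)^-1) r.
Proof.
move=> r0 av v0; have [m m0 vm] := zero_free_min r0 av v0.
have m20 : 0 < m / 2 by rewrite divr_gt0.
have [d d0 vd] := apx_unifcont r0 av m20.
pose n := (Num.truncn (r / d)).+1.
have rn : r / n%:R <= d.
  by rewrite ler_pdivrMr ?ltr0n// mulrC -ler_pdivrMr// ltW// truncnS_gt.
pose vt (k : nat) z := v (k%:R / n%:R * z).
have n0 : n%:R != 0 :> R[i] by rewrite pnatr_eq0.
have kn k z : (k <= n)%N -> nrm z <= r -> nrm (k%:R / n%:R * z) <= r.
  move=> kn zr; rewrite nrmM nrmM nrmV !nrm_nat (le_trans _ zr)//.
  by rewrite ler_piMl ?nrm_ge0// ler_pdivrMr ?ltr0n// mul1r ler_nat.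
have avt k : (k <= n)%N -> apx (vt k) r.
  move=> kn'; apply: apx_ext (@apx_affine _ v 0 (k%:R / n%:R) r r _ av).
    by move=> z _; rewrite add0r.
  rewrite nrm0 add0r nrmM nrmV !nrm_nat ler_piMl//.
  by rewrite ler_pdivrMr ?ltr0n// mul1r ler_nat.
suff inv k : (k <= n)%N -> apx (fun z => (vt k z)^-1) r.
  by apply: apx_ext (inv n (leqnn n)) => z _; rewrite /vt divff// mul1r.
elim: k => [_|k IH kn1].
  by apply: apx_ext (@apx_cst _ (v 0)^-1 r) => z _; rewrite /vt mul0r mul0r.
have kn' := ltnW kn1.
pose h z := (vt k z)^-1 * (vt k z - vt k.+1 z).
have nz j z : (j <= n)%N -> nrm z <= r -> vt j z != 0 by move=> jn zr; rewrite v0// kn.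
have ah : apx h r by apply: apxM; [exact: IH|apply: apxB; exact: avt].
have h2 z : nrm z <= r -> nrm (h z) <= 1 / 2.
  move=> zr; rewrite /h nrmM nrmV ler_pdivrMl; last by rewrite nrm_gt0 nz.
  apply: (@le_trans _ _ (m / 2)); last by rewrite mulrCA mul1r ler_wpM2r ?vm ?kn// invr_ge0.
  apply: vd; rewrite ?kn// -mulrBl -mulrBl -natr1 opprD addrA subrr add0r.
  rewrite nrmM nrmM nrmN nrm1 mul1r nrmV nrm_nat (le_trans _ rn)// mulrC.
  by rewrite ler_wpM2r ?invr_ge0.
apply: apx_ext (apxM (IH kn') (apx_geometric ah h2)) => z zr.
have a0 := nz _ z kn' zr; have b0 := nz _ z kn1 zr.
rewrite -invfM; congr (_^-1); rewrite /h mulrBr mulr1 mulVKf//; ring.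
Qed.

Definition ent f := forall r, apx f r.

Lemma ent_shift f c : ent f -> ent (fun z => f (c + z)).
Proof.
move=> ef r; apply: apx_ext (@apx_affine _ f c 1 (nrm c + r) r _ (ef _)).
  by move=> z _; rewrite mul1r.
by rewrite nrm1 mul1r.
Qed.

Lemma ent_sub f c : ent f -> ent (fun z => f (z - c)).
Proof.
by move=> /(ent_shift (- c)) h r; apply: apx_ext (h r) => z _; rewrite addrC.
Qed.

Lemma ent_factor f c m : ent f -> (forall i, (i < m)%N -> cf (fun z => f (c + z)) i = 0) ->
  exists2 g, ent g & forall z, f z = (z - c) ^+ m * g z.
Proof.
move=> ef f0; pose F z := f (c + z).
have eF : ent F by exact: ent_shift.
pose G z := if z == 0 then cf F m else F z / z ^+ m.
have eG : ent G.
  move=> r; have r1 : 0 < Num.max r 0 + 1 by rewrite ltr_wpDl// le_max lexx orbT.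
  apply: (@apx_divX _ F (Num.max r 0 + 1) r m) => //.
  by rewrite ltr_pwDr// le_max lexx.
exists (fun z => G (z - c)); first exact: ent_sub.
move=> z; have FE : f z = F (z - c) by rewrite /F addrC subrK.
rewrite FE /G; case: eqVneq => [->|zc]; last by rewrite mulrC divfK// expf_neq0.
rewrite -(cf0 ltr01 (eF 1)).
by case: m f0 @G eG => [|m] f0 G eG; rewrite ?expr0 ?mul1r// exprS !mul0r f0.
Qed.

Lemma ent_cancel f g c m : ent f -> ent g ->
  (forall z, (z - c) ^+ m * f z = (z - c) ^+ m * g z) -> forall z, f z = g z.
Proof.
move=> ef eg fg z; have [->|zc] := eqVneq z c; last first.
  by apply: (mulfI _ (fg z)); rewrite expf_neq0// subr_eq0.
rewrite -[c]addr0; apply: (apx_eq0 ltr01 ltr01 ltr01 (ent_shift c ef 1) (ent_shift c eg 1)).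
move=> w w0 _; apply: (mulfI _ (fg (c + w))).
by rewrite expf_neq0// [c + w]addrC addrK.
Qed.

(** At each point, f vanishes to at least the order of g.  Stated by factors, it
    passes to the cofactors when a zero is divided out. *)
Definition ord_le g f := forall c m g', ent g' -> (forall z, g z = (z - c) ^+ m * g' z) ->
  exists2 f', ent f' & forall z, f z = (z - c) ^+ m * f' z.

Lemma ent_mulXsub f c m : ent f -> ent (fun z => (z - c) ^+ m * f z).
Proof.
by move=> ef r; apply: apxM => //; apply: apxX; apply: apxB; [exact: apx_id|exact: apx_cst].
Qed.

Lemma ord_le_factor g f c g1 : ent f -> ent g1 -> (forall z, g z = (z - c) * g1 z) ->
  ord_le g f -> exists f1, [/\ ent f1, forall z, f z = (z - c) * f1 z & ord_le g1 f1].
Proof.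
move=> ef eg1 gE gf.
have [f1 ef1 fE] : exists2 f1, ent f1 & forall z, f z = (z - c) ^+ 1 * f1 z.
  by apply: gf eg1 _ => z; rewrite gE expr1.
exists f1; split=> // b m g' eg' g1E.
have [bc|bc] := eqVneq b c.
  rewrite {b}bc in g1E *.
  have [f' ef' f'E] : exists2 f', ent f' & forall z, f z = (z - c) ^+ m.+1 * f' z.
    by apply: gf eg' _ => z; rewrite gE g1E exprS mulrA.
  exists f' => // ; apply: (@ent_cancel f1 (fun z => (z - c) ^+ m * f' z) c 1) => //.
    exact: ent_mulXsub.
  by move=> z; rewrite -fE f'E expr1 exprS mulrA.
have [f' ef' f'E] : exists2 f', ent f' & forall z, f z = (z - b) ^+ m * f' z.
  apply: (gf b m (fun z => (z - c) ^+ 1 * g' z)); first exact: ent_mulXsub.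
  by move=> z; rewrite gE g1E; ring.
have f'c : f' c = 0.
  have := f'E c; rewrite fE subrr mul0r => /esym/eqP; rewrite mulf_eq0 => /orP[|/eqP//].
  by rewrite expf_eq0 subr_eq0 eq_sym (negbTE bc) andbF.
have [f2 ef2 f2E] : exists2 f2, ent f2 & forall z, f' z = (z - c) ^+ 1 * f2 z.
  apply: ent_factor => // -[|//] _; rewrite (cf0 ltr01); first by rewrite addr0.
  exact: ent_shift.
exists f2 => //.
apply: (@ent_cancel f1 (fun z => (z - b) ^+ m * f2 z) c 1) => //; first exact: ent_mulXsub.
by move=> z; rewrite -fE f'E f2E; ring.
Qed.

Definition root_product (s : seq R[i]) z := \prod_(c <- s) (z - c).

(** Jensen-type bound.  On the circle of radius 4 r every factor z - c is at
    least 3 r, so the cofactor g' is small there, hence also at z0 by the maximum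
    principle; at z0 every factor is at most 2 r.  So |g z0| is bounded by a
    constant times (2/3)^n for n zeros. *)
Lemma zeros_bounded g r z0 : ent g -> 0 < r -> nrm z0 <= r -> g z0 != 0 ->
  exists N : nat, forall s g', ent g' -> (forall c, c \in s -> nrm c <= r) ->
    (forall z, g z = root_product s z * g' z) -> (size s <= N)%N.
Proof.
move=> eg r0 z0r gz0.
have r40 : 0 < 4 * r by rewrite mulr_gt0.
have [M M0 gM] := apx_circle (eg (4 * r)).
have t01 : 0 <= (2 / 3 : R) < 1 by lra.
have gz0p : 0 < nrm (g z0) / (2 * (M + 1)) by rewrite divr_gt0 ?nrm_gt0// mulr_gt0// ltr_wpDl.
have gz0p' : 0 < nrm (g z0) / (2 * (M + 1)) / 2 by rewrite divr_gt0.
have [N hN] := pow_small t01 gz0p'; exists N => s g' eg' sr gE.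
rewrite leqNgt; apply/negP => /ltnW /hN small.
have r3 : 0 < (3 * r) ^+ size s by rewrite exprn_gt0// mulr_gt0.
have prod_lb (t : seq R[i]) z b : 0 <= b -> (forall c, c \in t -> b <= nrm (z - c)) ->
    b ^+ size t <= nrm (root_product t z).
  move=> b0; elim: t => [|c t IH] tb; first by rewrite /root_product big_nil nrm1.
  rewrite /root_product big_cons nrmM exprS ler_pM ?exprn_ge0 ?tb ?mem_head// IH// => x xt.
  by rewrite tb// inE xt orbT.
have prod_ub (t : seq R[i]) z b : 0 <= b -> (forall c, c \in t -> nrm (z - c) <= b) ->
    nrm (root_product t z) <= b ^+ size t.
  move=> b0; elim: t => [|c t IH] tb; first by rewrite /root_product big_nil nrm1.
  rewrite /root_product big_cons nrmM exprS ler_pM ?nrm_ge0 ?tb ?mem_head// IH// => x xt.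
  by rewrite tb// inE xt orbT.
have g'M z : nrm z = 4 * r -> nrm (g' z) <= M / (3 * r) ^+ size s.
  move=> zr; rewrite ler_pdivlMr// mulrC (le_trans _ (gM z zr))// gE nrmM.
  rewrite ler_wpM2r ?nrm_ge0// prod_lb ?mulr_ge0 ?(ltW r0)// => c cs.
  have := nrm_subl z c; rewrite zr; have := sr c cs; lra.
have z0r4 : nrm z0 / (4 * r) <= 1 / 4 by rewrite ler_pdivrMr//; lra.
have z04 : nrm z0 < 4 * r by lra.
have g'z0 : nrm (g' z0) <= 2 * (M / (3 * r) ^+ size s).
  apply: (le_trans (weak_max_principle r40 (eg' _) g'M z04)).
  rewrite mulrC ler_wpM2r ?divr_ge0// ?exprn_ge0 ?mulr_ge0 ?(ltW r0)//.
  rewrite -[leRHS]invrK lef_pV2 ?posrE ?invr_gt0//; lra.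
have : nrm (g z0) <= 2 * M * (2 / 3) ^+ size s.
  rewrite gE nrmM.
  apply: (@le_trans _ _ ((2 * r) ^+ size s * (2 * (M / (3 * r) ^+ size s)))).
    apply: ler_pM; rewrite ?nrm_ge0 ?prod_ub ?mulr_ge0 ?(ltW r0)// => c cs.
    have := nrmB z0 c; have := sr c cs; lra.
  rewrite le_eqVlt; apply/orP; left; apply/eqP.
  by rewrite !expr_div_n !exprMn; field; rewrite !expf_neq0 ?gt_eqF.
apply/negP; rewrite -ltNge; apply: (@le_lt_trans _ _ (2 * (M + 1) * (nrm (g z0) / (2 * (M + 1)) / 2))).
  apply: ler_pM => //; rewrite ?mulr_ge0 ?exprn_ge0 ?divr_ge0//; lra.
have D0 : 0 < 2 * (M + 1) by rewrite mulr_gt0// ltr_wpDl.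
rewrite mulrA mulrCA divff ?gt_eqF// mulr1 ltr_pdivrMr// ltr_pMr ?ltr1n// nrm_gt0//.
Qed.

(** A maximal number of zeros of g in the disc is divided out of f and g
    simultaneously; what remains of g has no zero in the disc, so its inverse is
    holomorphic there. *)
Theorem ent_division f g r z0 : ent f -> ent g -> 0 < r -> nrm z0 <= r -> g z0 != 0 ->
  ord_le g f -> exists2 u, apx u r & forall z, nrm z <= r -> f z = u z * g z.
Proof.
move=> ef eg r0 z0r gz0 gf; have [N hN] := zeros_bounded eg r0 z0r gz0.
pose factored n := exists s f' g', [/\ size s = n,
  forall c, c \in s -> nrm c <= r, ent f' & ent g'] /\
  [/\ forall z, f z = root_product s z * f' z, forall z, g z = root_product s z * g' z & ord_le g' f'].
have f0 : exists n, `[< factored n >].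
  exists 0%N; apply/asboolP; exists [::], f, g; split; split=> //;
  by move=> z; rewrite /root_product big_nil mul1r.
have fN n : `[< factored n >] -> (n <= N)%N.
  by move=> /asboolP[s [f' [g' [[<- sr _ eg'] [_ gE _]]]]]; exact: (hN s g').
case: (ex_maxnP f0 fN) => n /asboolP[s [f' [g' [[sn sr ef' eg'] [fE gE gf']]]]] nmax.
have g'0 z : nrm z <= r -> g' z != 0.
  move=> zr; apply/eqP => g'z.
  have [g1 eg1 g1E] : exists2 g1, ent g1 & forall w, g' w = (w - z) ^+ 1 * g1 w.
    apply: ent_factor => // -[|//] _; rewrite (cf0 ltr01); first by rewrite addr0.
    exact: ent_shift.
  have g1E' w : g' w = (w - z) * g1 w by rewrite g1E expr1.
  have [f1 [ef1 f1E gf1]] := ord_le_factor ef' eg1 g1E' gf'.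
  have /nmax : `[< factored n.+1 >]; last by rewrite ltnn.
  apply/asboolP; exists (z :: s), f1, g1; split; split=> //=.
  - by rewrite sn.
  - by move=> c; rewrite inE => /predU1P[->//|]; exact: sr.
  - by move=> w; rewrite fE f1E /root_product big_cons; ring.
  - by move=> w; rewrite gE g1E' /root_product big_cons; ring.
exists (fun z => f' z * (g' z)^-1).
  by apply: apxM => //; apply: apxV (ltW r0) (eg' r) g'0.
by move=> z /g'0 gz; rewrite fE gE; field.
Qed.

End Division.

(** * The topology of a complex normed space *)

Section Topology.
Variable R : realType.

Lemma nrm_ball (V : normedModType R[i]) (x y : V) (r : R) :
  ball x r%:C%C y <-> nrm (y - x) < r.
Proof.
rewrite -ball_normE /ball_/= -nrmE nrm_distC ltcR.
by [].
Qed.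

Lemma posc (e : R[i]) : 0 < e -> exists2 r : R, 0 < r & e = r%:C%C.
Proof.
case: e => a b; rewrite ltcE/= => /andP[/eqP -> a0]; by exists a.
Qed.

Lemma continuous_nrm (V W : normedModType R[i]) (f : V -> W) (x : V) :
  (forall e : R, 0 < e -> exists2 d : R, 0 < d & forall y, nrm (y - x) < d ->
    nrm (f y - f x) <= e) -> {for x, continuous f}.
Proof.
move=> h; apply/cvgrPdist_le => _ /posc[e e0 ->].
have [d d0 hd] := h e e0.
apply/nbhs_ballP; exists d%:C%C; first by rewrite /= ltcR.
move=> y /nrm_ball /hd; by rewrite -nrmE lecR nrm_distC.
Qed.

Lemma nrm_continuous (V W : normedModType R[i]) (f : V -> W) (x : V) :
  {for x, continuous f} -> forall e : R, 0 < e -> exists2 d : R, 0 < d &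
    forall y, nrm (y - x) < d -> nrm (f y - f x) <= e.
Proof.
move=> /cvgrPdist_le h e e0.
have /h/nbhs_ballP[_ /= /posc[d d0 ->] hd] : 0 < e%:C%C by rewrite ltcR.
exists d => // y /nrm_ball /hd /=; by rewrite -nrmE lecR nrm_distC.
Qed.

Lemma uniform_nrm (V : normedModType R[i]) (F : nat -> V -> R[i]) f (a : V) (r : R) :
  {uniform ball a r%:C%C, F @ \oo --> f} <->
  forall e : R, 0 < e -> exists n0, forall n, (n0 <= n)%N ->
    forall x, nrm (x - a) < r -> nrm (F n x - f x) <= e.
Proof.
split=> [h e e0|h U].
  pose U := [set g : {uniform` ball a r%:C%C -> R[i]} |
    forall x, ball a r%:C%C x -> nrm (g x - f x) <= e].
  have /h[n0 _ hn0] : nbhs (f : {uniform` ball a r%:C%C -> R[i]}) U.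
    rewrite uniform_nbhs; exists [set xy | ball xy.1 e%:C%C xy.2]; split.
      by rewrite -entourage_ballE; exists e%:C%C => //=; rewrite ltcR.
    move=> g /= hg x /hg /nrm_ball; exact: ltW.
  by exists n0 => n /hn0 hn x xr; apply: hn; apply/nrm_ball.
rewrite uniform_nbhs => -[E [entE EU]].
have [_ /= /posc[e e0 ->] eE] : exists2 e, 0 < e & [set xy | ball xy.1 e xy.2] `<=` E.
  by move: entE; rewrite -entourage_ballE => -[e /= e0 eE]; exists e.
have e20 : 0 < e / 2 by rewrite divr_gt0.
have [n0 hn0] := h _ e20; exists n0 => // n /= nn; apply: EU => x /nrm_ball xr.
apply: eE => /=; apply/nrm_ball; apply: le_lt_trans (hn0 n nn x xr) _.
by rewrite ltr_pdivrMr// ltr_pMr// ltr1n.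
Qed.

End Topology.

(** * Calculus of Taylor coefficients *)

Section CoefLinear.
Variable R : realType.
Implicit Types (c z w : R[i]) (f g F : R[i] -> R[i]) (p : {poly R[i]}) (r e M : R).

Lemma cf_cst c0 n : cf (fun=> c0) n = if n == 0%N then c0 else 0.
Proof.
have -> : (fun=> c0) = horner c0%:P by apply/funext => z; rewrite hornerC.
by rewrite cf_poly coefC.
Qed.

Lemma cfZ c0 f r n : 0 < r -> apx f r -> cf (fun z => c0 * f z) n = c0 * cf f n.
Proof.
move=> r0 af; have := cf_lin c0 n r0 af (apx_cst 0 r).
rewrite (_ : (fun z => c0 * f z + 0) = (fun z => c0 * f z)).
  by rewrite cf_cst if_same addr0.
by apply/funext => z; rewrite addr0.
Qed.

Lemma cfD f g r n : 0 < r -> apx f r -> apx g r ->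
  cf (fun z => f z + g z) n = cf f n + cf g n.
Proof.
move=> r0 af ag; have := cf_lin 1 n r0 af ag; rewrite mul1r => <-.
by congr (cf _ n); apply/funext => z; rewrite mul1r.
Qed.

Lemma cf_sum (I : Type) (s : seq I) (F : I -> R[i] -> R[i]) r n : 0 < r ->
  (forall i, apx (F i) r) -> cf (fun z => \sum_(i <- s) F i z) n = \sum_(i <- s) cf (F i) n.
Proof.
move=> r0 aF; elim: s => [|i s IH].
  rewrite big_nil; have -> : (fun z => \sum_(i <- [::]) F i z) = (fun=> 0).
    by apply/funext => z; rewrite big_nil.
  by rewrite cf_cst; case: ifP.
rewrite big_cons -IH -(cfD n r0 (aF i) (apx_sum s aF)); congr (cf _ n).
by apply/funext => z; rewrite big_cons.
Qed.

Lemma cf_scale c0 f r n : 0 < r -> apx f r -> cf (fun z => f (c0 * z)) n = c0 ^+ n * cf f n.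
Proof.
move=> r0 af; have [->|c00] := eqVneq c0 0.
  have -> : (fun z => f (0 * z)) = (fun=> f 0) by apply/funext => z; rewrite mul0r.
  by rewrite cf_cst -(cf0 r0 af) expr0n; case: n => [|n]; rewrite ?mul1r ?mul0r.
have nc0 : 0 < nrm c0 by rewrite nrm_gt0.
have [c [c1 cr]] := small_point r0.
have afc : apx (fun z => f (c0 * z)) (r / nrm c0).
  apply: apx_ext (@apx_affine _ f 0 c0 r _ _ af) => [z _|]; first by rewrite add0r.
  by rewrite nrm0 add0r mulrC divfK// gt_eqF.
have cr' : nrm (c / c0) < r / nrm c0 by rewrite nrmM nrmV ltr_pM2r// invr_gt0.
have c10 : c / c0 != 0 by rewrite mulf_neq0// invr_eq0.
apply: (ncvg_unique (avg_lim n afc c10 cr')) => e e0.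
have C0 : 0 < nrm (c0 ^+ n) by rewrite nrm_gt0 expf_neq0.
have [k0 h] := avg_lim n af c1 cr _ (divr_gt0 e0 C0).
exists k0 => k /h hk.
have -> : avg k (fun z => f (c0 * z)) (c / c0) n = c0 ^+ n * avg k f c n.
  rewrite /avg mulrCA; congr (_ * _); rewrite mulr_sumr; apply: eq_bigr => l _.
  have -> : c0 * (c / c0 * rou R k ^+ l) = c * rou R k ^+ l by field.
  by rewrite mulrAC expr_div_n; field; rewrite !expf_neq0 ?mulf_neq0 ?expf_neq0 ?rou_neq0.
by rewrite -mulrBr nrmM (le_trans (ler_wpM2l (nrm_ge0 _) hk))// mulrC divfK// gt_eqF.
Qed.

Lemma cf_avg (F : R[i] -> R[i] -> R[i]) k c n m r : 0 < r ->
  (forall w, nrm w = nrm c -> apx (F w) r) ->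
  cf (fun z => avg k (fun w => F w z) c n) m = avg k (fun w => cf (F w) m) c n.
Proof.
move=> r0 aF; rewrite /avg.
have aF' l : apx (fun z => F (c * rou R k ^+ l) z / (c * rou R k ^+ l) ^+ n) r.
  by apply: apxM; [apply: aF; exact: nrm_vertex|exact: apx_cst].
rewrite (cfZ _ _ r0); last exact: (apx_sum (index_enum _) (fun l : 'I_ _ => aF' l)).
congr (_ * _); rewrite (@cf_sum _ _ (fun l : 'I_ _ => fun z => _) r m r0)//.
apply: eq_bigr => l _.
rewrite [RHS]mulrC -(cfZ _ _ r0); last by apply: aF; exact: nrm_vertex.
by congr (cf _ m); apply/funext => z; rewrite [LHS]mulrC.
Qed.

Lemma remainder_bound f r M z n : 0 < r -> apx f r ->
  (forall z, nrm z = r -> nrm (f z) <= M) -> nrm z <= r / 2 ->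
  nrm (f z - \sum_(i < n) cf f i * z ^+ i) <= 2 * M * (nrm z / r) ^+ n.
Proof.
move=> r0 af fM zr; have [fa0 fa] := cfP r0 af fM.
have M0 : 0 <= M by apply: le_trans (fa0 0%N); rewrite expr0 mulr1 nrm_ge0.
have zr' : nrm z < r by rewrite (le_lt_trans zr)// ltr_pdivrMr// ltr_pMr// ltr1n.
apply: (le_trans (fa z n zr')).
have h2 : nrm z / r <= 1 / 2 by rewrite ler_pdivrMr// mulrC mulrA mulr1.
rewrite [2 * M]mulrC -mulrA ler_wpM2l// mulrC ler_wpM2r ?exprn_ge0 ?divr_ge0 ?nrm_ge0 ?(ltW r0)//.
rewrite -[leRHS]invrK lef_pV2 ?posrE ?invr_gt0//; lra.
Qed.

(** Both claims hold for polynomials, and z -> cf (w -> f (z + w)) 1 depends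
    continuously on f for uniform convergence on a slightly larger disc. *)
Lemma cf_deriv f r n : 0 < r -> apx f r ->
  let f' := fun z => cf (fun w => f (z + w)) 1 in
  apx f' (r / 2) /\ cf f' n = n.+1%:R * cf f n.+1.
Proof.
move=> r0 af f'.
have r20 : 0 < r / 2 by rewrite divr_gt0.
have ashift z g : apx g r -> nrm z <= r / 2 -> apx (fun w => g (z + w)) (r / 2).
  move=> ag zr; apply: apx_ext (@apx_affine _ g z 1 r _ _ ag) => [w _|].
    by rewrite mul1r.
  by rewrite nrm1 mul1r [leRHS]splitr lerD2r.
have f'p e p : (forall z, nrm z <= r -> nrm (f z - p.[z]) <= e) ->
    forall z, nrm z <= r / 2 -> nrm (f' z - p^`().[z]) <= e / (r / 2).
  move=> hp z zr; rewrite ler_pdivlMr//.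
  have -> : p^`().[z] = cf (fun w => p.[z + w]) 1.
    have -> : (fun w => p.[z + w]) = horner (\poly_(i < maxn 2 (size p)) p^`N(i).[z]).
      apply/funext => w; rewrite (@nderiv_taylor_wide _ (maxn 2 (size p))) ?leq_maxr//; last exact: mulrC.
      by rewrite horner_poly.
    by rewrite cf_poly coef_poly leq_max nderivn1.
  rewrite -[r / 2]expr1; apply: cf_dist r20 _ _ _; rewrite ?expr1.
  - exact: ashift.
  - by apply: ashift => //; exact: apx_poly.
  - move=> w wr; apply: hp; rewrite (le_trans (nrmD _ _))// [leRHS]splitr.
    by rewrite lerD// wr.
have af' : apx f' (r / 2).
  move=> e e0; have [p hp] := af _ (mulr_gt0 e0 r20); exists p^`() => z zr.
  by have := f'p _ p hp z zr; rewrite mulfK// gt_eqF.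
split=> //; apply: nrm_small_eq => e e0.
pose A := (r / 2)^-1 / (r / 2) ^+ n + n.+1%:R / r ^+ n.+1.
have A0 : 0 < A by rewrite addr_gt0// divr_gt0 ?invr_gt0 ?exprn_gt0.
have [p hp] := af _ (divr_gt0 e0 A0).
have -> : cf f' n - n.+1%:R * cf f n.+1 =
    (cf f' n - cf (horner p^`()) n) - n.+1%:R * (cf f n.+1 - cf (horner p) n.+1).
  by rewrite !cf_poly coef_deriv -mulr_natl; ring.
rewrite (le_trans (nrmB _ _))// nrmM nrm_nat.
have h1 : nrm (cf f' n - cf (horner p^`()) n) <= (e / A / (r / 2)) / (r / 2) ^+ n.
  rewrite ler_pdivlMr ?exprn_gt0//; apply: cf_dist r20 af' (apx_poly _ _) _ => z zr.
  by apply: f'p hp _ _; rewrite zr.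
have h2 : nrm (cf f n.+1 - cf (horner p) n.+1) <= (e / A) / r ^+ n.+1.
  rewrite ler_pdivlMr ?exprn_gt0//; apply: cf_dist r0 af (apx_poly _ _) _ => z zr.
  by apply: hp; rewrite zr.
apply: (le_trans (lerD h1 (ler_wpM2l (ler0n _ _) h2))).
have -> : e / A / (r / 2) / (r / 2) ^+ n + n.+1%:R * (e / A / r ^+ n.+1) = e / A * A.
  have AE : A = (r / 2)^-1 / (r / 2) ^+ n + n.+1%:R / r ^+ n.+1 by [].
  rewrite [X in _ = _ * X]AE; move: (e / A) => t; ring.
by rewrite divfK// gt_eqF.
Qed.

End CoefLinear.

(** * Holomorphy on lines and directional derivatives *)

Section Osgood.
Variables (R : realType) (V : normedModType R[i]).
Implicit Types (f g : V -> R[i]) (p q b : V) (r e d M : R) (z w : R[i]).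

(** Locally bounded and holomorphic on complex lines, with a radius that is
    locally uniform.  By Osgood's theorem this is holomorphy; it is easier to
    check than the existence of Taylor expansions into homogeneous polynomials. *)
Definition line_holo f := forall p, exists d M, 0 < d /\
  forall q, nrm (q - p) <= d -> nrm (f q) <= M /\
    forall b r, nrm b * r <= d -> apx (fun z => f (q + z *: b)) r.

Lemma line_holo_local f p : line_holo f -> exists d M, [/\ 0 < d, 0 <= M &
  forall q, nrm (q - p) <= d -> forall b r, nrm b * r <= d ->
    apx (fun z => f (q + z *: b)) r /\
    forall z : R[i], nrm z <= r -> nrm (f (q + z *: b)) <= M].
Proof.
move=> /(_ p)[d [M [d0 h]]]; exists (d / 2), M.
have d2 : d / 2 <= d by rewrite ler_pdivrMr// ler_pMr// ler1n.
have M0 : 0 <= M by have [] := h p; rewrite ?subrr ?nrm0 ?(ltW d0)// => /(le_trans (nrm_ge0 _)).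
split=> //; first by rewrite divr_gt0.
move=> q qp b r br; split; first by apply: (h q _).2; exact: le_trans d2.
move=> z zr; apply: (h _ _).1.
rewrite addrAC (le_trans (nrmD _ _))// [leRHS]splitr lerD// nrmZ.
by rewrite (le_trans _ br)// mulrC ler_wpM2l ?nrm_ge0.
Qed.

Lemma line_holo_lip f p : line_holo f -> exists d K, [/\ 0 < d, 0 <= K &
  forall q q', nrm (q - p) <= d -> nrm (q' - p) <= d -> nrm (f q' - f q) <= K * nrm (q' - q)].
Proof.
move=> /(line_holo_local p)[d [M [d0 M0 h]]]; exists (d / 4), (2 * M / d).
split=> [||q q' qp q'p]; [by rewrite divr_gt0|by rewrite divr_ge0 ?mulr_ge0 ?(ltW d0)|].
have [->|qq'] := eqVneq q' q; first by rewrite !subrr !nrm0 mulr0.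
have n0 : 0 < nrm (q' - q) by rewrite nrm_gt0 subr_eq0.
have qd : nrm (q - p) <= d by lra.
have [] := h q qd (q' - q) (d / nrm (q' - q)); first by rewrite mulrC divfK// gt_eqF.
set F := (fun z => _) => aF FM.
have r0 : 0 < d / nrm (q' - q) by rewrite divr_gt0.
have := @remainder_bound _ F _ M 1 1 r0 aF.
rewrite big_ord1 (cf0 r0 aF) expr0 mulr1 /F scale0r addr0 scale1r [q + _]addrC subrK nrm1 expr1.
have -> : 2 * M * (1 / (d / nrm (q' - q))) = 2 * M / d * nrm (q' - q).
  by move: (nrm (q' - q)) n0 => t t0; field; rewrite !gt_eqF.
apply; first by move=> z zr; rewrite FM// zr.
rewrite ler_pdivlMr// mul1r ler_pdivlMr//.
have := nrm_tri q' p q; rewrite (nrm_distC p q); lra.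
Qed.

(** The derivative of f at q in the direction b. *)
Definition dir b f q : R[i] := cf (fun z => f (q + z *: b)) 1.

(** The aliasing error of the discrete Cauchy integrals depends only on a bound
    of f, so they converge to dir b f uniformly near p; dir b f inherits
    holomorphy on lines from them. *)
Lemma dir_avg f p b : line_holo f -> exists d s, [/\ 0 < d, 0 < s, nrm b * s <= d / 2,
  forall q, nrm (q - p) <= d -> forall b r, nrm b * r <= d -> apx (fun z => f (q + z *: b)) r &
  forall c, c != 0 -> nrm c <= s -> forall e, 0 < e -> exists k0, forall k, (k0 <= k)%N ->
    forall q, nrm (q - p) <= d ->
    nrm (dir b f q - avg k (fun z => f (q + z *: b)) c 1) <= e].
Proof.
move=> /(line_holo_local p)[d [M [d0 M0 h]]].
have b1 : 0 < nrm b + 1 by rewrite ltr_wpDl ?nrm_ge0.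
have s0 : 0 < d / (nrm b + 1) by rewrite divr_gt0.
have bs : nrm b * (d / (nrm b + 1)) <= d.
  by rewrite mulr_fit ?nrm_ge0 ?(ltW d0).
exists d, (d / (nrm b + 1) / 2); split=> //.
- by rewrite divr_gt0.
- by rewrite mulrA ler_wpM2r.
- by move=> q qp b' r b'r; have [] := h q qp b' r b'r.
move=> c c0 cs e e0.
have cs' : nrm c < d / (nrm b + 1).
  by rewrite (le_lt_trans cs)// ltr_pdivrMr// ltr_pMr// ltr1n.
have t01 := ratio_bounds s0 cs'; set t := nrm c / _ in t01.
have /andP[t0 t1] := t01; have t1' : 0 < 1 - t by rewrite subr_gt0.
have nc0 : 0 < nrm c by rewrite nrm_gt0.
have e1 : 0 < e * nrm c * (1 - t) / (M + 1).
  by rewrite divr_gt0 ?mulr_gt0// ltr_wpDl.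
have [N hN] := pow_small t01 e1; exists (maxn N 1) => k; rewrite geq_max => /andP[Nk k1] q qp.
have [aF FM] := h q qp b _ bs; rewrite nrm_distC.
have kk : (k < 2 ^ k.+1)%N by exact: ltn_pow2.
have FM' z : nrm z = d / (nrm b + 1) -> nrm (f (q + z *: b)) <= M by move=> zr; rewrite FM// zr.
apply: le_trans (avg_cf s0 aF FM' c0 cs' (leq_ltn_trans k1 kk)) _.
rewrite expr1 ler_pdivrMr// mulrA ler_pdivrMr// -/t.
have := hN _ (leq_trans Nk (ltnW kk)); rewrite ler_pdivlMr ?ltr_wpDl// mulrC.
by apply: le_trans; rewrite ler_wpM2r ?exprn_ge0// lerDl.
Qed.

Lemma avg_line_apx f p d : (forall q, nrm (q - p) <= d -> forall b r, nrm b * r <= d ->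
    apx (fun z => f (q + z *: b)) r) ->
  forall q b b' c r k n, nrm (q - p) <= d / 2 -> nrm b * nrm c <= d / 2 -> nrm b' * r <= d / 2 ->
  apx (fun z => avg k (fun w => f (q + z *: b' + w *: b)) c n) r.
Proof.
move=> h q b b' c r k n qp bc b'r; rewrite /avg; apply: apxM; first exact: apx_cst.
apply: (apx_sum (index_enum _) (F := fun (l : 'I_ _) z => _)) => l.
apply: apxM; last exact: apx_cst.
set w := c * _.
have d0 : d / 2 <= d.
  have : 0 <= d / 2 by apply: le_trans qp; exact: nrm_ge0.
  by move=> hd; rewrite [leRHS]splitr lerDl.
apply: apx_ext (h (q + w *: b) _ b' r (le_trans b'r d0)) => [z _|]; first by rewrite addrAC.
rewrite addrAC (le_trans (nrmD _ _))// [leRHS]splitr lerD// nrmZ /w nrm_vertex.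
by rewrite mulrC.
Qed.

Lemma line_holo_dir f b : line_holo f -> line_holo (dir b f).
Proof.
move=> hf p; have [d1 [M [d10 M0 h1]]] := line_holo_local p hf.
have [d2 [s2 [d20 s20 bs2 ah h2]]] := dir_avg p b hf.
have [c cs] := complex_of_nrm (ltW s20).
have c0 : c != 0 by rewrite -nrm_gt0 cs.
have cs' : nrm c <= s2 by rewrite cs.
have bc : nrm b * nrm c <= d2 / 2 by rewrite cs.
have b1 : 0 < nrm b + 1 by rewrite ltr_wpDl ?nrm_ge0.
have s0 : 0 < d1 / (nrm b + 1) by rewrite divr_gt0.
have bs : nrm b * (d1 / (nrm b + 1)) <= d1.
  by rewrite mulr_fit ?nrm_ge0 ?(ltW d10).
have dir_bound q : nrm (q - p) <= d1 -> nrm (dir b f q) <= M / (d1 / (nrm b + 1)).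
  move=> qp; rewrite ler_pdivlMr// -[X in _ * X]expr1.
  have [aF FM] := h1 q qp b _ bs.
  by apply: cf_bound => // z zr; rewrite FM// zr.
exists (Num.min d1 (d2 / 2)), (M / (d1 / (nrm b + 1))).
split; first by rewrite lt_min d10 divr_gt0.
move=> q; rewrite le_min => /andP[qp1 qp2]; split; first exact: dir_bound.
move=> b' r; rewrite le_min => /andP[_ b'r]; apply: apx_lim => e e0.
have [k0 /(_ k0 (leqnn _)) hk] := h2 c c0 cs' e e0.
exists (fun z => avg k0 (fun w => f (q + z *: b' + w *: b)) c 1).
  exact: avg_line_apx ah _ _ _ _ _ _ _ qp2 bc b'r.
move=> z zr; apply: hk; rewrite addrAC (le_trans (nrmD _ _))// [leRHS]splitr lerD// nrmZ.
by rewrite (le_trans _ b'r)// mulrC ler_wpM2l ?nrm_ge0.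
Qed.

Lemma dirZ f a b : line_holo f -> dir (a *: b) f = a *: dir b f.
Proof.
move=> hf; apply/funext => q; have [d [M [d0 M0 h]]] := line_holo_local q hf.
have b1 : 0 < nrm b + 1 by rewrite ltr_wpDl ?nrm_ge0.
have qq : nrm (q - q) <= d by rewrite subrr nrm0 ltW.
have bs : nrm b * (d / (nrm b + 1)) <= d.
  by rewrite mulr_fit ?nrm_ge0 ?(ltW d0).
have [aF _] := h q qq b _ bs.
have := @cf_scale _ a _ _ 1 (divr_gt0 d0 b1) aF.
rewrite expr1 => /= E; rewrite /dir -[RHS]/(a * _) -E.
by congr (cf _ 1); apply/funext => z; rewrite scalerA mulrC.
Qed.

(** Uniformity in the base point lets the estimate in the direction c be used
    at q + z b, which gives the additivity of the derivative in the direction. *)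
Lemma dir_estimate f p b : line_holo f -> exists d K, [/\ 0 < d, 0 <= K &
  forall q (z : R[i]), nrm (q - p) <= d -> nrm z <= d ->
    nrm (f (q + z *: b) - f q - z * dir b f q) <= K * nrm z ^+ 2 /\
    nrm (f (q + z *: b) - f q) <= K * nrm z].
Proof.
move=> /(line_holo_local p)[d [M [d0 M0 h]]].
have b1 : 0 < nrm b + 1 by rewrite ltr_wpDl ?nrm_ge0.
have [s s0 bs] : exists2 s, 0 < s & nrm b * s <= d.
  exists (d / (nrm b + 1)); first by rewrite divr_gt0.
  by rewrite mulr_fit ?nrm_ge0 ?(ltW d0).
exists (Num.min d (s / 2)), (2 * M / s ^+ 2 + 2 * M / s); split.
- by rewrite lt_min d0 divr_gt0.
- by rewrite addr_ge0// divr_ge0 ?mulr_ge0 ?exprn_ge0 ?(ltW s0).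
move=> q z; rewrite !le_min => /andP[qd _] /andP[_ zs].
have [aF FM] := h q qd b s bs.
have FM' w : nrm w = s -> nrm (f (q + w *: b)) <= M by move=> ws; rewrite FM// ws.
have := remainder_bound 2 s0 aF FM' zs; have := remainder_bound 1 s0 aF FM' zs.
rewrite big_ord1 big_ord_recr big_ord1/= (cf0 s0 aF) scale0r addr0 expr0 !expr1 mulr1.
rewrite opprD addrA [_ * z]mulrC => h1 h2; split.
  apply: (le_trans h2); rewrite expr_div_n.
  have -> : 2 * M * (nrm z ^+ 2 / s ^+ 2) = 2 * M / s ^+ 2 * nrm z ^+ 2 by ring.
  rewrite ler_wpM2r ?exprn_ge0 ?nrm_ge0//.
  by rewrite lerDl divr_ge0 ?mulr_ge0 ?(ltW s0).
apply: (le_trans h1).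
have -> : 2 * M * (nrm z / s) = 2 * M / s * nrm z by ring.
rewrite ler_wpM2r ?nrm_ge0//.
by rewrite lerDr divr_ge0 ?mulr_ge0 ?exprn_ge0 ?(ltW s0).
Qed.

Lemma eq0_small (a : R[i]) (d K : R) : 0 < d -> 0 <= K ->
  (forall z : R[i], z != 0 -> nrm z <= d -> nrm (z * a) <= K * nrm z ^+ 2) -> a = 0.
Proof.
move=> d0 K0 h; apply: nrm_small_eq0 => e e0.
have K1 : 0 < K + 1 by rewrite ltr_wpDl.
pose s := Num.min d (e / (K + 1)).
have s0 : 0 < s by rewrite lt_min d0 divr_gt0.
have [z zs] := complex_of_nrm (ltW s0).
have z0 : z != 0 by rewrite -nrm_gt0 zs.
have zd : nrm z <= d by rewrite zs ge_min lexx.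
have := h z z0 zd; rewrite nrmM expr2 mulrCA zs ler_pM2l// => /le_trans; apply.
apply: (@le_trans _ _ ((K + 1) * s)); first by rewrite ler_wpM2r ?(ltW s0)// lerDl.
by rewrite mulrC -ler_pdivlMr// ge_min lexx orbT.
Qed.

Lemma dirD f b c : line_holo f -> dir (b + c) f = dir b f + dir c f.
Proof.
move=> hf; apply/funext => q; apply/eqP; rewrite -subr_eq0; apply/eqP.
have [d1 [K1 [d10 K10 h1]]] := dir_estimate q (b + c) hf.
have [d2 [K2 [d20 K20 h2]]] := dir_estimate q b hf.
have [d3 [K3 [d30 K30 h3]]] := dir_estimate q c hf.
have [d4 [K4 [d40 K40 h4]]] := dir_estimate q b (line_holo_dir c hf).
have b1 : 0 < nrm b + 1 by rewrite ltr_wpDl ?nrm_ge0.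
pose d := Num.min (Num.min d1 d2) (Num.min (Num.min d3 d4) (d3 / (nrm b + 1))).
have d0 : 0 < d by rewrite !lt_min d10 d20 d30 d40 divr_gt0.
apply: (@eq0_small _ d (K1 + K2 + K3 + K4)) => //; first by rewrite !addr_ge0.
move=> z z0; rewrite !le_min => /andP[/andP[zd1 zd2] /andP[/andP[zd3 zd4] zd5]].
have qq e : 0 < e -> nrm (q - q) <= e by move=> e0; rewrite subrr nrm0 ltW.
have [e1 _] := h1 q z (qq _ d10) zd1; have [e2 _] := h2 q z (qq _ d20) zd2.
have [_ e4] := h4 q z (qq _ d40) zd4.
have [|e3 _] := h3 (q + z *: b) z _ zd3.
  rewrite addrC addKr nrmZ (le_trans (_ : _ <= nrm z * (nrm b + 1)))//.
    by rewrite ler_wpM2l ?nrm_ge0// lerDl.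
  by rewrite -ler_pdivlMr.
have -> : z * (dir (b + c) f q - (dir b f + dir c f) q) =
    (f (q + z *: b) - f q - z * dir b f q)
    + (f (q + z *: b + z *: c) - f (q + z *: b) - z * dir c f (q + z *: b))
    + z * (dir c f (q + z *: b) - dir c f q)
    - (f (q + z *: (b + c)) - f q - z * dir (b + c) f q).
  have E : q + z *: (b + c) = q + z *: b + z *: c by rewrite scalerDr addrA.
  rewrite -[(dir b f + dir c f) q]/(dir b f q + dir c f q) E; ring.
have -> : (K1 + K2 + K3 + K4) * nrm z ^+ 2 =
    K2 * nrm z ^+ 2 + K3 * nrm z ^+ 2 + nrm z * (K4 * nrm z) + K1 * nrm z ^+ 2.
  by move: (nrm z) => t; ring.
rewrite (le_trans (nrmB _ _))// lerD// (le_trans (nrmD _ _))// lerD//.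
  by rewrite (le_trans (nrmD _ _))// lerD.
by rewrite nrmM ler_wpM2l ?nrm_ge0.
Qed.

Lemma cf1_dist (F G : R[i] -> R[i]) r M : 0 < r -> apx F r -> apx G r ->
  (forall z, nrm z <= r -> nrm (F z - G z) <= M) -> nrm (cf F 1 - cf G 1) <= M / r.
Proof.
move=> r0 aF aG FG; rewrite ler_pdivlMr// -[r in _ * r]expr1.
by apply: cf_dist => // z zr; apply: FG; rewrite zr.
Qed.

(** Directional derivatives commute because each is a uniform limit of finite
    combinations of translations, and the other one is continuous for uniform
    convergence. *)
Lemma dirC f b c : line_holo f -> dir b (dir c f) = dir c (dir b f).
Proof.
move=> hf; apply/funext => q; apply: nrm_small_eq => e e0.
have e20 : 0 < e / 2 by rewrite divr_gt0.
have qq d : 0 < d -> nrm (q - q) <= d by move=> d0; rewrite subrr nrm0 ltW.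
have [d1 [s1 [d10 s10 cs1 a1 h1]]] := dir_avg q c hf.
have [d3 [M3 [d30 _ h3]]] := line_holo_local q (line_holo_dir b hf).
have [d4 [M4 [d40 _ h4]]] := line_holo_local q (line_holo_dir c hf).
have b1 : 0 < nrm b + 1 by rewrite ltr_wpDl ?nrm_ge0.
have c1 : 0 < nrm c + 1 by rewrite ltr_wpDl ?nrm_ge0.
have fit (v : V) d : 0 < d -> nrm v * (d / (nrm v + 1)) <= d.
  by move=> d0; rewrite mulr_fit ?nrm_ge0 ?(ltW d0).
have [a3 _] := h3 q (qq _ d30) c _ (fit c d3 d30).
pose r := Num.min (d4 / (nrm b + 1)) (d1 / 2 / (nrm b + 1)).
have r0 : 0 < r by rewrite lt_min !divr_gt0.
have br4 : nrm b * r <= d4.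
  by apply: le_trans (fit b d4 d40); rewrite ler_wpM2l ?nrm_ge0// ge_min lexx.
have br1 : nrm b * r <= d1 / 2.
  apply: le_trans (fit b _ (divr_gt0 d10 (ltr0n _ 2))).
  by rewrite ler_wpM2l ?nrm_ge0// ge_min lexx orbT.
have [w [w0 ws]] : exists w : R[i], w != 0 /\ nrm w < Num.min s1 (d3 / (nrm c + 1)).
  by apply: small_point; rewrite lt_min s10 divr_gt0.
move: ws; rewrite lt_min => /andP[/ltW ws1 ws3].
have [k1 hk1] := h1 w w0 ws1 _ (mulr_gt0 e20 r0).
have [k2 hk2] := avg_lim 1 a3 w0 ws3 _ e20.
pose k := maxn k1 k2.
have cw : nrm c * nrm w <= d1 / 2 by rewrite (le_trans _ cs1)// ler_wpM2l ?nrm_ge0.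
have q2 : nrm (q - q) <= d1 / 2 by apply: qq; rewrite divr_gt0.
have E : cf (fun z => avg k (fun x => f (q + z *: b + x *: c)) w 1) 1 =
    avg k (fun x => dir b f (q + x *: c)) w 1.
  rewrite (cf_avg k (c := w) 1 1 (F := fun x z => f (q + z *: b + x *: c)) r0).
    congr (avg k _ w 1); apply/funext => x; rewrite /dir; congr (cf _ 1).
    by apply/funext => z; rewrite addrAC.
  move=> x xw; have [d11] : nrm b * r <= d1 /\ True by split=> //; lra.
  move=> _; apply: apx_ext (a1 (q + x *: c) _ b r d11) => [z _|]; first by rewrite addrAC.
  by rewrite addrC addKr nrmZ xw mulrC; lra.
rewrite (le_trans (nrm_tri _ (avg k (fun x => dir b f (q + x *: c)) w 1) _))// [leRHS]splitr.
apply: lerD; last by apply: hk2; rewrite leq_maxr.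
rewrite -E -[e / 2](mulfK (lt0r_neq0 r0)); apply: cf1_dist => //.
- by have [] := h4 q (qq _ d40) b r br4.
- exact: avg_line_apx a1 _ _ _ _ _ _ _ q2 cw br1.
- move=> z zr; apply: hk1; first exact: leq_maxl.
  rewrite addrC addKr nrmZ (le_trans (_ : _ <= nrm b * r)); [by []| |lra].
  by rewrite mulrC ler_wpM2l ?nrm_ge0.
Qed.

Definition dirs (s : seq V) f := foldr dir f s.

Lemma line_holo_dirs s f : line_holo f -> line_holo (dirs s f).
Proof. by move=> hf; elim: s => //= b s; exact: line_holo_dir. Qed.

Lemma dirs_perm s t f : line_holo f -> perm_eq s t -> dirs s f = dirs t f.
Proof.
move=> hf; elim: s t => [|b s IH] t st; first by move: st; rewrite perm_sym => /perm_nilP ->.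
have bt : b \in t by rewrite -(perm_mem st) mem_head.
case/splitPr: bt st => t1 t2 st.
have st' : perm_eq s (t1 ++ t2) by rewrite -(perm_cons b) (perm_trans st)// -[b :: t2]cat1s perm_catCA.
rewrite /= (IH _ st') /dirs !foldr_cat /= -/(dirs t2 f).
have := line_holo_dirs t2 hf; move: (dirs t2 f) => g hg.
elim: t1 {st st'} => //= c t1 <-; rewrite dirC//; exact: line_holo_dirs.
Qed.

(** The homogeneous term of degree n of the Taylor expansion of f at p, read off
    the complex line through p with direction y. *)
Definition tcoef f p n (y : V) : R[i] := cf (fun z => f (p + z *: y)) n.

(** On the line p + z y the derivative in the direction y acts as d/dz. *)
Lemma dirs_nseq f p n y : line_holo f -> dirs (nseq n y) f p = n`!%:R * tcoef f p n y.
Proof.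
move=> hf; have qq d : 0 < d -> nrm (p - p) <= d by move=> d0; rewrite subrr nrm0 ltW.
have fit g : line_holo g -> exists2 r, 0 < r & apx (fun z => g (p + z *: y)) r.
  move=> /(line_holo_local p)[d [M [d0 _ h]]].
  have y1 : 0 < nrm y + 1 by rewrite ltr_wpDl ?nrm_ge0.
  exists (d / (nrm y + 1)); first by rewrite divr_gt0.
  have [] // := h p (qq _ d0) y (d / (nrm y + 1)).
  by rewrite mulr_fit ?nrm_ge0 ?(ltW d0).
have der g m : line_holo g -> tcoef (dir y g) p m y = m.+1%:R * tcoef g p m.+1 y.
  move=> hg; have [r r0 ag] := fit g hg.
  have [_ <-] := cf_deriv m r0 ag; congr (cf _ m); apply/funext => z.
  by rewrite /dir; congr (cf _ 1); apply/funext => w; rewrite scalerDl addrA.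
suff H m : n`!%:R * tcoef f p (m + n) y * (m + n)`!%:R = n`!%:R * (m`!%:R * tcoef (dirs (nseq n y) f) p m y).
  have := H 0%N; rewrite add0n fact0 mul1r [tcoef (dirs _ _) _ _ _](_ : _ = dirs (nseq n y) f p).
    have n0 : n`!%:R != 0 :> R[i] by rewrite pnatr_eq0 -lt0n fact_gt0.
    by rewrite -mulrA => /(mulfI n0) <-; rewrite mulrC.
  have [r r0 ag] := fit _ (line_holo_dirs (nseq n y) hf).
  by rewrite /tcoef (cf0 r0 ag) scale0r addr0.
rewrite -mulrA; congr (_ * _).
elim: n m => [|n IH] m; first by rewrite addn0 mulrC.
rewrite /= der; last exact: line_holo_dirs.
by rewrite addnS -addSn IH factS natrM; ring.
Qed.

End Osgood.

(** * Taylor expansions of entire functions *)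

Section EntireFunctions.
Variables (R : realType) (V : normedModType R[i]).
Implicit Types (f g : V -> R[i]) (p q b x y : V) (r e d M : R) (z w c : R[i]).

Lemma update_id n (u : 'I_n -> V) i x : update u i x i = x.
Proof. by rewrite /update eqxx. Qed.

Lemma update_neq n (u : 'I_n -> V) i x l : l != i -> update u i x l = u l.
Proof. by rewrite /update => /negbTE ->. Qed.

Lemma dirs_update n (u : 'I_n -> V) i x f : line_holo f ->
  dirs [seq update u i x l | l <- enum 'I_n] f =
  dir x (dirs [seq u l | l <- rem i (enum 'I_n)] f).
Proof.
move=> hf.
have pe : perm_eq (enum 'I_n) (i :: rem i (enum 'I_n)) by rewrite perm_to_rem ?mem_enum.
rewrite (dirs_perm hf (perm_map (update u i x) pe)) /= update_id; congr (dir x (dirs _ f)).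
apply/eq_in_map => l; rewrite mem_rem_uniq ?enum_uniq// inE => /andP[li _].
exact: update_neq.
Qed.

(** Directional derivatives are additive, homogeneous and commute, so iterating
    them gives a symmetric multilinear form; on the diagonal it is n! times the
    Taylor term. *)
Lemma tcoef_polar f p n : line_holo f ->
  polar_form (tcoef f p n) (fun u : 'I_n -> V => n`!%:R^-1 * dirs [seq u i | i <- enum 'I_n] f p).
Proof.
move=> hf; split.
- move=> u i a x y; rewrite !dirs_update//.
  have hg := line_holo_dirs [seq u l | l <- rem i (enum 'I_n)] hf.
  rewrite dirD// dirZ// -[(_ + _) p]/(_ p + _ p) mulrDr; congr (_ + _).
  by rewrite -[(_ *: _) p]/(_ * _ p) mulrCA.
- move=> s u; congr (_ * _ p); apply: dirs_perm => //.
  have -> : [seq u (s i) | i : 'I_n <- enum 'I_n] = [seq u i | i <- [seq s i | i : 'I_n <- enum 'I_n]].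
    by rewrite -(map_comp u (fun i => s i)).
  apply: perm_map; apply: uniq_perm.
  - by rewrite (map_inj_uniq (@perm_inj _ s)); exact: enum_uniq.
  - exact: enum_uniq.
  move=> i; rewrite mem_enum; apply/mapP; exists (invF (@perm.perm_inj _ s) i).
    by rewrite mem_enum.
  by rewrite f_invF.
move=> x; have -> : [seq x | _ <- enum 'I_n] = nseq n x.
  by rewrite -[in RHS](card_ord n) cardE; elim: (enum _) => //= a l ->.
by rewrite dirs_nseq// mulKf// pnatr_eq0 -lt0n fact_gt0.
Qed.

Lemma line_radius f p : line_holo f -> exists2 d, 0 < d &
  forall y r, nrm y * r <= d -> apx (fun z => f (p + z *: y)) r.
Proof.
move=> /(line_holo_local p)[d [M [d0 _ h]]]; exists d => // y r yr.
by have [] // := h p _ y r yr; rewrite subrr nrm0 ltW.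
Qed.

Lemma tcoef_continuous f p n : line_holo f -> continuous (tcoef f p n).
Proof.
move=> hf y; apply: continuous_nrm => e e0.
have [d1 d10 a1] := line_radius p hf.
have [d2 [K [d20 K0 h2]]] := line_holo_lip p hf.
have y1 : 0 < nrm y + 1 by rewrite ltr_wpDl ?nrm_ge0.
pose d := Num.min d1 d2.
have d0 : 0 < d by rewrite lt_min d10.
have [s s0 sd] : exists2 s, 0 < s & (nrm y + 1) * s <= d.
  by exists (d / (nrm y + 1)); rewrite ?divr_gt0// mulrC divfK// gt_eqF.
have K1 : 0 < K + 1 by rewrite ltr_wpDl.
have sn0 : 0 < s ^+ n by rewrite exprn_gt0.
have e1 : 0 < e * s ^+ n / ((K + 1) * s) by rewrite divr_gt0 ?mulr_gt0.
exists (Num.min 1 (e * s ^+ n / ((K + 1) * s))); first by rewrite lt_min ltr01.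
move=> x; rewrite lt_min => /andP[/ltW x1 /ltW]; rewrite ler_pdivlMr ?mulr_gt0// => xe.
have xy : nrm x <= nrm y + 1.
  by have := nrmD (x - y) y; rewrite subrK; lra.
have small v : nrm v <= nrm y + 1 -> nrm v * s <= d.
  by move=> vy; rewrite (le_trans _ sd)// ler_wpM2r// ltW.
have le1 v : nrm v * s <= d -> nrm v * s <= d1 by move=> /le_trans; apply; rewrite ge_min lexx.
have le2 v : nrm v * s <= d -> nrm v * s <= d2 by move=> /le_trans; apply; rewrite ge_min lexx orbT.
have yy : nrm y <= nrm y + 1 by rewrite lerDl.
rewrite -(ler_pM2r sn0); apply: le_trans xe; apply: cf_dist => //.
- by apply: a1; apply: le1; exact: small.
- by apply: a1; apply: le1; exact: small.
move=> z zs; apply: (le_trans (h2 (p + z *: y) (p + z *: x) _ _)).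
- by rewrite addrC addKr nrmZ zs mulrC le2 ?small.
- by rewrite addrC addKr nrmZ zs mulrC le2 ?small.
rewrite opprD addrACA subrr add0r -scalerBr nrmZ zs mulrC -mulrA mulrCA ler_wpM2l ?nrm_ge0//.
by rewrite mulrC ler_wpM2r ?(ltW s0)// lerDl.
Qed.

(** Osgood's theorem: the Taylor coefficients along lines are polynomials,
    polarized by iterated directional derivatives, and the Cauchy estimates on
    lines make the expansion converge uniformly on a ball. *)
Theorem line_holo_entire f : line_holo f -> entire f.
Proof.
move=> hf p; exists (tcoef f p); split.
  by move=> m; split; [exact: tcoef_continuous|eexists; exact: tcoef_polar].
have [d [M [d0 M0 h]]] := line_holo_local p hf.
exists (d / 2); first by rewrite divr_gt0.
apply/uniform_nrm => e e0.
have t01 : 0 <= (1 / 2 : R) < 1 by lra.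
have M1 : 0 < 2 * M + 1 by rewrite ltr_wpDl ?mulr_ge0.
have [N hN] := pow_small t01 (divr_gt0 e0 M1).
exists N => n Nn x xp; rewrite nrm_distC.
have pp : nrm (p - p) <= d by rewrite subrr nrm0 ltW.
have xp2 : nrm (x - p) * 2 <= d by rewrite -ler_pdivlMr// ltW.
have [aF FM] := h p pp _ _ xp2.
have FM' z : nrm z = 2 -> nrm (f (p + z *: (x - p))) <= M by move=> z2; rewrite FM// z2.
have := @remainder_bound _ _ _ M 1 n (ltr0n _ 2) aF FM'.
rewrite nrm1 scale1r [p + _]addrC subrK (eq_bigr (fun m : 'I_n => tcoef f p m (x - p))); last first.
  by move=> m _; rewrite expr1n mulr1.
move=> /(_ (_ : 1 <= 2 / 2)); rewrite divff// => /(_ (lexx _)) /le_trans; apply.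
apply: (@le_trans _ _ ((2 * M + 1) * (1 / 2) ^+ n)).
  by rewrite ler_wpM2r ?exprn_ge0// lerDl.
by rewrite mulrC -ler_pdivlMr// hN.
Qed.

Lemma multilinear0 n (A : ('I_n -> V) -> R[i]) u i : multilinear A -> A (update u i 0) = 0.
Proof.
move=> /(_ u i 1 0 0); rewrite scale1r addr0 mul1r => /eqP.
by rewrite -subr_eq0 opprD addNKr oppr_eq0 => /eqP.
Qed.

Lemma multilinearD n (A : ('I_n -> V) -> R[i]) u i a x y : multilinear A ->
  A (update u i (x + a *: y)) = A (update u i x) + a * A (update u i y).
Proof. by move=> mA; rewrite addrC mA addrC. Qed.

(** The arguments are moved along the line one at a time. *)
Lemma multilinear_line n (A : ('I_n -> V) -> R[i]) p b k : multilinear A -> (k <= n)%N ->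
  forall u, exists Q : {poly R[i]}, forall z,
    A (fun i => if (i < k)%N then p + z *: b else u i) = Q.[z].
Proof.
move=> mA; elim: k => [_ u|k IH kn u]; first by exists (A u)%:P => z; rewrite hornerC.
have [Q hQ] := IH (ltnW kn) (update u (Ordinal kn) p).
have [Q' hQ'] := IH (ltnW kn) (update u (Ordinal kn) b).
exists (Q + 'X * Q') => z; rewrite hornerD hornerM hornerX -hQ -hQ'.
pose U (i : 'I_n) := if (i < k)%N then p + z *: b else u i.
have E v : (fun i : 'I_n => if (i < k)%N then p + z *: b else update u (Ordinal kn) v i) =
    update U (Ordinal kn) v.
  apply/funext => i; rewrite /update /U; case: (eqVneq i (Ordinal kn)) => // ->.
  by rewrite ltnn.
rewrite !E -multilinearD//; congr A; apply/funext => i; rewrite /update /U.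
case: eqVneq => [->/=|ik]; first by rewrite ltnSn.
by rewrite ltnS leq_eqVlt (_ : nat_of_ord i == k = false)//; apply/negbTE.
Qed.

Lemma homog_line n (P : V -> R[i]) p b : homog_poly n P -> exists Q : {poly R[i]}, forall z, P (p + z *: b) = Q.[z].
Proof.
move=> [_ [A [mA _ PA]]]; have [Q hQ] := multilinear_line p b mA (leqnn n) (fun=> 0).
exists Q => z; rewrite -hQ PA; congr A; apply/funext => i; by rewrite ltn_ord.
Qed.

Lemma homogZ n (P : V -> R[i]) z y : homog_poly n P -> P (z *: y) = z ^+ n * P y.
Proof.
move=> [_ [A [mA _ PA]]]; rewrite !PA.
suff H k : (k <= n)%N ->
    A (fun i : 'I_n => if (i < k)%N then z *: y else y) = z ^+ k * A (fun=> y).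
  by rewrite -(H n (leqnn n)); congr A; apply/funext => i; rewrite ltn_ord.
elim: k => [_|k IH kn]; first by rewrite expr0 mul1r.
rewrite exprS -mulrA -(IH (ltnW kn)).
pose U (i : 'I_n) := if (i < k)%N then z *: y else y.
have -> : (fun i : 'I_n => if (i < k.+1)%N then z *: y else y) = update U (Ordinal kn) (z *: y + 0).
  apply/funext => i; rewrite /update /U addr0; case: eqVneq => [->/=|ik]; first by rewrite ltnSn.
  by rewrite ltnS leq_eqVlt (_ : nat_of_ord i == k = false)//; apply/negbTE.
rewrite mA (multilinear0 _ _ mA) addr0; congr (_ * A _).
apply/funext => i; rewrite /update /U; case: eqVneq => [->/=|//]; by rewrite ltnn.
Qed.

Lemma homog_line_holo n (P : V -> R[i]) : homog_poly n P -> line_holo P.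
Proof.
move=> hP p; have [cP _] := hP.
have [d d0 hd] := nrm_continuous (cP p) ltr01.
exists (d / 2), (1 + nrm (P p)); split; first by rewrite divr_gt0.
move=> q qp; split=> [|b r _].
  have qd : nrm (q - p) < d by rewrite (le_lt_trans qp)// ltr_pdivrMr// ltr_pMr// ltr1n.
  by have := nrmD (P q - P p) (P p); rewrite subrK => /le_trans; apply; rewrite lerD2r hd.
by have [Q hQ] := homog_line q b hP; apply: apx_ext (apx_poly Q r) => z _; rewrite hQ.
Qed.

(** Taylor expansions restrict to lines, where the coefficients are unique. *)
Lemma taylor_line f p P y : taylor_expansion f p P ->
  (exists2 r, 0 < r & apx (fun z => f (p + z *: y)) r) /\ forall m, P m y = tcoef f p m y.
Proof.
move=> [hP [r r0 /uniform_nrm fP]].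
have y1 : 0 < nrm y + 1 by rewrite ltr_wpDl ?nrm_ge0.
have [s s0 sr] : exists2 s, 0 < s & forall z, nrm z <= s -> nrm (z *: y) < r.
  exists (r / (nrm y + 1)); first by rewrite divr_gt0.
  move=> z zs; rewrite nrmZ; apply: (@le_lt_trans _ _ (r / (nrm y + 1) * nrm y)).
    by rewrite ler_wpM2r ?nrm_ge0.
  by rewrite mulrAC ltr_pdivrMr// ltr_pM2l// ltrDl.
pose S n := \poly_(m < n) P m y.
have hS e : 0 < e -> exists n0, forall n, (n0 <= n)%N -> forall z, nrm z <= s ->
    nrm (f (p + z *: y) - (S n).[z]) <= e.
  move=> e0; have [n0 h] := fP e e0; exists n0 => n nn z zs.
  have := h n nn (p + z *: y); rewrite [p + _]addrC addrK nrm_distC => /(_ (sr z zs)).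
  rewrite horner_poly (eq_bigr (fun m : 'I_n => P m y * z ^+ m))// => m _.
  by rewrite (homogZ _ _ (hP m)) mulrC.
have aF : apx (fun z => f (p + z *: y)) s.
  by move=> e /hS[n0 h]; exists (S n0); exact: h.
split; first by exists s.
move=> m; apply/eqP; rewrite -subr_eq0 -nrm_eq0 eq_le nrm_ge0 andbT.
apply/ler_addgt0Pr => e e0; rewrite add0r nrm_distC.
have sm0 : 0 < s ^+ m by rewrite exprn_gt0.
have [n0 h] := hS _ (mulr_gt0 e0 sm0).
have -> : P m y = cf (horner (S (maxn n0 m.+1))) m by rewrite cf_poly coef_poly leq_max ltnSn orbT.
rewrite -(ler_pM2r sm0); apply: cf_dist s0 aF (apx_poly _ _) _ => z zs.
by apply: h; rewrite ?leq_maxl ?zs.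
Qed.

Lemma taylor_tcoef f p : entire f -> taylor f p = tcoef f p.
Proof.
move=> ef; have [P fP] := ef p.
have h : taylor_expansion f p (taylor f p).
  exact: (@xgetPex _ (fun=> 0) [set P | taylor_expansion f p P] (ex_intro _ P fP)).
by apply/funext => m; apply/funext => y; rewrite (taylor_line y h).2.
Qed.

Lemma entire_line f p y : entire f -> exists2 r, 0 < r & apx (fun z => f (p + z *: y)) r.
Proof. by move=> /(_ p)[P /(taylor_line y)[]]. Qed.

Lemma taylor_coefE f j : entire f -> taylor_coef f j = tcoef f 0 j.
Proof.
move=> ef; have n0 : j`!%:R != 0 :> R[i] by rewrite pnatr_eq0 -lt0n fact_gt0.
by rewrite /taylor_coef /dhat taylor_tcoef// scalerA mulVf// scale1r.
Qed.

Lemma dhatE f j p : entire f -> dhat j f p = j`!%:R *: tcoef f p j.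
Proof. by move=> ef; rewrite /dhat taylor_tcoef. Qed.

(** The supremum of the points t of [0, 1] at which all Taylor coefficients
    vanish has a neighbourhood on which u vanishes, since discs of a fixed radius
    around nearby points reach beyond it. *)
Lemma identity_principle (u : R[i] -> R[i]) :
  (forall c, exists2 r, 0 < r & apx (fun z => u (c + z)) r) ->
  (forall n, cf u n = 0) -> u 1 = 0.
Proof.
move=> hu u0.
pose Z (t : R) := forall n, cf (fun z => u (t%:C%C + z)) n = 0.
pose S := [set t : R | 0 <= t <= 1 /\ Z t].
have Z0 : Z 0 by move=> n; rewrite -[RHS](u0 n); congr (cf _ n); apply/funext => z; rewrite add0r.
have supS : has_sup S.
  split; first by exists 0; split=> //; rewrite lexx ler01.
  by exists 1 => t [/andP[_ t1] _].
set t0 := sup S.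
have t00 : 0 <= t0 by apply: sup_upper_bound => //; split=> //; rewrite lexx ler01.
have t01 : t0 <= 1 by apply: ge_sup; [exact: supS.1|move=> t [/andP[]]].
have [r r0 ar] := hu t0%:C%C.
have r4 : 0 < r / 4 by rewrite divr_gt0.
have [t [/andP[t0' t1'] Zt] tt] := sup_adherent r4 supS.
have tle : t <= t0 by apply: sup_upper_bound => //; split=> //; rewrite t0'.
have shift (a b : R) z : a%:C%C + ((b - a)%:C%C + z) = b%:C%C + z.
  by rewrite addrA -rmorphD/= [a + _]addrC subrK.
have at_ : apx (fun z => u (t%:C%C + z)) (3 * r / 4).
  apply: apx_ext (@apx_affine _ _ (t - t0)%:C%C 1 r _ _ ar) => [z _|].
    by rewrite mul1r shift.
  rewrite nrmc nrm1 mul1r ler0_norm; rewrite -/t0 in tt; lra.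
have near0 s z : t <= s -> s <= t0 + r / 4 -> nrm z < r / 4 -> u (s%:C%C + z) = 0.
  move=> ts st zr; rewrite -(shift t).
  apply: (apx_cf0 _ at_ Zt); first by lra.
  rewrite (le_lt_trans (nrmD _ _))// nrmc ger0_norm ?subr_ge0//.
  rewrite -/t0 in tt; lra.
have ZZ s : t <= s -> s <= t0 + r / 4 -> Z s.
  move=> ts st n; have [r' r'0 ar'] := hu s%:C%C.
  rewrite (cf_near r'0 ltr01 r4 ar' (apx_cst 0 1)); first by rewrite cf_cst; case: ifP.
  by move=> z _; exact: near0.
have Z1 : Z 1.
  apply: (ZZ); first by lra.
  rewrite leNgt; apply/negP => lt1.
  have : S (t0 + r / 4).
    by split; [rewrite (ltW lt1) andbT addr_ge0// ltW|apply: ZZ; rewrite ?lexx//; lra].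
  by move=> /(sup_upper_bound supS); rewrite -/t0; lra.
have [r' r'0 ar'] := hu 1.
by have := Z1 0%N; rewrite (cf0 r'0 ar') addr0.
Qed.

Lemma ent_of_coefs (a : nat -> R[i]) :
  (forall r, 0 < r -> exists M, forall n, nrm (a n) * r ^+ n <= M) ->
  exists F, [/\ ent F, cf F =1 a & forall z, ncvg (fun N => \sum_(n < N) a n * z ^+ n) (F z)].
Proof.
move=> ha.
have tail r : 0 < r -> exists2 M, 0 <= M & forall m n z, nrm z < r ->
    (m <= n)%N -> nrm (\sum_(i < n) a i * z ^+ i - \sum_(i < m) a i * z ^+ i) <=
      M * ((nrm z / r) ^+ m / (1 - nrm z / r)).
  move=> r0; have [M hM] := ha r r0; exists M.
    by apply: le_trans (hM 0%N); rewrite expr0 mulr1 nrm_ge0.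
  have M0 : 0 <= M by apply: le_trans (hM 0%N); rewrite expr0 mulr1 nrm_ge0.
  move=> m n z zr mn.
  rewrite -!(big_mkord xpredT (fun i => a i * z ^+ i)) (@big_cat_nat _ _ _ m 0 n)//=.
  rewrite addrAC subrr add0r (le_trans (nrm_sum _ _ _))//.
  apply: (@le_trans _ _ (M * \sum_(m <= i < n) (nrm z / r) ^+ i)); last first.
    by rewrite ler_wpM2l// geometric_tail// ratio_bounds.
  rewrite mulr_sumr; apply: ler_sum => i _; rewrite nrmM nrmX expr_div_n.
  rewrite [leRHS]mulrCA mulrC ler_wpM2l ?exprn_ge0 ?nrm_ge0// ler_pdivlMr ?exprn_gt0//.
have /choice[F hF] : forall z, exists l, ncvg (fun N => \sum_(n < N) a n * z ^+ n) l.
  move=> z; have r0 : 0 < nrm z + 1 by rewrite ltr_wpDl ?nrm_ge0.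
  have [M hM] := ha _ r0; have M0 : 0 <= M.
    by apply: le_trans (hM 0%N); rewrite expr0 mulr1 nrm_ge0.
  have t01 : 0 <= nrm z / (nrm z + 1) < 1 by apply: ratio_bounds => //; rewrite ltrDl.
  apply: (@abs_summable_cvg _ (fun i => a i * z ^+ i) (M * (1 / (1 - nrm z / (nrm z + 1))))) => n.
  have := ler_wpM2l M0 (geometric_tail 0 n t01); rewrite expr0 big_mkord; apply: le_trans.
  rewrite mulr_sumr; apply: ler_sum => i _; rewrite nrmM nrmX expr_div_n.
  by rewrite [leRHS]mulrCA mulrC ler_wpM2l ?exprn_ge0 ?nrm_ge0// ler_pdivlMr ?exprn_gt0.
have psF r : 0 < r -> exists M, pseries F a r M.
  move=> r0; have [M M0 hM] := tail r r0; have [M' hM'] := ha r r0.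
  exists (Num.max M M'); split=> [n|z N zr]; first by rewrite le_max hM' orbT.
  have tt : 0 <= (nrm z / r) ^+ N / (1 - nrm z / r).
    have /andP[t0 t1] := ratio_bounds r0 zr.
    by rewrite divr_ge0 ?exprn_ge0// subr_ge0 ltW.
  apply: (@le_trans _ _ (M * ((nrm z / r) ^+ N / (1 - nrm z / r)))).
    by apply: ncvg_le (hF z) _; exists N => n Nn; exact: hM.
  by rewrite ler_wpM2r// le_max lexx.
exists F; split=> //.
- move=> r; have r1 : 0 < Num.max r 0 + 1 by rewrite ltr_wpDl// le_max lexx orbT.
  have [M fM] := psF _ r1; apply: pseries_apx r1 _ fM.
  by rewrite ltr_pwDr// le_max lexx.
- by have [M fM] := psF 1 ltr01; exact: cf_eq fM.
Qed.

(** The expansion of f at 0 is known to converge to f only on some ball.  If the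
    series converges on the whole line through x, its sum and f have the same
    coefficients at 0, and the identity theorem extends the equality. *)
Lemma entire_global f x : entire f ->
  (forall r, 0 < r -> exists M, forall n, nrm (tcoef f 0 n x) * r ^+ n <= M) ->
  exists F, [/\ ent F, forall n, cf F n = tcoef f 0 n x, forall z, F z = f (z *: x) &
    forall z, ncvg (fun N => \sum_(n < N) tcoef f 0 n x * z ^+ n) (f (z *: x))].
Proof.
move=> ef hx; have [F [eF Fc Fl]] := ent_of_coefs hx.
suff FE z : F z = f (z *: x).
  by exists F; split=> // z; rewrite -FE; exact: Fl.
apply/esym/eqP; rewrite -subr_eq0; apply/eqP.
have := @identity_principle (fun w => f ((w * z) *: x) - F (w * z)).
rewrite !mul1r; apply.
  move=> c; have [r r0 ar] := entire_line ((c * z) *: x) (z *: x) ef.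
  exists r => //; apply: apxB.
    by apply: apx_ext ar => w _; rewrite mulrDl scalerDl scalerA.
  apply: apx_ext (@apx_affine _ F (c * z) z _ r (lexx _) (eF _)) => w _.
  by rewrite mulrDl [w * z]mulrC.
move=> n; have [r r0 ar] := entire_line 0 (z *: x) ef.
have ar' : apx (fun w => f ((w * z) *: x)) r.
  by apply: apx_ext ar => w _; rewrite add0r scalerA.
have aF : apx (fun w => F (w * z)) r.
  by apply: apx_ext (@apx_affine _ F 0 z _ r (lexx _) (eF _)) => w _; rewrite add0r mulrC.
rewrite (cfB n r0 ar' aF).
have -> : cf (fun w => F (w * z)) n = z ^+ n * tcoef f 0 n x.
  rewrite -Fc -(cf_scale _ _ ltr01 (eF 1)); congr (cf _ n); apply/funext => w.
  by rewrite mulrC.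
have [s s0 as_] := entire_line 0 x ef.
rewrite -(cf_scale z n s0 as_) -[RHS](subrr (cf (fun w => f ((w * z) *: x)) n)); congr (_ - cf _ n).
by apply/funext => w; rewrite add0r mulrC.
Qed.

End EntireFunctions.

(** * The weights *)

Section Weights.
Variable R : realType.
Implicit Types (k : \bar R) (q r : R).

Lemma weight0 k : weight k 0 = 1.
Proof. by case: k => [r| |] //=; rewrite !mul0r powRr0. Qed.

Lemma weight_gt0 k j : (1%:E < k)%E -> 0 < weight k j.
Proof.
case: k => [r| |]//=; rewrite lte_fin => r1.
case: j => [|j]; first by rewrite !mul0r powRr0.
by rewrite powR_gt0// divr_gt0// mulr_gt0 ?expR_gt0// (lt_trans _ r1).
Qed.

(** The power (j/e)^j, which agrees with j! up to a geometric factor. *)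
Definition euler_power (j : nat) : R := (j%:R / expR 1) ^+ j.

Lemma euler_power_fact j : euler_power j <= j`!%:R.
Proof.
rewrite /euler_power expr_div_n ler_pdivrMr ?exprn_gt0 ?expR_gt0//.
elim: j => [|j IH]; first by rewrite !expr0 mul1r.
case: j IH => [_|j IH].
  rewrite !expr1 (_ : 1`! = 1%N)// mul1r; apply: le_trans (expR_ge1Dx 1); by rewrite lerDl ler01.
have step : j.+2%:R ^+ j.+1 <= expR 1 * j.+1%:R ^+ j.+1 :> R.
  rewrite -ler_pdivrMr ?exprn_gt0// -expr_div_n.
  have -> : j.+2%:R / j.+1%:R = 1 + j.+1%:R^-1 :> R.
    by rewrite -[j.+2]addn1 natrD mulrDl divff// ?mul1r// pnatr_eq0.
  apply: (@le_trans _ _ (expR (j.+1%:R^-1) ^+ j.+1)).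
    by rewrite lerXn2r ?nnegrE ?expR_ge0 ?addr_ge0 ?invr_ge0// expR_ge1Dx.
  by rewrite -expRM_natl divff// pnatr_eq0.
rewrite exprS (le_trans (ler_wpM2l _ step))//.
rewrite factS natrM [expR 1 ^+ j.+2]exprS -mulrA ler_wpM2l// mulrCA ler_wpM2l ?expR_ge0//.
Qed.

Lemma fact_euler_power j : j`!%:R <= expR 1 ^+ j * euler_power j.
Proof.
rewrite /euler_power expr_div_n mulrCA divff ?mulr1 ?expf_neq0 ?gt_eqF ?expR_gt0//.
elim: j => [|j IH]; first by rewrite fact0 expr0.
rewrite factS natrM exprS ler_wpM2l// (le_trans IH)// lerXn2r ?nnegrE//.
by rewrite ler_nat.
Qed.

Lemma powR_natdiv q r j : 0 < r -> 0 <= q -> q `^ (j%:R / r) = (q `^ r^-1) ^+ j.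
Proof. by move=> r0 q0; rewrite mulrC powRrM powR_mulrn ?powR_ge0. Qed.

(** The exponents j / k and j / k' add up to j. *)
Lemma weight_conjugate k : (1%:E < k)%E -> let q := fine (hoelder_conjugate k) in
  1 <= q /\ exists2 c, 0 < c & forall j, weight k j * weight q%:E j = c ^+ j * euler_power j.
Proof.
have scale r j : 0 < r -> weight r%:E j = (r^-1 `^ r^-1) ^+ j * (j%:R / expR 1) `^ (j%:R / r).
  move=> r0; rewrite -powR_natdiv ?invr_ge0 ?(ltW r0)// -powRM.
  - by rewrite /= invfM mulrCA.
  - by rewrite invr_ge0 ltW.
  - by rewrite divr_ge0 ?expR_ge0.
case: k => [r| |]//=; last first.
  move=> _; split=> //; exists 1 => // j.
  rewrite mul1r expr1n mul1r divr1 /euler_power -powR_mulrn ?divr_ge0 ?expR_ge0//.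
  by rewrite mul1r.
rewrite lte_fin => r1; have r0 : 0 < r by rewrite (lt_trans _ r1).
have rm0 : 0 < r - 1 by rewrite subr_gt0.
have qE : fine (hoelder_conjugate r%:E) = r / (r - 1).
  rewrite /hoelder_conjugate/= eqe gt_eqF//= -EFinB inver gt_eqF//.
rewrite qE; set q := r / (r - 1).
have q0 : 0 < q by rewrite divr_gt0.
split; first by rewrite ler_pdivlMr// mul1r gerBl.
exists (r^-1 `^ r^-1 * q^-1 `^ q^-1) => [|j].
  by rewrite mulr_gt0 ?powR_gt0 ?invr_gt0.
rewrite -[(j%:R / (r * expR 1)) `^ _]/(weight r%:E j) -[(j%:R / (q * expR 1)) `^ _]/(weight q%:E j).
rewrite !scale// exprMn -!mulrA; congr (_ * _); rewrite mulrCA; congr (_ * _).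
rewrite /euler_power; case: j => [|j]; first by rewrite !mul0r !powRr0 expr0 mulr1.
rewrite -powRD; last by apply/implyP => _; rewrite gt_eqF// divr_gt0// expR_gt0.
have -> : j.+1%:R / r + j.+1%:R / q = j.+1%:R.
  by rewrite /q; field; rewrite ?gt_eqF.
by rewrite powR_mulrn// divr_ge0 ?expR_ge0.
Qed.

Lemma bounded_seq (u : nat -> R) N M : (forall n, (N <= n)%N -> u n <= M) ->
  exists M', forall n, u n <= M'.
Proof.
elim: N M => [M h|N IH M h]; first by exists M => n; exact: h.
apply: (IH (Num.max M (u N))) => n; rewrite leq_eqVlt => /predU1P[<-|Nn].
  by rewrite le_max lexx orbT.
by rewrite le_max h.
Qed.

(** Once j is so large that its base j / (q e) exceeds r^q, the weight exceeds
    r^j. *)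
Lemma weight_superexp q r : 1 <= q -> 0 < r ->
  exists M, forall j, r ^+ j <= M * weight q%:E j.
Proof.
move=> q1 r0; have q0 : 0 < q by rewrite (lt_le_trans _ q1).
have [M hM] : exists M, forall j, r ^+ j / weight q%:E j <= M.
  apply: (@bounded_seq _ (Num.truncn (r `^ q * (q * expR 1))).+1 1) => j jN.
  have j0 : (0 < j)%N by case: j jN.
  have w0 : 0 < j%:R / (q * expR 1) by rewrite divr_gt0 ?ltr0n// mulr_gt0 ?expR_gt0.
  rewrite ler_pdivrMr ?powR_gt0// mul1r /= -powR_mulrn ?(ltW r0)//.
  have -> : r `^ j%:R = (r `^ q) `^ (j%:R / q) by rewrite -powRrM mulrCA divff ?mulr1// gt_eqF.
  apply: ge0_ler_powR; rewrite ?nnegrE ?powR_ge0 ?(ltW w0)//; first by rewrite divr_ge0// ltW.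
  rewrite ler_pdivlMr ?mulr_gt0 ?expR_gt0// ltW// (lt_le_trans (truncnS_gt _))//.
  by rewrite ler_nat.
exists M => j; rewrite -ler_pdivrMr//= ?hM//.
case: j => [|j]; first by rewrite !mul0r powRr0.
by rewrite powR_gt0 ?divr_gt0 ?mulr_gt0 ?expR_gt0.
Qed.

(** Here k > 1 is used: the conjugate exponent is finite, so up to a
    geometric factor j! is the weight times a conjugate weight, which beats r^j. *)
Lemma weight_fact k (r : R) : (1%:E < k)%E -> 0 < r ->
  exists M, forall j, r ^+ j * (weight k j / j`!%:R) <= M.
Proof.
move=> k1 r0; have [q1 [c c0 wc]] := weight_conjugate k1; set q := fine _ in q1 wc.
have [M hM] := weight_superexp q1 (mulr_gt0 r0 c0); exists M => j.
have w'0 : 0 < weight q%:E j.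
  case: j => [|j]; first by rewrite weight0.
  by rewrite powR_gt0 ?divr_gt0 ?mulr_gt0 ?expR_gt0 ?(lt_le_trans _ q1).
have f0 : 0 < j`!%:R :> R by rewrite ltr0n fact_gt0.
rewrite -(ler_pM2r w'0) (le_trans _ (hM j))// exprMn -mulrA ler_wpM2l ?exprn_ge0 ?(ltW r0)//.
by rewrite mulrAC wc ler_pdivrMr// ler_wpM2l ?exprn_ge0 ?(ltW c0)// euler_power_fact.
Qed.

End Weights.

(** * The exponential function and continuous functionals *)

Section EntireExamples.
Variable R : realType.
Implicit Types (z w c : R[i]) (r e M : R).

Lemma fact_superexp (a : R) : 0 < a -> exists M, forall n, a ^+ n / n`!%:R <= M :> R.
Proof.
move=> a0; have [M hM] := @weight_fact R +oo%E a (ltry _) a0.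
by exists M => n; have := hM n; rewrite /= mul1r.
Qed.

(** All properties of the exponential function below come from its Taylor
    coefficients. *)
Lemma cexpP : [/\ ent (@cexp R), forall n, cf (@cexp R) n = n`!%:R^-1 &
  forall z, ncvg (fun N => \sum_(n < N) n`!%:R^-1 * z ^+ n) (cexp z)].
Proof.
have [|F [eF Fc Fl]] := @ent_of_coefs R (fun n => n`!%:R^-1).
  move=> r r0; have [M hM] := fact_superexp r0; exists M => n.
  by rewrite nrmV nrm_nat mulrC.
suff -> : @cexp R = F by [].
apply/funext => z; apply: cvg_lim.
  exact: norm_hausdorff.
apply/cvgrPdist_le => _ /posc[e e0 ->].
have [n0 h] := Fl z e e0; exists n0 => // n /= /h hn.
rewrite -nrmE lecR nrm_distC /series/= big_mkord.
by rewrite (eq_bigr (fun i : 'I_n => i`!%:R^-1 * z ^+ i))// => i _; rewrite mulrC.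
Qed.

Lemma cexp0 : cexp 0 = 1 :> R[i].
Proof.
have [eF Fc _] := cexpP.
by rewrite -(cf0 ltr01 (eF 1)) Fc fact0 invr1.
Qed.

Section LineHolo.
Variable V : normedModType R[i].
Implicit Types (f g : V -> R[i]) (phi psi : dual V).

Lemma line_holoM f g : line_holo f -> line_holo g -> line_holo (fun x => f x * g x).
Proof.
move=> hf hg p; have [d [M [d0 h]]] := hf p; have [d' [M' [d'0 h']]] := hg p.
exists (Num.min d d'), (M * M'); split; first by rewrite lt_min d0.
move=> q; rewrite le_min => /andP[qd qd']; have [fM af] := h q qd; have [gM ag] := h' q qd'.
split; first by rewrite nrmM ler_pM ?nrm_ge0.
by move=> b r; rewrite le_min => /andP[bd bd']; apply: apxM; [exact: af|exact: ag].
Qed.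

Lemma line_holo_cst c : line_holo (fun _ : V => c).
Proof.
by move=> p; exists 1, (nrm c); split=> // q _; split=> // b r _; exact: apx_cst.
Qed.

Lemma line_holoX f n : line_holo f -> line_holo (fun x => f x ^+ n).
Proof.
move=> hf; elim: n => [|n IH].
  by have -> : (fun x => f x ^+ 0) = (fun=> 1) by []; exact: line_holo_cst.
have -> : (fun x => f x ^+ n.+1) = (fun x => f x * f x ^+ n) by apply/funext => x; rewrite exprS.
exact: line_holoM.
Qed.

Lemma line_holo_ent f : (forall p b, ent (fun z => f (p + z *: b))) ->
  (forall p, exists d M, 0 < d /\ forall q, nrm (q - p) <= d -> nrm (f q) <= M) -> line_holo f.
Proof.
move=> ef bf p; have [d [M [d0 h]]] := bf p; exists d, M; split=> // q qp.
by split; [exact: h|move=> b r _; exact: ef].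
Qed.

Lemma dual0 phi : phi 0 = 0.
Proof. by have := dual_linear phi (-1) 0 0; rewrite scaler0 addr0 scaleN1r addNr. Qed.

Lemma dualZ phi a x : phi (a *: x) = a * phi x.
Proof. by have := dual_linear phi a x 0; rewrite dual0 !addr0. Qed.

Lemma dualD phi x y : phi (x + y) = phi x + phi y.
Proof. by have := dual_linear phi 1 x y; rewrite !scale1r. Qed.

Lemma dual_line phi p b z : phi (p + z *: b) = phi p + phi b * z.
Proof. by rewrite dualD dualZ mulrC. Qed.

Lemma dual_le phi x : nrm (phi x) <= nrm phi * nrm x.
Proof.
have [->|x0] := eqVneq x 0; first by rewrite dual0 !nrm0 mulr0.
have nx0 : 0 < nrm x by rewrite nrm_gt0.
have := @dual_norm_ub R V phi ((nrm x)^-1%:C%C *: x).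
rewrite dualZ nrmZ nrmM nrmc ger0_norm ?invr_ge0 ?nrm_ge0// mulVf ?gt_eqF// => /(_ (lexx _)).
by rewrite ler_pdivrMl// mulrC.
Qed.

Lemma apx_dual phi p b r : apx (fun z => phi (p + z *: b)) r.
Proof.
apply: (@apx_ext _ (fun z => phi p + phi b * z)); first by move=> z _; rewrite dual_line.
by apply: apxD; [exact: apx_cst|apply: apxZ; exact: apx_id].
Qed.

Lemma line_holo_dual phi : line_holo phi.
Proof.
apply: line_holo_ent => [p b r|p]; first exact: apx_dual.
exists 1, (nrm phi * (1 + nrm p)); split=> // q qp.
rewrite (le_trans (dual_le _ _))// ler_wpM2l ?nrm_ge0//.
by have := nrmD (q - p) p; rewrite subrK; lra.
Qed.

Lemma line_holo_cexp phi : line_holo (fun x => cexp (phi x)).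
Proof.
have [eF _ _] := cexpP; apply: line_holo_ent => [p b r|p].
  apply: apx_ext (@apx_affine _ _ (phi p) (phi b) _ r (lexx _) (eF _)) => z _.
  by rewrite dual_line.
have [M M0 hM] := apx_bounded (eF (nrm phi * (1 + nrm p))).
exists 1, M; split=> // q qp; apply: hM.
rewrite (le_trans (dual_le _ _))// ler_wpM2l ?nrm_ge0//.
by have := nrmD (q - p) p; rewrite subrK; lra.
Qed.

End LineHolo.
End EntireExamples.

(** * Linearity of Taylor expansions and duals of normed function spaces *)

Section EntireSpace.
Variables (R : realType) (V : normedModType R[i]).
Implicit Types (f g P Q : V -> R[i]) (p x y : V) (a : R[i]).

Lemma fctE_D f g x : (f + g) x = f x + g x. Proof. by []. Qed.
Lemma fctE_Z a f x : (a *: f) x = a * f x. Proof. by []. Qed.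

Lemma polar_form_lin j P Q A B a : polar_form P A -> polar_form Q B ->
  polar_form (a *: P + Q) (fun u : 'I_j -> V => a * A u + B u).
Proof.
move=> [mA sA PA] [mB sB QB]; split=> [u i b x y|s u|x].
- by rewrite mA mB; ring.
- by rewrite sA sB.
- by rewrite fctE_D fctE_Z PA QB.
Qed.

Lemma homog_poly_lin j a P Q : homog_poly j P -> homog_poly j Q -> homog_poly j (a *: P + Q).
Proof.
move=> [cP [A PA]] [cQ [B QB]]; split; last by eexists; exact: polar_form_lin PA QB.
by move=> x; apply: continuousD; [apply: continuousZl_tmp; exact: cP|exact: cQ].
Qed.

Lemma entire_lin a f g : entire f -> entire g -> entire (a *: f + g).
Proof.
move=> ef eg p; have [P [hP [r r0 /uniform_nrm fP]]] := ef p.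
have [Q [hQ [s s0 /uniform_nrm gQ]]] := eg p.
exists (fun m => a *: P m + Q m); split; first by move=> m; exact: homog_poly_lin.
exists (Num.min r s); first by rewrite lt_min r0.
apply/uniform_nrm => e e0; have a1 : 0 < nrm a + 1 by rewrite ltr_wpDl ?nrm_ge0.
have [n1 h1] := fP (e / 2 / (nrm a + 1)) (divr_gt0 (divr_gt0 e0 (ltr0n _ 2)) a1).
have [n2 h2] := gQ (e / 2) (divr_gt0 e0 (ltr0n _ 2)).
exists (maxn n1 n2) => n; rewrite geq_max => /andP[n1n n2n] x.
rewrite lt_min => /andP[xr xs].
have -> : \sum_(m < n) (a *: P m + Q m) (x - p) - (a *: f + g) x =
    a * (\sum_(m < n) P m (x - p) - f x) + (\sum_(m < n) Q m (x - p) - g x).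
  rewrite big_split/= mulrBr mulr_sumr fctE_D fctE_Z; ring.
rewrite (le_trans (nrmD _ _))// [leRHS]splitr lerD ?h2// nrmM.
rewrite (le_trans (ler_wpM2l (nrm_ge0 _) (h1 n n1n x xr)))//.
by rewrite mulr_fit ?nrm_ge0 ?divr_ge0 ?(ltW e0).
Qed.

Lemma tcoef_lin a f g p n : entire f -> entire g ->
  tcoef (a *: f + g) p n = a *: tcoef f p n + tcoef g p n.
Proof.
move=> ef eg; apply/funext => y; rewrite fctE_D fctE_Z /tcoef.
have [r r0 af] := entire_line p y ef; have [s s0 ag] := entire_line p y eg.
have m0 : 0 < Num.min r s by rewrite lt_min r0.
have af' : apx (fun z => f (p + z *: y)) (Num.min r s) by apply: apx_le af; rewrite ge_min lexx.
have ag' : apx (fun z => g (p + z *: y)) (Num.min r s) by apply: apx_le ag; rewrite ge_min lexx orbT.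
by rewrite -(cf_lin a n m0 af' ag').
Qed.

Lemma entire0 : entire (0 : V -> R[i]).
Proof. exact: (line_holo_entire (line_holo_cst (V := V) 0)). Qed.

Lemma tcoef0 p n : tcoef (0 : V -> R[i]) p n = 0.
Proof. by apply/funext => y; rewrite /tcoef cf_cst; case: ifP. Qed.

Lemma homog_entire j P : homog_poly j P -> entire P.
Proof. by move=> hP; exact: line_holo_entire (homog_line_holo hP). Qed.

Lemma tcoef_homog j P m : homog_poly j P -> tcoef P 0 m = if m == j then P else 0.
Proof.
move=> hP; apply/funext => y; rewrite /tcoef.
have -> : (fun z => P (0 + z *: y)) = horner (P y *: 'X^j).
  by apply/funext => z; rewrite add0r (homogZ _ _ hP) hornerZ hornerXn mulrC.
by rewrite cf_poly coefZ coefXn; case: eqP => _; rewrite ?mulr1 ?mulr0.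
Qed.

End EntireSpace.

Section NormedFunctions.
Variables (R : realType) (V : Type) (X : set (V -> R[i])) (n : (V -> R[i]) -> R).
Hypothesis XB : is_banach X n.
Implicit Types (f g : V -> R[i]) (a : R[i]) (T : (V -> R[i]) -> R[i]).

Lemma subspace0 : X 0. Proof. by have [[]] := XB. Qed.

Lemma subspace_lin a f g : X f -> X g -> X (a *: f + g).
Proof. by have [[_ h] _ _ _ _] := XB; exact: h. Qed.

Lemma subspaceD f g : X f -> X g -> X (f + g).
Proof. by move=> Xf Xg; rewrite -[f]scale1r; exact: subspace_lin. Qed.

Lemma subspaceZ a f : X f -> X (a *: f).
Proof. by move=> Xf; rewrite -[_ *: _]addr0; apply: subspace_lin => //; exact: subspace0. Qed.

Lemma subspace_sum (I : Type) (s : seq I) (F : I -> V -> R[i]) :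
  (forall i, X (F i)) -> X (\sum_(i <- s) F i).
Proof.
move=> XF; elim: s => [|i s IH]; first by rewrite big_nil; exact: subspace0.
by rewrite big_cons; exact: subspaceD.
Qed.

Lemma fnorm_ge0 f : X f -> 0 <= n f.
Proof. by have [_ [h _] _ _ _] := XB; exact: h. Qed.

Lemma fnormZ a f : X f -> n (a *: f) = nrm a * n f.
Proof. by have [_ _ h _ _] := XB; exact: h. Qed.

Lemma fnorm0 : n 0 = 0.
Proof. by have := fnormZ 0 subspace0; rewrite scale0r nrm0 mul0r. Qed.

Lemma fnormD f g : X f -> X g -> n (f + g) <= n f + n g.
Proof. by have [_ _ _ h _] := XB; exact: h. Qed.

Lemma fnorm_sum (I : Type) (s : seq I) (F : I -> V -> R[i]) :
  (forall i, X (F i)) -> n (\sum_(i <- s) F i) <= \sum_(i <- s) n (F i).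
Proof.
move=> XF; elim: s => [|i s IH]; first by rewrite !big_nil fnorm0.
by rewrite !big_cons (le_trans (fnormD (XF i) (subspace_sum s XF)))// lerD2l.
Qed.

Lemma linear_on0 T : linear_on X T -> T 0 = 0.
Proof.
move=> lT; have := lT 1 0 0 subspace0 subspace0; rewrite scaler0 addr0 scale1r => /eqP.
by rewrite -subr_eq0 opprD addNKr oppr_eq0 => /eqP.
Qed.

Lemma linear_onZ T a f : linear_on X T -> X f -> T (a *: f) = a * T f.
Proof. by move=> lT Xf; have := lT a f 0 Xf subspace0; rewrite linear_on0// !addr0. Qed.

Lemma linear_onB T f g : linear_on X T -> X f -> X g -> T (f - g) = T f - T g.
Proof.
by move=> lT Xf Xg; have := lT (-1) g f Xg Xf; rewrite !scaleN1r addrC => ->; rewrite addrC.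
Qed.

Lemma linear_on_sum T (I : Type) (s : seq I) (F : I -> V -> R[i]) : linear_on X T ->
  (forall i, X (F i)) -> T (\sum_(i <- s) F i) = \sum_(i <- s) T (F i).
Proof.
move=> lT XF; elim: s => [|i s IH]; first by rewrite !big_nil linear_on0.
rewrite !big_cons -IH -[F i in LHS]scale1r lT ?scale1r//.
exact: subspace_sum.
Qed.

(** Continuity at 0 bounds T on a small ball, hence everywhere after rescaling;
    then opnorm is a finite supremum and the best constant. *)
Lemma sn_dual_le T : sn_dual (normed_snspace X n) T ->
  linear_on X T /\ forall f, X f -> nrm (T f) <= opnorm X n T * n f.
Proof.
move=> [lT cT]; split=> //.
have [C [C0 hC]] : exists C, 0 <= C /\ forall f, X f -> nrm (T f) <= C * n f.
  have : nbhs (T 0) [set z | nrm z <= 1].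
    rewrite (linear_on0 lT); apply/nbhs_ballP; exists 1 => //= z.
    by rewrite -[1]/(1%:C%C) => /nrm_ball; rewrite subr0 => /ltW.
  move=> /(cT 0 subspace0)[m [i [e [e0 he]]]].
  exists (2 / e); split; first by rewrite divr_ge0// ltW.
  have small f : X f -> n f < e -> nrm (T f) <= 1.
    by move=> Xf nf; apply: he; split=> // l; rewrite subr0.
  move=> f Xf; apply/ler_addgt0Pr => d d0.
  pose s := 2 * (n f / e + d / 2).
  have s0 : 0 < s by rewrite mulr_gt0// ltr_wpDl ?divr_gt0// divr_ge0 ?fnorm_ge0// ltW.
  have : nrm (T (s^-1%:C%C *: f)) <= 1.
    apply: small; first exact: subspaceZ.
    rewrite fnormZ// nrmc ger0_norm ?invr_ge0 ?(ltW s0)// ltr_pdivrMl//.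
    have -> : s * e = 2 * n f + d * e by rewrite /s; field; rewrite gt_eqF.
    by have := fnorm_ge0 Xf; have := mulr_gt0 d0 e0; lra.
  rewrite linear_onZ// nrmM nrmc ger0_norm ?invr_ge0 ?(ltW s0)// ler_pdivrMl// mulr1.
  by move=> /le_trans; apply; rewrite /s; lra.
have hs : has_sup [set nrm (T f) | f in [set f | X f /\ n f <= 1]].
  split; first by exists (nrm (T 0)), 0 => //; split; [exact: subspace0|rewrite fnorm0].
  exists C => _ [f [Xf nf] <-]; rewrite (le_trans (hC f Xf))// ler_piMr//.
move=> f Xf; have [nf0|nf0] := eqVneq (n f) 0.
  by rewrite nf0 mulr0 (le_trans (hC f Xf))// nf0 mulr0.
have nf : 0 < n f by rewrite lt_neqAle eq_sym nf0 fnorm_ge0.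
have : nrm (T ((n f)^-1%:C%C *: f)) <= opnorm X n T.
  apply: sup_upper_bound => //; exists ((n f)^-1%:C%C *: f) => //; split; first exact: subspaceZ.
  by rewrite fnormZ// nrmc ger0_norm ?invr_ge0 ?(ltW nf)// mulVf.
by rewrite linear_onZ// nrmM nrmc ger0_norm ?invr_ge0 ?(ltW nf)// ler_pdivrMl// mulrC.
Qed.

Lemma sn_dual_intro T C : linear_on X T -> (forall f, X f -> nrm (T f) <= C * n f) ->
  sn_dual (normed_snspace X n) T.
Proof.
move=> lT hC; split=> // f Xf U /nbhs_ballP[_ /= /posc[e e0 ->] eU].
have C1 : 0 < `|C| + 1 by rewrite ltr_wpDl.
exists 1%N, (fun=> tt), (e / (`|C| + 1)); split; first by rewrite divr_gt0.
move=> g [Xg /(_ ord0) /= gf]; apply: eU; apply/nrm_ball.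
rewrite -linear_onB//; have Xgf : X (g - f).
  by rewrite addrC -scaleN1r; exact: subspace_lin.
apply: (le_lt_trans (hC _ Xgf)); move: gf; rewrite ltr_pdivlMr// mulrC; apply: le_lt_trans.
by rewrite ler_wpM2r ?fnorm_ge0// (le_trans (ler_norm C))// lerDl.
Qed.

Lemma opnorm_bound T C : 0 <= C -> (forall f, X f -> nrm (T f) <= C * n f) -> opnorm X n T <= C.
Proof.
move=> C0 hC; apply: ge_sup.
  by exists (nrm (T 0)), 0 => //; split; [exact: subspace0|rewrite fnorm0].
by move=> _ [f [Xf nf] <-]; rewrite (le_trans (hC f Xf))// ler_piMr.
Qed.

Lemma dense_vanish T C Y : linear_on X T -> (forall f, X f -> nrm (T f) <= C * n f) ->
  sn_dense (normed_snspace X n) Y X -> (forall f, Y f -> T f = 0) -> forall f, X f -> T f = 0.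
Proof.
move=> lT hC [YX dY] TY f Xf; apply: nrm_small_eq0 => e e0.
have C1 : 0 < `|C| + 1 by rewrite ltr_wpDl.
pose U := [set g | X g /\ n (g - f) < e / (`|C| + 1)].
have [|g [Yg [Xg gf]]] := dY f Xf U.
  exists 1%N, (fun=> tt), (e / (`|C| + 1)); split; first by rewrite divr_gt0.
  by move=> g [Xg /(_ ord0)].
have -> : T f = - T (g - f) by rewrite linear_onB// (TY g Yg) sub0r opprK.
have Xgf : X (g - f) by rewrite addrC -scaleN1r; exact: subspace_lin.
rewrite nrmN (le_trans (hC _ Xgf))//; move: gf; rewrite ltr_pdivlMr// mulrC => /ltW; apply: le_trans.
by rewrite ler_wpM2r ?fnorm_ge0// (le_trans (ler_norm C))// lerDl.
Qed.

End NormedFunctions.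

(** * Entire functions of restricted growth *)

Section ExpSpace.
Variables (R : realType) (E : normedModType R[i]) (k : \bar R) (Th : poly_spaces E).
Hypotheses (hk : (1%:E < k)%E) (hTh : holomorphy_type Th).
Implicit Types (f g P Q : E -> R[i]) (x y : E) (a : R[i]) (r rho M : R).

Lemma pbanach j : is_banach (pcar Th j) (pnorm Th j).
Proof. by have [/(_ j)[]] := hTh. Qed.

Lemma pcar_homog j P : pcar Th j P -> homog_poly j P.
Proof. by have [/(_ j)[_ h] _ _] := hTh; exact: h. Qed.

Lemma pcar_entire j P : pcar Th j P -> entire P.
Proof. by move=> /pcar_homog/homog_entire. Qed.

(** Evaluation of a polynomial at a is its derivative of order 0 at a, so the
    second axiom of holomorphy types bounds the values by the norm. *)
Lemma theta_eval : exists2 s : R, 1 <= s & forall j P x, pcar Th j P ->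
  nrm (P x) <= s ^+ j * pnorm Th j P * nrm x ^+ j.
Proof.
have [_ [_ n0] [s s1 hs]] := hTh; exists s => // j P x hP.
have [_] := hs 0%N j x P (leq0n j) hP; rewrite subn0; apply: le_trans.
have eP := pcar_entire hP; rewrite dhatE// fact0 invr1 !scale1r.
suff -> : tcoef P x 0 = (fun=> P x) by rewrite n0.
apply/funext => y; have [r r0 ar] := entire_line x y eP.
by rewrite /tcoef (cf0 r0 ar) scale0r addr0.
Qed.

Definition wnorm f j := weight k j * pnorm Th j (tcoef f 0 j).

(** Summability for every rho when k is finite, and the root condition when k is
    infinite, both say that the weighted norms of the Taylor terms decay faster
    than every geometric sequence. *)
Definition in_exp f := [/\ entire f, forall j, pcar Th j (tcoef f 0 j) &
  forall r, 0 < r -> exists M, forall j, r ^+ j * wnorm f j <= M].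

Lemma pcar_dhat f j : entire f -> pcar Th j (dhat j f 0) <-> pcar Th j (tcoef f 0 j).
Proof.
move=> ef; rewrite dhatE//; split=> h; last exact: subspaceZ (pbanach j) _ _ h.
have n0 : j`!%:R != 0 :> R[i] by rewrite pnatr_eq0 -lt0n fact_gt0.
by rewrite -[tcoef _ _ _]scale1r -(mulVf n0) -scalerA; exact: subspaceZ (pbanach j) _ _ h.
Qed.

Lemma wnorm_ge0 f j : pcar Th j (tcoef f 0 j) -> 0 <= wnorm f j.
Proof. by move=> h; rewrite mulr_ge0 ?(ltW (weight_gt0 j hk))// (fnorm_ge0 (pbanach j)). Qed.

Lemma exp_termE rho f j : entire f -> exp_term Th k rho f j = rho ^- j * wnorm f j.
Proof. by move=> ef; rewrite /exp_term taylor_coefE// mulrA. Qed.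

(** Using the decay at the ratio 2 / rho leaves the factor 2^-j for summation. *)
Lemma in_exp_dyadic f rho : in_exp f -> 0 < rho ->
  exists2 M, 0 <= M & forall j, rho ^- j * wnorm f j <= M * (1 / 2) ^+ j.
Proof.
move=> [ef pf hf] rho0; have [M hM] := hf (2 / rho) (divr_gt0 (ltr0n _ 2) rho0).
exists M => [|j].
  by apply: le_trans (hM 0%N); rewrite expr0 mul1r wnorm_ge0.
have := hM j; rewrite !expr_div_n expr1n mul1r [M * _]mulrC ler_pdivlMl ?exprn_gt0// => h.
by rewrite mulrA.
Qed.

Lemma in_exp_cvg f rho : in_exp f -> 0 < rho -> cvgn (series (exp_term Th k rho f)).
Proof.
move=> hf rho0; have [ef pf _] := hf; have [M M0 hM] := in_exp_dyadic hf rho0.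
have t0 n : 0 <= exp_term Th k rho f n.
  by rewrite exp_termE// mulr_ge0 ?wnorm_ge0// invr_ge0 exprn_ge0// ltW.
apply: (series_bounded_cvg t0 (dyadic_sum M0 _)).1 => n.
by rewrite exp_termE.
Qed.

Lemma exp_term_ge0 f rho n : in_exp f -> 0 < rho -> 0 <= exp_term Th k rho f n.
Proof.
move=> [ef pf _] rho0.
by rewrite exp_termE// mulr_ge0 ?wnorm_ge0// invr_ge0 exprn_ge0// ltW.
Qed.

Lemma exp_carP f : exp_car Th k f <-> in_exp f.
Proof.
split=> [[ef pf hf]|hf].
  have pf' j : pcar Th j (tcoef f 0 j) by apply/pcar_dhat.
  split=> // r r0; rewrite /wnorm; case: k hk hf => [q| |]// k1 hf.
    have rV0 : 0 < r^-1 by rewrite invr_gt0.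
    have t0 n : 0 <= exp_term Th q%:E r^-1 f n.
      rewrite /exp_term taylor_coefE// mulr_ge0 ?(fnorm_ge0 (pbanach n))//.
      by rewrite mulr_ge0 ?(ltW (weight_gt0 n k1))// invr_ge0 exprn_ge0 ?(ltW rV0).
    have [M hM] := cvg_series_bounded t0 (hf _ rV0); exists M => j.
    by have := hM j; rewrite /exp_term taylor_coefE// exprVn invrK -mulrA.
  have e0 : 0 < r^-1 by rewrite invr_gt0.
  have /cvgrPdist_le/(_ _ e0)[N _ hN] := hf.
  apply: (@bounded_seq R _ N.+1 1) => j Nj; have := hN j (ltnW Nj).
  have j0 : (0 < j)%N by case: j Nj.
  have p0 := fnorm_ge0 (pbanach j) (pf' j).
  rewrite sub0r normrN ger0_norm ?powR_ge0// taylor_coefE//= mul1r => h.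
  have : (pnorm Th j (tcoef f 0 j) `^ j%:R^-1) ^+ j <= r^-1 ^+ j.
    by rewrite lerXn2r ?nnegrE ?powR_ge0// ltW.
  rewrite -powR_mulrn ?powR_ge0// -powRrM mulVf ?pnatr_eq0 -?lt0n// powRr1// exprVn.
  by rewrite -ler_pdivlMl ?exprn_gt0// mulr1.
have [ef pf hM] := hf; split=> // [j|]; first by apply/pcar_dhat.
have cf rho : 0 < rho -> cvgn (series (exp_term Th k rho f)) := @in_exp_cvg f rho hf.
move: hM cf; rewrite /wnorm; case: k hk => [q| |]// k1 hM cf.
apply/cvgrPdist_le => e e0; have [M hMe] := hM (2 / e) (divr_gt0 (ltr0n _ 2) e0).
have M1 : 0 < `|M| + 1 by rewrite ltr_wpDl.
have t01 : 0 <= (1 / 2 : R) < 1 by lra.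
have M1V : 0 < (`|M| + 1)^-1 by rewrite invr_gt0.
have [N hN] := pow_small t01 M1V.
exists N.+1 => // j /= Nj; have j0 : (0 < j)%N by case: j Nj.
have p0 := fnorm_ge0 (pbanach j) (pf j).
rewrite sub0r normrN ger0_norm ?powR_ge0// taylor_coefE//.
have pe : pnorm Th j (tcoef f 0 j) <= e ^+ j.
  have := hMe j; rewrite /= mul1r expr_div_n mulrAC ler_pdivrMr ?exprn_gt0// => h.
  have h2 := hN j (ltnW Nj); move: h2; rewrite expr_div_n expr1n mul1r lef_pV2 ?posrE ?exprn_gt0// => h2.
  have ej0 : 0 < e ^+ j by rewrite exprn_gt0.
  rewrite -(ler_pM2l (exprn_gt0 j (ltr0n R 2))) (le_trans h)// ler_wpM2r ?(ltW ej0)//.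
  by rewrite (le_trans _ h2)// (le_trans (ler_norm M))// lerDl.
have eE : e = (e ^+ j) `^ j%:R^-1.
  by rewrite -powR_mulrn ?(ltW e0)// -powRrM mulfV ?pnatr_eq0 -?lt0n// powRr1// ltW.
rewrite [leRHS]eE; apply: ge0_ler_powR; rewrite ?invr_ge0 ?nnegrE//.
by rewrite exprn_ge0 ?(ltW e0).
Qed.

Lemma exp_norm_le f rho M : in_exp f -> 0 < rho ->
  (forall n, \sum_(j < n) rho ^- j * wnorm f j <= M) -> exp_norm Th k rho f <= M.
Proof.
move=> hf rho0 hM; have [ef _ _] := hf.
apply: (series_bounded_cvg (fun n => exp_term_ge0 n hf rho0) _).2 => n.
by under eq_bigr do rewrite exp_termE//.
Qed.

Lemma exp_norm_partial f rho n : in_exp f -> 0 < rho ->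
  \sum_(j < n) rho ^- j * wnorm f j <= exp_norm Th k rho f.
Proof.
move=> hf rho0; have [ef _ _] := hf.
rewrite (eq_bigr (fun j : 'I_n => exp_term Th k rho f j)); last by move=> j _; rewrite exp_termE.
by apply: series_partial_le; [move=> m; exact: exp_term_ge0|exact: in_exp_cvg].
Qed.

Lemma exp_norm_ge0 f rho : in_exp f -> 0 < rho -> 0 <= exp_norm Th k rho f.
Proof. by move=> hf rho0; have := exp_norm_partial 0 hf rho0; rewrite big_ord0. Qed.

Lemma exp_norm_anti f rho rho' : in_exp f -> 0 < rho -> rho <= rho' ->
  exp_norm Th k rho' f <= exp_norm Th k rho f.
Proof.
move=> hf rho0 rr; have [ef pf _] := hf; have r0 : 0 < rho' by exact: lt_le_trans rr.
apply: exp_norm_le => // n; apply: le_trans (exp_norm_partial n hf rho0).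
apply: ler_sum => j _; rewrite ler_wpM2r ?wnorm_ge0//.
by rewrite lef_pV2 ?posrE ?exprn_gt0// lerXn2r ?nnegrE ?(ltW rho0) ?(ltW r0).
Qed.

Lemma wnorm_lin a f g j : in_exp f -> in_exp g ->
  wnorm (a *: f + g) j <= nrm a * wnorm f j + wnorm g j.
Proof.
move=> [ef pf _] [eg pg _]; rewrite /wnorm tcoef_lin// mulrCA -mulrDr.
rewrite ler_wpM2l ?(ltW (weight_gt0 j hk))//.
by rewrite (le_trans (fnormD (pbanach j) (subspaceZ (pbanach j) a (pf j)) (pg j)))// (fnormZ (pbanach j)).
Qed.

Lemma in_exp_lin a f g : in_exp f -> in_exp g -> in_exp (a *: f + g).
Proof.
move=> hf hg; have [ef pf bf] := hf; have [eg pg bg] := hg.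
split; first exact: entire_lin.
  by move=> j; rewrite tcoef_lin//; exact: subspace_lin (pbanach j) _ _ _ (pf j) (pg j).
move=> r r0; have [M hM] := bf r r0; have [M' hM'] := bg r r0.
exists (nrm a * M + M') => j.
rewrite (le_trans (ler_wpM2l (exprn_ge0 j (ltW r0)) (wnorm_lin a j hf hg)))// mulrDr mulrCA.
by rewrite lerD// ler_wpM2l ?nrm_ge0.
Qed.

Lemma exp_norm_lin a f g rho : in_exp f -> in_exp g -> 0 < rho ->
  exp_norm Th k rho (a *: f + g) <= nrm a * exp_norm Th k rho f + exp_norm Th k rho g.
Proof.
move=> hf hg rho0; apply: exp_norm_le => //; first exact: in_exp_lin.
move=> n; apply: (@le_trans _ _ (\sum_(j < n) (nrm a * (rho ^- j * wnorm f j) + rho ^- j * wnorm g j))).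
  apply: ler_sum => j _; rewrite [nrm a * _]mulrCA -mulrDr ler_wpM2l ?invr_ge0 ?exprn_ge0 ?(ltW rho0)//.
  exact: wnorm_lin.
rewrite big_split/= -mulr_sumr lerD ?exp_norm_partial//.
by rewrite ler_wpM2l ?nrm_ge0 ?exp_norm_partial.
Qed.

Lemma in_exp0 : in_exp 0.
Proof.
split; first exact: entire0.
  by move=> j; rewrite tcoef0; exact: subspace0 (pbanach j).
by move=> r r0; exists 0 => j; rewrite /wnorm tcoef0 (fnorm0 (pbanach j)) !mulr0.
Qed.

Lemma exp_norm0 rho : 0 < rho -> exp_norm Th k rho 0 = 0.
Proof.
move=> rho0; apply/eqP; rewrite eq_le exp_norm_ge0 ?andbT//; last exact: in_exp0.
apply: exp_norm_le => //; first exact: in_exp0.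
by move=> n; rewrite big1// => j _; rewrite /wnorm tcoef0 (fnorm0 (pbanach j)) !mulr0.
Qed.

Lemma in_expZ a f : in_exp f -> in_exp (a *: f).
Proof. by move=> hf; rewrite -[_ *: _]addr0; exact: in_exp_lin hf in_exp0. Qed.

Lemma in_expD f g : in_exp f -> in_exp g -> in_exp (f + g).
Proof. by move=> hf hg; rewrite -[f]scale1r; exact: in_exp_lin. Qed.

Lemma in_expB f g : in_exp f -> in_exp g -> in_exp (f - g).
Proof. by move=> hf hg; rewrite addrC -scaleN1r; exact: in_exp_lin. Qed.

Lemma in_exp_sum (I : Type) (s : seq I) (F : I -> E -> R[i]) :
  (forall i, in_exp (F i)) -> in_exp (\sum_(i <- s) F i).
Proof.
move=> hF; elim: s => [|i s IH]; first by rewrite big_nil; exact: in_exp0.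
by rewrite big_cons; exact: in_expD.
Qed.

Lemma exp_normZ a f rho : in_exp f -> 0 < rho ->
  exp_norm Th k rho (a *: f) <= nrm a * exp_norm Th k rho f.
Proof.
move=> hf rho0; have := exp_norm_lin a hf in_exp0 rho0.
by rewrite addr0 exp_norm0// addr0.
Qed.

Lemma pcar_in_exp j P : pcar Th j P -> in_exp P.
Proof.
move=> hP; have hP' := pcar_homog hP; split; first exact: homog_entire hP'.
  by move=> m; rewrite (tcoef_homog m hP'); case: eqP => [->//|_]; exact: subspace0 (pbanach m).
move=> r r0; exists (r ^+ j * (weight k j * pnorm Th j P)) => m.
rewrite /wnorm (tcoef_homog m hP'); case: eqP => [->//|_].
rewrite (fnorm0 (pbanach m)) !mulr0 !mulr_ge0 ?exprn_ge0 ?(ltW r0) ?(ltW (weight_gt0 j hk))//.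
exact: fnorm_ge0 (pbanach j) _ hP.
Qed.

Lemma exp_norm_pcar j P rho : pcar Th j P -> 0 < rho ->
  exp_norm Th k rho P <= rho ^- j * (weight k j * pnorm Th j P).
Proof.
move=> hP rho0; have hP' := pcar_homog hP.
have p0 : 0 <= rho ^- j * (weight k j * pnorm Th j P).
  by rewrite !mulr_ge0 ?invr_ge0 ?exprn_ge0 ?(ltW rho0) ?(ltW (weight_gt0 j hk))// (fnorm_ge0 (pbanach j)).
apply: exp_norm_le; [exact: pcar_in_exp hP|by []|move=> n].
have termE (m : 'I_n) : rho ^- m * wnorm P m = if m == j :> nat then rho ^- j * (weight k j * pnorm Th j P) else 0.
  by rewrite /wnorm (tcoef_homog m hP'); case: eqP => [->//|_]; rewrite (fnorm0 (pbanach m)) !mulr0.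
rewrite (eq_bigr _ (fun m _ => termE m)) -big_mkcond/=.
have [jn|nj] := ltnP j n; first by rewrite (big_pred1 (Ordinal jn)).
by rewrite big_pred0// => m; apply/negbTE; rewrite neq_ltn (leq_trans (ltn_ord m)).
Qed.

Definition tsum f n := \sum_(j < n) tcoef f 0 j.

Lemma tsum_in_exp f n : in_exp f -> in_exp (tsum f n).
Proof. by move=> [_ pf _]; apply: in_exp_sum => j; exact: pcar_in_exp (pf j). Qed.

Lemma tcoef_sum (I : Type) (s : seq I) (F : I -> E -> R[i]) m : (forall i, entire (F i)) ->
  entire (\sum_(i <- s) F i) /\ tcoef (\sum_(i <- s) F i) 0 m = \sum_(i <- s) tcoef (F i) 0 m.
Proof.
move=> eF; elim: s => [|i s [es IH]].
  by rewrite !big_nil tcoef0; split=> //; exact: entire0.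
rewrite !big_cons -[F i]scale1r; split; first exact: entire_lin.
by rewrite tcoef_lin// IH !scale1r.
Qed.

Lemma tcoef_tsum f n m : in_exp f -> tcoef (tsum f n) 0 m = if (m < n)%N then tcoef f 0 m else 0.
Proof.
move=> [_ pf _]; have [_ ->] := @tcoef_sum _ (index_enum _) (fun j : 'I_n => tcoef f 0 j) m
  (fun j => pcar_entire (pf j)).
rewrite (eq_bigr (fun j : 'I_n => if m == j :> nat then tcoef f 0 m else 0)); last first.
  by move=> j _; rewrite (tcoef_homog m (pcar_homog (pf j))); case: eqP => [->|].
rewrite -big_mkcond/=; case: ifP => mn.
  by rewrite (big_pred1 (Ordinal mn))// => j; rewrite eq_sym.
by rewrite big_pred0// => j; apply: contraFF mn => /eqP ->.
Qed.

Lemma tsum_cvg f rho : in_exp f -> 0 < rho -> forall e, 0 < e ->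
  exists N, forall n, (N <= n)%N -> exp_norm Th k rho (f - tsum f n) <= e.
Proof.
move=> hf rho0 e e0; have [M M0 hM] := in_exp_dyadic hf rho0.
have M1 : 0 < 2 * M + 1 by rewrite ltr_wpDl ?mulr_ge0.
have t01 : 0 <= (1 / 2 : R) < 1 by lra.
have [N hN] := pow_small t01 (divr_gt0 e0 M1); exists N => n /hN hn.
have hfn := in_expB hf (tsum_in_exp n hf).
have [ef pf _] := hf; have [en _ _] := tsum_in_exp n hf.
apply: exp_norm_le => // m.
have tE j : tcoef (f - tsum f n) 0 j = if (j < n)%N then 0 else tcoef f 0 j.
  rewrite addrC -scaleN1r tcoef_lin// (tcoef_tsum n j hf) scaleN1r.
  by case: ifP => _; rewrite ?addNr// oppr0 add0r.
have t0 : 0 <= 1 - 1 / 2 :> R by lra.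
apply: (@le_trans _ _ (M * \sum_(n <= j < maxn n m) (1 / 2) ^+ j)); last first.
  apply: (@le_trans _ _ (M * ((1 / 2) ^+ n / (1 - 1 / 2)))).
    by rewrite ler_wpM2l// geometric_tail.
  apply: (@le_trans _ _ ((2 * M + 1) * (1 / 2) ^+ n)); last by rewrite mulrC -ler_pdivlMr.
  have -> : M * ((1 / 2) ^+ n / (1 - 1 / 2)) = 2 * M * (1 / 2) ^+ n.
    move: ((1 / 2) ^+ n) => t; field; lra.
  by rewrite ler_wpM2r ?exprn_ge0// lerDl.
pose u j := rho ^- j * wnorm (f - tsum f n) j.
have u0 j : 0 <= u j.
  by have [_ pfn _] := hfn; rewrite mulr_ge0 ?wnorm_ge0// invr_ge0 exprn_ge0// ltW.
apply: (@le_trans _ _ (\sum_(j < maxn n m) u j)).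
  rewrite -!(big_mkord xpredT u) (@big_cat_nat _ _ _ m 0 (maxn n m))//= ?leq_maxr//.
  by rewrite lerDl sumr_ge0.
rewrite -(big_mkord xpredT u) (@big_cat_nat _ _ _ n 0 (maxn n m))//= ?leq_maxl//.
rewrite big_nat big1 ?add0r => [|j /andP[_ jn]]; last first.
  by rewrite /u /wnorm tE jn (fnorm0 (pbanach j)) !mulr0.
rewrite mulr_sumr !big_nat; apply: ler_sum => j /andP[nj _].
by rewrite /u /wnorm tE ltnNge nj/=; exact: hM.
Qed.

(** The norms exp_norm rho are directed, so a functional is continuous if and
    only if a multiple of one of them dominates it. *)
Definition bounded_functional (T : (E -> R[i]) -> R[i]) :=
  (forall a f g, in_exp f -> in_exp g -> T (a *: f + g) = a * T f + T g) /\
  exists rho C, [/\ 0 < rho, 0 <= C & forall f, in_exp f -> nrm (T f) <= C * exp_norm Th k rho f].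

Lemma functional0 T : bounded_functional T -> T 0 = 0.
Proof.
move=> [lT _]; have := lT 1 0 0 in_exp0 in_exp0; rewrite scaler0 addr0 mul1r => /eqP.
by rewrite -subr_eq0 opprD addNKr oppr_eq0 => /eqP.
Qed.

Lemma functionalZ T a f : bounded_functional T -> in_exp f -> T (a *: f) = a * T f.
Proof.
move=> bT hf; have [lT _] := bT; have := lT a f 0 hf in_exp0.
by rewrite (functional0 bT) !addr0.
Qed.

Lemma functionalB T f g : bounded_functional T -> in_exp f -> in_exp g -> T (f - g) = T f - T g.
Proof.
move=> [lT _] hf hg; have := lT (-1) g f hg hf.
by rewrite scaleN1r addrC => ->; rewrite mulN1r addrC.
Qed.

Lemma functional_sum T (I : Type) (s : seq I) (F : I -> E -> R[i]) : bounded_functional T ->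
  (forall i, in_exp (F i)) -> T (\sum_(i <- s) F i) = \sum_(i <- s) T (F i).
Proof.
move=> bT hF; have [lT _] := bT; elim: s => [|i s IH]; first by rewrite !big_nil functional0.
rewrite !big_cons -IH -[F i in LHS]scale1r lT ?mul1r//.
exact: in_exp_sum.
Qed.

Lemma functional_pcar T : bounded_functional T -> exists rho C, [/\ 0 < rho, 0 <= C &
  forall j P, pcar Th j P -> nrm (T P) <= C * (rho ^- j * weight k j) * pnorm Th j P].
Proof.
move=> [_ [rho [C [rho0 C0 hC]]]]; exists rho, C; split=> // j P hP.
rewrite (le_trans (hC _ (pcar_in_exp hP)))// -!mulrA ler_wpM2l//.
exact: exp_norm_pcar.
Qed.

End ExpSpace.

(** * Exponential monomials and the Borel transform *)

Section ExpMonomials.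
Variables (R : realType) (E : normedModType R[i]) (k : \bar R) (Th : poly_spaces E).
Hypotheses (hk : (1%:E < k)%E) (hTh : holomorphy_type Th) (hpi1 : pi1_type Th).
Implicit Types (f g P Q : E -> R[i]) (x y : E) (a z w : R[i]) (r rho M : R) (phi psi : dual E).

Let pb j := pbanach hTh j.

Definition expmon n psi phi : E -> R[i] := fun x => psi x ^+ n * cexp (phi x).
Definition bimon n j psi phi : E -> R[i] := fun x => psi x ^+ n * phi x ^+ j.

Lemma expmon_entire n psi phi : entire (expmon n psi phi).
Proof.
apply: line_holo_entire; apply: line_holoM; last exact: line_holo_cexp.
by apply: line_holoX; exact: line_holo_dual.
Qed.

Lemma tcoef_expmon n psi phi m : tcoef (expmon n psi phi) 0 m =
  if (n <= m)%N then (m - n)`!%:R^-1 *: bimon n (m - n) psi phi else 0.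
Proof.
have [eX cX _] := cexpP R.
apply/funext => y; rewrite /tcoef.
have eF : ent (fun z => psi y ^+ n * cexp (phi y * z)).
  move=> r; apply: apxZ.
  apply: apx_ext (@apx_affine _ _ 0 (phi y) _ r (lexx _) (eX _)) => z _.
  by rewrite add0r.
have -> : (fun z => expmon n psi phi (0 + z *: y)) =
    (fun z => z ^+ n * (psi y ^+ n * cexp (phi y * z))).
  by apply/funext => z; rewrite /expmon add0r !dualZ exprMn mulrA [phi y * z]mulrC.
case: ifPn => [nm|]; last by rewrite -ltnNge => nm; exact: cf_mulX_lt ltr01 (eF 1) nm.
rewrite -{1}(subnKC nm) (cf_mulX _ _ ltr01 (eF 1)).
have eG : apx (fun z => cexp (phi y * z)) 1.
  apply: apx_ext (@apx_affine _ _ 0 (phi y) _ 1 (lexx _) (eX _)) => z _.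
  by rewrite add0r.
rewrite (cfZ _ _ ltr01 eG) (cf_scale _ _ ltr01 (eX 1)) cX fctE_Z /bimon; ring.
Qed.

Lemma pow_finite j psi : finite_poly j (fun x => psi x ^+ j).
Proof.
exists 1%N, (fun=> 1), (fun=> (fun x => psi x ^+ j)); split; first by exists psi.
by rewrite big_ord1 scale1r.
Qed.

Lemma pow_pcar j psi : pcar Th j (fun x => psi x ^+ j).
Proof. by have [h _ _] := hpi1; apply: h; exact: pow_finite. Qed.

Lemma finite_poly_span j P : finite_poly j P -> exists (n : nat) (c : 'I_n -> R[i]) (psi : 'I_n -> dual E),
  P = \sum_(i < n) c i *: (fun x => psi i x ^+ j).
Proof.
move=> [n [c [g [hg ->]]]]; have /choice[psi hpsi] : forall i, exists psi : dual E, (fun x => psi x ^+ j) = g i.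
  by move=> i; have [psi _ <-] := hg i; exists psi.
by exists n, c, psi; apply: eq_bigr => i _; rewrite hpsi.
Qed.

Lemma pi1_power : exists2 K : R, 0 < K & forall phi j,
  pcar Th j (fun x => phi x ^+ j) /\ pnorm Th j (fun x => phi x ^+ j) <= K ^+ j * nrm phi ^+ j.
Proof.
have [_ [K K0 hK] _] := hpi1; exists K => // phi j; split; first exact: pow_pcar.
have := hK phi 1 j; rewrite nrm1 mulr1; congr (pnorm Th j _ <= _).
by apply/funext => x; rewrite mul1r.
Qed.

(** The product psi^n phi^j, times a binomial coefficient, is the coefficient of
    w^n in (phi + w psi)^(n + j).  A discrete Cauchy integral over |w| = 1 extracts
    it as a mean of powers of functionals, whose norms are known; keeping the
    binomial coefficient on the left turns (n + j)! / (n! j!) into a gain. *)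
Lemma bimon_norm : exists2 K : R, 0 < K & forall n j psi phi,
  pcar Th (n + j) (bimon n j psi phi) /\
  pnorm Th (n + j) (bimon n j psi phi) * 'C(n + j, n)%:R <= (K * (nrm phi + nrm psi)) ^+ (n + j).
Proof.
have [K K0 hK] := pi1_power; exists K => // n j psi phi.
set m := (n + j)%N; pose N := (2 ^ m.+1)%N.
have mN : (m < N)%N by exact: ltn_pow2.
pose F (l : 'I_N) : E -> R[i] := ((rou R m ^+ l) ^+ n)^-1 *: (fun x => (phi + rou R m ^+ l *: psi) x ^+ m).
have pF l : pcar Th m (F l) by apply: (subspaceZ (pb m)); have [] := hK (phi + rou R m ^+ l *: psi) m.
have C0 : 'C(m, n)%:R != 0 :> R[i] by rewrite pnatr_eq0 -lt0n bin_gt0 leq_addr.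
have N0 : N%:R != 0 :> R[i] by rewrite pnatr_eq0 -lt0n expn_gt0.
have FE : bimon n j psi phi = ('C(m, n)%:R^-1 * N%:R^-1) *: \sum_(l < N) F l.
  apply/funext => x; rewrite fctE_Z fct_sumE -mulrA.
  apply: (canRL (mulKf C0)); rewrite /bimon.
  pose q : {poly R[i]} := \poly_(i < m.+1) ('C(m, i)%:R * (phi x ^+ (m - i) * psi x ^+ i)).
  have qE w : q.[w] = (phi x + w * psi x) ^+ m.
    rewrite horner_poly exprDn; apply: eq_bigr => i _.
    by rewrite exprMn -mulr_natl; ring.
  have -> : 'C(m, n)%:R * (psi x ^+ n * phi x ^+ j) = avg m (horner q) 1 n.
    rewrite avg_poly ?oner_neq0 ?(leq_ltn_trans (leq_addr _ _) mN)//; last first.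
      exact: leq_trans (size_poly _ _) mN.
    by rewrite coef_poly ltnS leq_addr /m addKn [phi x ^+ j * _]mulrC.
  rewrite /avg; congr (_ * _); apply: eq_bigr => l _.
  by rewrite mul1r qE /F fctE_Z mulrC.
have CR0 : 0 < 'C(m, n)%:R :> R by rewrite ltr0n bin_gt0 leq_addr.
split; first by rewrite FE; apply: (subspaceZ (pb m)); exact: subspace_sum (pb m) _ _ _ pF.
rewrite FE (fnormZ (pb m)); last exact: subspace_sum (pb m) _ _ _ pF.
rewrite nrmM !nrmV !nrm_nat mulrC -!mulrA mulVKf ?gt_eqF//.
have NR0 : 0 < N%:R :> R by rewrite ltr0n expn_gt0.
rewrite ler_pdivrMl// (le_trans (fnorm_sum (pb m) _ pF))//.
rewrite (le_trans (ler_sum _ (_ : forall l, true -> _ <= (K * (nrm phi + nrm psi)) ^+ m)))//.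
  move=> l _; have [hc hn] := hK (phi + rou R m ^+ l *: psi) m.
  rewrite /F (fnormZ (pb m))// nrmV !nrmX nrm_rou !expr1n invr1 mul1r (le_trans hn)//.
  rewrite -exprMn lerXn2r ?nnegrE ?mulr_ge0 ?addr_ge0 ?nrm_ge0 ?(ltW K0)//.
  rewrite ler_wpM2l ?(ltW K0)// (le_trans (nrmD _ _))// lerD2l.
  by rewrite nrmZ nrmX nrm_rou expr1n mul1r.
by rewrite sumr_const card_ord mulr_natl.
Qed.

Lemma expmon_wnorm : exists2 K : R, 0 < K & forall n psi phi,
  (forall m, pcar Th m (tcoef (expmon n psi phi) 0 m)) /\
  forall m, pnorm Th m (tcoef (expmon n psi phi) 0 m) <=
    n`!%:R * ((K * (nrm phi + nrm psi)) ^+ m / m`!%:R).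
Proof.
have [K K0 hK] := bimon_norm; exists K => // n psi phi.
have f0 i : 0 < i`!%:R :> R by rewrite ltr0n fact_gt0.
have B0 m : 0 <= n`!%:R * ((K * (nrm phi + nrm psi)) ^+ m / m`!%:R).
  by rewrite mulr_ge0 ?divr_ge0 ?exprn_ge0 ?mulr_ge0 ?addr_ge0 ?nrm_ge0 ?(ltW K0).
have main m : (n <= m)%N -> pcar Th m (bimon n (m - n) psi phi) /\
    pnorm Th m (bimon n (m - n) psi phi) * 'C(m, n)%:R <= (K * (nrm phi + nrm psi)) ^+ m.
  by move=> nm; have := hK n (m - n)%N psi phi; rewrite (subnKC nm).
split=> m; rewrite tcoef_expmon; case: ifPn => [nm|_].
- by apply: (subspaceZ (pb m)); have [] := main m nm.
- exact: subspace0 (pb m).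
- have [hc hn] := main m nm; rewrite (fnormZ (pb m))// nrmV nrm_nat.
  have CR0 : 'C(m, n)%:R != 0 :> R by rewrite pnatr_eq0 -lt0n bin_gt0.
  have -> : (m - n)`!%:R^-1 * pnorm Th m (bimon n (m - n) psi phi) =
      n`!%:R * (pnorm Th m (bimon n (m - n) psi phi) * 'C(m, n)%:R / m`!%:R).
    by rewrite -(bin_fact nm) !natrM; field; rewrite CR0 !gt_eqF.
  by rewrite ler_wpM2l// ler_wpM2r// invr_ge0.
- by rewrite (fnorm0 (pb m)).
Qed.

Lemma weight_fact_dyadic (L : R) : 0 <= L -> exists2 M, 0 <= M &
  forall m, weight k m * (L ^+ m / m`!%:R) <= M * (1 / 2) ^+ m.
Proof.
move=> L0; have L1 : 0 < 2 * (L + 1) by rewrite mulr_gt0// ltr_wpDl.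
have [M hM] := weight_fact hk L1.
have f0 m : 0 < m`!%:R :> R by rewrite ltr0n fact_gt0.
exists M => [|m]; first by have := hM 0%N; rewrite weight0 fact0 divr1 expr0 mulr1; lra.
rewrite expr_div_n expr1n mul1r ler_pdivlMr ?exprn_gt0// (le_trans _ (hM m))//.
have -> : weight k m * (L ^+ m / m`!%:R) * 2 ^+ m = weight k m / m`!%:R * (L ^+ m * 2 ^+ m).
  by move: (2 ^+ m) => v; ring.
have -> : (2 * (L + 1)) ^+ m * (weight k m / m`!%:R) =
    weight k m / m`!%:R * ((L + 1) ^+ m * 2 ^+ m).
  by rewrite exprMn; move: ((L + 1) ^+ m) (2 ^+ m) => u v; ring.
rewrite ler_wpM2l ?divr_ge0 ?(ltW (weight_gt0 m hk))// ler_wpM2r ?exprn_ge0//.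
by rewrite lerXn2r ?nnegrE ?addr_ge0// lerDl.
Qed.

Lemma expmon_in_exp n psi phi : in_exp k Th (expmon n psi phi).
Proof.
have [K K0 /(_ n psi phi)[hp hn]] := expmon_wnorm.
split=> //; first exact: expmon_entire.
move=> r r0; set L := K * _ in hn.
have L0 : 0 <= L by rewrite mulr_ge0 ?addr_ge0 ?nrm_ge0// ltW.
clearbody L; have rL : 0 <= r * L by rewrite mulr_ge0// ltW.
have [M M0 hM] := weight_fact_dyadic rL.
exists (n`!%:R * M) => m; rewrite /wnorm.
apply: (@le_trans _ _ (r ^+ m * (weight k m * (n`!%:R * (L ^+ m / m`!%:R))))).
  by rewrite ler_wpM2l ?exprn_ge0 ?(ltW r0)// ler_wpM2l ?(ltW (weight_gt0 m hk))// hn.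
have -> : r ^+ m * (weight k m * (n`!%:R * (L ^+ m / m`!%:R))) =
    n`!%:R * (weight k m * ((r * L) ^+ m / m`!%:R)).
  by rewrite exprMn; move: (L ^+ m) => u; ring.
rewrite ler_wpM2l// (le_trans (hM m))// ler_piMr// exprn_ile1//; lra.
Qed.

Definition expdual phi : E -> R[i] := fun x => cexp (phi x).

Lemma expdualE phi : expdual phi = expmon 0 phi phi.
Proof. by apply/funext => x; rewrite /expmon expr0 mul1r. Qed.

Lemma expdual_in_exp phi : in_exp k Th (expdual phi).
Proof. by rewrite expdualE; exact: expmon_in_exp. Qed.

Lemma tcoef_expdual phi m : tcoef (expdual phi) 0 m = m`!%:R^-1 *: (fun x => phi x ^+ m).
Proof.
rewrite expdualE tcoef_expmon/= subn0; congr (_ *: _).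
by apply/funext => x; rewrite /bimon expr0 mul1r.
Qed.

Lemma expdual_bound B : 0 <= B -> forall rho, 0 < rho -> exists M, forall phi, nrm phi <= B ->
  exp_norm Th k rho (expdual phi) <= M.
Proof.
move=> B0 rho rho0; have [K K0 hK] := pi1_power.
have L0 : 0 <= K * B / rho by rewrite divr_ge0 ?mulr_ge0// ltW.
have [M M0 hM] := weight_fact_dyadic L0; exists (2 * M) => phi phiB.
suff u m : rho ^- m * wnorm k Th (expdual phi) m <= M * (1 / 2) ^+ m.
  by apply: exp_norm_le (dyadic_sum M0 u) => //; exact: expdual_in_exp.
apply: le_trans (hM m); have [hc hn] := hK phi m.
rewrite /wnorm tcoef_expdual (fnormZ (pb m))// nrmV nrm_nat.
have -> : (K * B / rho) ^+ m / m`!%:R = rho ^- m * (m`!%:R^-1 * (K ^+ m * B ^+ m)).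
  by rewrite expr_div_n exprMn; ring.
rewrite mulrCA ler_wpM2l ?(ltW (weight_gt0 m hk))// ler_wpM2l ?invr_ge0 ?exprn_ge0 ?(ltW rho0)//.
rewrite ler_wpM2l ?invr_ge0// (le_trans hn)// ler_wpM2l ?exprn_ge0 ?(ltW K0)//.
by rewrite lerXn2r ?nnegrE ?nrm_ge0.
Qed.

(** The exponential series of z psi, multiplied by exp phi, converges in the
    space, geometrically and uniformly on discs. *)
Lemma expdual_line phi psi Z : 0 <= Z -> forall rho, 0 < rho -> exists2 M, 0 <= M &
  forall z N, nrm z <= Z ->
    exp_norm Th k rho (expdual (phi + z *: psi)
      - \sum_(n < N) (z ^+ n / n`!%:R) *: expmon n psi phi) <= M * (1 / 2) ^+ N.
Proof.
move=> Z0 rho rho0; have [K K0 hK] := bimon_norm.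
pose L := K * (nrm phi + nrm psi) * (1 + Z) / rho.
have L1 : 0 <= K * (nrm phi + nrm psi) by rewrite mulr_ge0 ?addr_ge0 ?nrm_ge0 ?(ltW K0).
have L0 : 0 <= L by rewrite divr_ge0 ?(ltW rho0)// mulr_ge0// addr_ge0.
have [M M0 hM] := weight_fact_dyadic L0; exists (2 * M) => [|z N zZ]; first by rewrite mulr_ge0.
set S := \sum_(n < N) _.
have hS : in_exp k Th S by apply: in_exp_sum => // n; apply: in_expZ => //; exact: expmon_in_exp.
have he := expdual_in_exp (phi + z *: psi).
have [ee _ _] := he; have [eS _ _] := hS.
have fn0 n : n`!%:R != 0 :> R[i] by rewrite pnatr_eq0 -lt0n fact_gt0.
have hd := in_expB hk hTh he hS.
pose t m (n : nat) : E -> R[i] := (z ^+ n / (n`!%:R * (m - n)`!%:R)) *: bimon n (m - n) psi phi.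
have tS m : tcoef S 0 m = \sum_(n < N | (n <= m)%N) t m n.
  have eF (n : 'I_N) : entire ((z ^+ n / n`!%:R) *: expmon n psi phi).
    by have [] := in_expZ hk hTh (z ^+ n / n`!%:R) (expmon_in_exp n psi phi).
  have [_ ->] := tcoef_sum (index_enum _) m eF.
  rewrite [RHS]big_mkcond/=; apply: eq_bigr => n _.
  have := tcoef_lin (z ^+ n / n`!%:R) 0 m (expmon_entire n psi phi) (@entire0 _ E).
  rewrite addr0 tcoef0 addr0 => ->; rewrite tcoef_expmon; case: ifP => _; last by rewrite scaler0.
  by rewrite scalerA -mulrA -invfM.
have te m : tcoef (expdual (phi + z *: psi)) 0 m = \sum_(n < m.+1) t m n.
  rewrite tcoef_expdual; apply/funext => x; rewrite fctE_Z fct_sumE.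
  rewrite [(phi + z *: psi) x](_ : _ = phi x + z * psi x)// exprDn mulr_sumr.
  apply: eq_bigr => n _; have nm : (n <= m)%N by rewrite -ltnS.
  have b0 : 'C(m, n)%:R != 0 :> R[i] by rewrite pnatr_eq0 -lt0n bin_gt0.
  rewrite /t fctE_Z /bimon -(bin_fact nm) !natrM exprMn -mulr_natl.
  by field; rewrite b0 !fn0.
have pt m n : (n <= m)%N -> pcar Th m (t m n) /\
    pnorm Th m (t m n) <= (K * (nrm phi + nrm psi)) ^+ m / m`!%:R * nrm z ^+ n.
  move=> nm; have := hK n (m - n)%N psi phi; rewrite (subnKC nm) => -[hc hn].
  split; first exact: subspaceZ (pb m) _ _ hc.
  have CR0 : 0 < 'C(m, n)%:R :> R by rewrite ltr0n bin_gt0.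
  have fR0 i : 0 < i`!%:R :> R by rewrite ltr0n fact_gt0.
  rewrite /t (fnormZ (pb m))// nrmM nrmX nrmV nrmM !nrm_nat.
  have -> : nrm z ^+ n / (n`!%:R * (m - n)`!%:R) * pnorm Th m (bimon n (m - n) psi phi) =
      pnorm Th m (bimon n (m - n) psi phi) * 'C(m, n)%:R / m`!%:R * nrm z ^+ n.
    rewrite -(bin_fact nm) !natrM; move: (nrm z ^+ n) (pnorm _ _ _) => u v.
    by field; rewrite !gt_eqF.
  by rewrite ler_wpM2r ?exprn_ge0 ?nrm_ge0// ler_wpM2r// invr_ge0.
have td m : tcoef (expdual (phi + z *: psi) - S) 0 m =
    \sum_(n < m.+1 | (N <= n)%N) t m n.
  have := tcoef_lin (-1) 0 m eS ee; rewrite scaleN1r addrC => ->.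
  rewrite scaleN1r te tS addrC.
  rewrite -(big_mkord xpredT (t m)) -(big_mkord (fun n => (n <= m)%N) (t m)).
  rewrite -(big_mkord (fun n => (N <= n)%N) (t m)).
  rewrite (bigID (fun n => (N <= n)%N) xpredT)/= -[RHS]addr0 -addrA; congr (_ + _).
  rewrite (big_nat_widen _ _ (maxn N m.+1)) ?leq_maxr// (big_nat_widen _ N (maxn N m.+1)) ?leq_maxl//.
  apply/eqP; rewrite subr_eq0; apply/eqP; apply: eq_bigl => n.
  by rewrite -ltnNge ltnS andbC.
apply: exp_norm_le => // p.
pose u m := rho ^- m * wnorm k Th (expdual (phi + z *: psi) - S) m.
have um m : u m <= if (m < N)%N then 0 else M * (1 / 2) ^+ m.
  rewrite /u /wnorm td; case: ltnP => [mN|Nm].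
    rewrite big_pred0 ?(fnorm0 (pb m)) ?mulr0// => n; apply/negbTE.
    by rewrite -ltnNge (leq_ltn_trans _ mN)// -ltnS.
  apply: le_trans (hM m).
  have -> : weight k m * (L ^+ m / m`!%:R) = rho ^- m * (weight k m *
      ((K * (nrm phi + nrm psi)) ^+ m / m`!%:R * (1 + Z) ^+ m)).
    by rewrite /L expr_div_n exprMn; move: ((1 + Z) ^+ m) ((K * _) ^+ m) => u1 u2; ring.
  rewrite ler_wpM2l ?invr_ge0 ?exprn_ge0 ?(ltW rho0)// ler_wpM2l ?(ltW (weight_gt0 m hk))//.
  rewrite big_mkcond/= (le_trans (fnorm_sum (pb m) _ _))//.
    by move=> n; case: ifP => _; [apply: (pt m n _).1; rewrite -ltnS|exact: subspace0 (pb m)].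
  rewrite exprDn mulr_sumr; apply: ler_sum => n _.
  have nm : (n <= m)%N by rewrite -ltnS.
  have A0 : 0 <= (K * (nrm phi + nrm psi)) ^+ m / m`!%:R by rewrite divr_ge0 ?exprn_ge0.
  rewrite expr1n mul1r; case: ifP => _; last first.
    by rewrite (fnorm0 (pb m)) mulr_ge0// mulrn_wge0// exprn_ge0.
  rewrite (le_trans (pt m n nm).2)// ler_wpM2l// (le_trans (_ : _ <= Z ^+ n))//.
    by rewrite lerXn2r ?nnegrE ?nrm_ge0.
  by rewrite -mulr_natr ler_peMr ?exprn_ge0// ler1n bin_gt0.
apply: (@le_trans _ _ (M * \sum_(N <= m < maxn N p) (1 / 2) ^+ m)); last first.
  have t01 : 0 <= (1 / 2 : R) < 1 by lra.
  apply: (@le_trans _ _ (M * ((1 / 2) ^+ N / (1 - 1 / 2)))).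
    by rewrite ler_wpM2l// geometric_tail.
  by rewrite le_eqVlt; apply/orP; left; apply/eqP; move: ((1 / 2) ^+ N) => v; field; lra.
apply: (@le_trans _ _ (\sum_(m < p) if (m < N)%N then 0 else M * (1 / 2) ^+ m)).
  by apply: ler_sum => m _; exact: um.
rewrite mulr_sumr; pose v m := if (m < N)%N then 0 else M * (1 / 2 : R) ^+ m.
have v0 m : 0 <= v m by rewrite /v; case: ifP => // _; rewrite mulr_ge0// exprn_ge0.
apply: (@le_trans _ _ (\sum_(m < maxn N p) v m)).
  rewrite -!(big_mkord xpredT v) (@big_cat_nat _ _ _ p 0 (maxn N p))//= ?leq_maxr//.
  by rewrite lerDl sumr_ge0.
rewrite -(big_mkord xpredT v) (@big_cat_nat _ _ _ N 0 (maxn N p))//= ?leq_maxl//.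
rewrite big_nat big1 ?add0r => [|m /andP[_ mN]]; last by rewrite /v mN.
by rewrite !big_nat; apply: ler_sum => m /andP[Nm _]; rewrite /v ltnNge Nm.
Qed.

Section Functional.
Variables (T : (E -> R[i]) -> R[i]).
Hypothesis bT : bounded_functional k Th T.

Definition borel_transform phi := T (expdual phi).

(** T is applied to the expansion of exp(phi + z psi) in powers of z. *)
Lemma borel_line phi psi :
  ent (fun z => borel_transform (phi + z *: psi)) /\
  forall n, cf (fun z => borel_transform (phi + z *: psi)) n = n`!%:R^-1 * T (expmon n psi phi).
Proof.
have [_ [rho [C [rho0 C0 hC]]]] := bT.
pose p N : {poly R[i]} := \poly_(n < N) (n`!%:R^-1 * T (expmon n psi phi)).
have main Z : 0 <= Z -> exists2 M, 0 <= M & forall N z, nrm z <= Z ->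
    nrm (borel_transform (phi + z *: psi) - (p N).[z]) <= M * (1 / 2) ^+ N.
  move=> Z0; have [M M0 hM] := expdual_line phi psi Z0 rho0.
  exists (C * M) => [|N z zZ]; first by rewrite mulr_ge0.
  have hF (n : 'I_N) : in_exp k Th ((z ^+ n / n`!%:R) *: expmon n psi phi).
    by apply: in_expZ => //; exact: expmon_in_exp.
  have hS := in_exp_sum hk hTh (index_enum _) hF.
  have he := expdual_in_exp (phi + z *: psi).
  have -> : (p N).[z] = T (\sum_(n < N) (z ^+ n / n`!%:R) *: expmon n psi phi).
    rewrite (functional_sum hk hTh (index_enum _) bT hF) horner_poly; apply: eq_bigr => n _.
    by rewrite (functionalZ hTh _ bT (expmon_in_exp n psi phi)); ring.
  rewrite /borel_transform -(functionalB bT he hS) (le_trans (hC _ (in_expB hk hTh he hS)))//.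
  by rewrite -mulrA ler_wpM2l// hM.
have t01 : 0 <= (1 / 2 : R) < 1 by lra.
have close Z e : 0 <= Z -> 0 < e -> exists N0, forall N, (N0 <= N)%N -> forall z, nrm z <= Z ->
    nrm (borel_transform (phi + z *: psi) - (p N).[z]) <= e.
  move=> Z0 e0; have [M M0 hM] := main Z Z0; have M1 : 0 < M + 1 by rewrite ltr_wpDl.
  have [N0 hN] := pow_small t01 (divr_gt0 e0 M1); exists N0 => N /hN hN' z zZ.
  rewrite (le_trans (hM N z zZ))// (le_trans (_ : _ <= (M + 1) * (1 / 2) ^+ N))//.
    by rewrite ler_wpM2r ?exprn_ge0// lerDl.
  by rewrite mulrC -ler_pdivlMr.
have eB : ent (fun z => borel_transform (phi + z *: psi)).
  move=> Z e e0; have [Z0|Z0] := leP 0 Z; last first.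
    by exists 0 => z zr; have := nrm_ge0 z; rewrite leNgt (le_lt_trans zr Z0).
  have [N0 h] := close Z e Z0 e0; exists (p N0); exact: h.
split=> // n; apply: nrm_small_eq => e e0.
have [N0 h] := close 1 e ler01 e0.
have -> : n`!%:R^-1 * T (expmon n psi phi) = cf (horner (p (maxn N0 n.+1))) n.
  by rewrite cf_poly coef_poly leq_max ltnSn orbT.
have := @cf_dist _ _ _ 1 e n ltr01 (eB 1) (apx_poly (p (maxn N0 n.+1)) 1).
rewrite expr1n mulr1; apply=> z z1; apply: h; rewrite ?leq_maxl ?z1//.
Qed.

Lemma borel_line_holo : line_holo borel_transform.
Proof.
apply: line_holo_ent => [phi psi|phi]; first by have [] := borel_line phi psi.
have [_ [rho [C [rho0 C0 hC]]]] := bT.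
have B0 : 0 <= nrm phi + 1 by rewrite addr_ge0 ?nrm_ge0.
have [M hM] := expdual_bound B0 rho0.
exists 1, (C * M); split=> // psi psi1.
rewrite (le_trans (hC _ (expdual_in_exp psi)))// ler_wpM2l// hM//.
by have := nrmD (psi - phi) phi; rewrite subrK; lra.
Qed.

Lemma borel_tcoef n psi : tcoef borel_transform 0 n psi = n`!%:R^-1 * T (fun x => psi x ^+ n).
Proof.
have [_ /(_ n)] := borel_line 0 psi; rewrite /tcoef => ->; congr (_ * T _).
by apply/funext => x; rewrite /expmon [(0 : dual E) x](_ : _ = 0)// cexp0 mulr1.
Qed.

(** The Taylor coefficients of the transform at 0 are the values of T at the
    powers psi^n; these span a dense subspace of the polynomials, and Taylor
    series converge in the space. *)
Lemma borel_injective : (forall phi, borel_transform phi = 0) -> forall f, in_exp k Th f -> T f = 0.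
Proof.
move=> B0; have Tpow n psi : T (fun x => psi x ^+ n) = 0.
  have n0 : n`!%:R^-1 != 0 :> R[i] by rewrite invr_eq0 pnatr_eq0 -lt0n fact_gt0.
  apply: (mulfI n0); rewrite mulr0 -borel_tcoef /tcoef.
  have -> : (fun z => borel_transform (0 + z *: psi)) = (fun=> 0) by apply/funext => z; rewrite B0.
  by rewrite cf_cst; case: ifP.
have [lT [rho [C [rho0 C0 hC]]]] := bT.
have Tp j P : pcar Th j P -> T P = 0.
  have [_ _ dj] := hpi1.
  have lTj : linear_on (pcar Th j) T.
    by move=> a f g hf' hg; apply: lT; [exact: (pcar_in_exp hk hTh hf')|exact: (pcar_in_exp hk hTh hg)].
  have hCj f : pcar Th j f -> nrm (T f) <= C * (rho ^- j * weight k j) * pnorm Th j f.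
    move=> hf'; rewrite (le_trans (hC _ (pcar_in_exp hk hTh hf')))// -!mulrA ler_wpM2l//.
    exact: exp_norm_pcar.
  apply: (dense_vanish (pb j) lTj hCj (dj j)).
  move=> _ /finite_poly_span[n [c [psi ->]]].
  rewrite (linear_on_sum (pb j) _ lTj) => [|i]; last exact: (subspaceZ (pb j) _ (pow_pcar j (psi i))).
  by rewrite big1// => i _; rewrite (linear_onZ (pb j) _ lTj (pow_pcar j (psi i))) Tpow mulr0.
move=> f hf; apply: nrm_small_eq0 => e e0.
have C1 : 0 < C + 1 by rewrite ltr_wpDl.
have [N /(_ N (leqnn _)) hN] := tsum_cvg hk hTh hf rho0 (divr_gt0 e0 C1).
have hS := tsum_in_exp hk hTh N hf; have [_ pf _] := hf.
have -> : T f = T (f - tsum f N).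
  rewrite (functionalB bT hf hS) (functional_sum hk hTh _ bT) => [|j]; last exact: (pcar_in_exp hk hTh (pf j)).
  rewrite big1 ?subr0// => j _; exact: (Tp _ _ (pf j)).
rewrite (le_trans (hC _ (in_expB hk hTh hf hS)))// (le_trans (ler_wpM2l C0 hN))//.
by rewrite mulr_fit ?nrm_ge0 ?(ltW e0).
Qed.

End Functional.
End ExpMonomials.

(** * Convolution operators *)

Section ConvolutionOperator.
Variables (R : realType) (E : normedModType R[i]) (k : \bar R) (Th : poly_spaces E).
Hypotheses (hk : (1%:E < k)%E) (hTh : holomorphy_type Th) (hpi1 : pi1_type Th).
Implicit Types (f g P Q : E -> R[i]) (x y : E) (a z w : R[i]) (r rho M : R) (phi psi : dual E).

Lemma weight_lower : exists2 M : R, 0 < M & forall j, 1 <= M * weight k j.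
Proof.
case: k hk => [q| |]// k1; last by exists 1 => // j; rewrite mul1r.
have q1 : 1 <= q by rewrite -lee_fin ltW.
have [M hM] := weight_superexp q1 (ltr01 : 0 < (1 : R)).
exists M => [|j]; last by have := hM j; rewrite expr1n.
by have := hM 0%N; rewrite weight0 expr0 mulr1; lra.
Qed.

Lemma in_exp_bound x : exists L M : R, [/\ 0 < L, 0 <= M & forall f j, in_exp k Th f ->
  nrm (tcoef f 0 j x) <= M * (L ^+ j * wnorm k Th f j)].
Proof.
have [s s1 hs] := theta_eval hTh; have [M M0 hM] := weight_lower.
have s0 : 0 <= s by rewrite (le_trans _ s1).
exists (s * nrm x + 1), M; split; [by rewrite ltr_wpDl// mulr_ge0 ?nrm_ge0|exact: ltW|].
move=> f j [_ pf _]; rewrite (le_trans (hs j _ x (pf j)))//.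
have pn0 := fnorm_ge0 (pbanach hTh j) (pf j).
have -> : s ^+ j * pnorm Th j (tcoef f 0 j) * nrm x ^+ j = (s * nrm x) ^+ j * (1 * pnorm Th j (tcoef f 0 j)).
  by rewrite exprMn; ring.
have -> : M * ((s * nrm x + 1) ^+ j * wnorm k Th f j) =
    (s * nrm x + 1) ^+ j * (M * weight k j * pnorm Th j (tcoef f 0 j)).
  by rewrite /wnorm; ring.
apply: ler_pM; rewrite ?exprn_ge0 ?mulr_ge0 ?nrm_ge0//; last by rewrite ler_wpM2r.
by rewrite lerXn2r ?nnegrE ?addr_ge0 ?mulr_ge0 ?nrm_ge0// lerDl.
Qed.

Lemma in_exp_global f x : in_exp k Th f -> exists F, [/\ ent F, forall n, cf F n = tcoef f 0 n x,
  forall z, F z = f (z *: x) &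
  forall z, ncvg (fun N => \sum_(n < N) tcoef f 0 n x * z ^+ n) (f (z *: x))].
Proof.
move=> hf; have [ef pf bf] := hf; apply: entire_global => // r r0.
have [L [M [L0 M0 hLM]]] := in_exp_bound x.
have [B hB] := bf (L * r) (mulr_gt0 L0 r0); exists (M * B) => n.
rewrite (le_trans (ler_wpM2r (exprn_ge0 n (ltW r0)) (hLM f n hf)))//.
have -> : M * (L ^+ n * wnorm k Th f n) * r ^+ n = M * ((L * r) ^+ n * wnorm k Th f n).
  by rewrite exprMn; ring.
by rewrite ler_wpM2l.
Qed.

Lemma eval_bounded x : exists rho C, [/\ 0 < rho, 0 <= C &
  forall f, in_exp k Th f -> nrm (f x) <= C * exp_norm Th k rho f].
Proof.
have [L [M [L0 M0 hLM]]] := in_exp_bound x.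
exists L^-1, M; split; rewrite ?invr_gt0// => f hf.
have [F [_ _ _ /(_ 1)]] := in_exp_global x hf; rewrite scale1r => hl.
rewrite -[f x]subr0; apply: ncvg_le hl _; exists 0%N => n _; rewrite subr0.
rewrite (le_trans (nrm_sum _ _ _))//.
have L0' : 0 < L^-1 by rewrite invr_gt0.
rewrite (le_trans _ (ler_wpM2l M0 (exp_norm_partial hk hTh n hf L0')))// mulr_sumr.
by apply: ler_sum => j _; rewrite expr1n mulr1 exprVn invrK; exact: hLM.
Qed.

Lemma in_exp_ext f g : in_exp k Th f -> in_exp k Th g ->
  (forall n x, tcoef f 0 n x = tcoef g 0 n x) -> f = g.
Proof.
move=> hf hg fg; apply/funext => x.
have [_ [_ _ _ /(_ 1)]] := in_exp_global x hf; have [_ [_ _ _ /(_ 1)]] := in_exp_global x hg.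
rewrite scale1r => h1 h2; apply: (ncvg_unique h2); move=> e /h1[n0 h]; exists n0 => n /h.
by rewrite (eq_bigr (fun m : 'I_n => tcoef f 0 m x * 1 ^+ m))// => m _; rewrite fg.
Qed.

(** The derivative of the exponential series is the series itself. *)
Lemma cf_cexp_shift (u : R[i]) : cf (fun z => cexp (u + z)) 1 = cexp u.
Proof.
have [eX cX lX] := cexpP R.
pose D z := cf (fun w => cexp (z + w)) 1.
have aD r : 0 < r -> apx D (r / 2) /\ forall n, cf D n = n`!%:R^-1.
  move=> r0; split; first by have [] := cf_deriv 0 r0 (eX r).
  move=> n; have [_ ->] := cf_deriv n r0 (eX r).
  by rewrite cX factS natrM invfM mulrA divff ?mul1r// pnatr_eq0.
have r0 : 0 < 2 * (nrm u + 1) by rewrite mulr_gt0// ltr_wpDl ?nrm_ge0.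
have [a cD] := aD _ r0; have s0 : 0 < 2 * (nrm u + 1) / 2 by rewrite divr_gt0.
apply/eqP; rewrite -subr_eq0 -[cf _ 1]/(D u); apply/eqP.
apply: (@apx_cf0 R (fun z => D z - cexp z) _ s0).
- by apply: apxB.
- by move=> n; rewrite (cfB n s0 a (eX _)) cD cX subrr.
- by rewrite mulrAC divff// mul1r ltrDl.
Qed.

Lemma dhat_expdual phi x y : dhat 1 (expdual phi) x y = phi y * expdual phi x.
Proof.
have [eX _ _] := cexpP R.
rewrite dhatE; last by rewrite expdualE; exact: expmon_entire.
rewrite (_ : 1`! = 1%N)// scale1r /tcoef /expdual.
have := cf_scale (phi y) 1 ltr01 (ent_shift (phi x) eX 1).
rewrite expr1 (cf_cexp_shift (phi x)) => <-; congr (cf _ 1).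
by apply/funext => z; rewrite dual_line.
Qed.

Section Operator.
Variable L : (E -> R[i]) -> E -> R[i].
Hypothesis hL : conv_op Th k L.

Lemma op_in_exp f : in_exp k Th f -> in_exp k Th (L f).
Proof. by move=> /(exp_carP hk hTh) hf; apply/(exp_carP hk hTh); have [[h _ _] _] := hL; exact: h. Qed.

Lemma op_lin a f g : in_exp k Th f -> in_exp k Th g -> L (a *: f + g) = a *: L f + L g.
Proof.
move=> /(exp_carP hk hTh) hf /(exp_carP hk hTh) hg.
have [[_ lL _] _] := hL; exact: lL a f g hf hg.
Qed.

Lemma op0 : L 0 = 0.
Proof.
have h0 := in_exp0 k hTh; have := op_lin 1 h0 h0; rewrite scaler0 addr0 scale1r => /eqP.
by rewrite -subr_eq0 opprD addNKr oppr_eq0 => /eqP.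
Qed.

Lemma opZ a f : in_exp k Th f -> L (a *: f) = a *: L f.
Proof. by move=> hf; have := op_lin a hf (in_exp0 k hTh); rewrite op0 !addr0. Qed.

(** The usual rescaling: a neighbourhood of 0 that L maps into the unit ball of
    one norm contains a ball of another norm, since finitely many norms are
    dominated by the one with the smallest parameter. *)
Lemma op_bounded rho : 0 < rho -> exists rho' C, [/\ 0 < rho', 0 <= C &
  forall f, in_exp k Th f -> exp_norm Th k rho (L f) <= C * exp_norm Th k rho' f].
Proof.
move=> rho0; have [[_ _ cL] _] := hL.
have c0 : exp_car Th k 0 by apply/(exp_carP hk hTh); exact: in_exp0.
have [|n [i [e [e0 he]]]] := cL 0 c0 [set g | exp_car Th k g /\ exp_norm Th k rho g < 1].
  exists 1%N, (fun=> PosNum rho0), 1; split; first exact: ltr01.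
  by move=> g [cg /(_ ord0)/=]; rewrite op0 subr0 => lt1; split; [exact: cg|exact: lt1].
pose m := \big[Num.min/1]_(l < n) (i l)%:num.
have m0 : 0 < m by rewrite /m; elim/big_ind : _ => // u v u0 v0; rewrite lt_min u0.
have mi l : m <= (i l)%:num by rewrite /m bigmin_le_cond.
have small f : in_exp k Th f -> exp_norm Th k m f < e -> exp_norm Th k rho (L f) <= 1.
  move=> hf fe; apply/ltW; have [|_] := he f; last by [].
  split; first exact/(exp_carP hk hTh).
  by move=> l; rewrite subr0; apply: le_lt_trans fe; exact: exp_norm_anti.
exists m, (2 / e); split=> //; first by rewrite divr_ge0// ltW.
move=> f hf; apply/ler_addgt0Pr => d d0.
have p0 := exp_norm_ge0 hk hTh hf m0.
pose s := 2 * (exp_norm Th k m f / e) + d.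
have fe0 : 0 <= exp_norm Th k m f / e by rewrite divr_ge0// ltW.
have s0 : 0 < s by rewrite ltr_wpDl// mulr_ge0.
have sV : 0 < s^-1 by rewrite invr_gt0.
have hsf := in_expZ hk hTh (s^-1%:C%C) hf.
have : exp_norm Th k rho (L (s^-1%:C%C *: f)) <= 1.
  apply: small => //; rewrite (le_lt_trans (exp_normZ hk hTh _ hf m0))//.
  rewrite nrmc gtr0_norm// ltr_pdivrMl//.
  have -> : s * e = 2 * exp_norm Th k m f + d * e by rewrite /s; field; rewrite gt_eqF.
  by have := mulr_gt0 d0 e0; lra.
rewrite opZ// => h1.
have -> : L f = s%:C%C *: (s^-1%:C%C *: L f).
  by rewrite scalerA -rmorphM/= mulfV ?gt_eqF// scale1r.
have hLs := in_expZ hk hTh (s^-1%:C%C) (op_in_exp hf).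
rewrite (le_trans (exp_normZ hk hTh _ hLs rho0))// nrmc gtr0_norm//.
rewrite (le_trans (ler_wpM2l (ltW s0) h1))// mulr1 /s; lra.
Qed.

Lemma op_eval_bounded x : bounded_functional k Th (fun f => L f x).
Proof.
split=> [a f g hf hg|]; first by rewrite op_lin.
have [rho [C [rho0 C0 hC]]] := eval_bounded x.
have [rho' [C' [rho'0 C'0 hC']]] := op_bounded rho0.
exists rho', (C * C'); split=> // [|f hf]; first by rewrite mulr_ge0.
by rewrite (le_trans (hC _ (op_in_exp hf)))// -mulrA ler_wpM2l ?hC'.
Qed.

Lemma op_comp_bounded S : bounded_functional k Th S -> bounded_functional k Th (fun f => S (L f)).
Proof.
move=> [lS [rho [C [rho0 C0 hC]]]]; split=> [a f g hf hg|].
  by rewrite op_lin// lS//; exact: op_in_exp.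
have [rho' [C' [rho'0 C'0 hC']]] := op_bounded rho0.
exists rho', (C * C'); split=> // [|f hf]; first by rewrite mulr_ge0.
by rewrite (le_trans (hC _ (op_in_exp hf)))// -mulrA ler_wpM2l ?hC'.
Qed.

(** The Borel transform of the functional f -> L f 0. *)
Definition symbol phi := L (expdual phi) 0.

(** Commuting with directional derivatives, L maps exp phi to a solution g of
    the equations dg a = phi a g, which determine the Taylor series of g. *)
Lemma op_expdual phi : L (expdual phi) = symbol phi *: expdual phi.
Proof.
have he := expdual_in_exp hk hTh hpi1 phi.
have hg := op_in_exp he; set g := L (expdual phi) in hg *.
have [eg _ _] := hg.
have ode x y : dhat 1 g x y = phi y * g x.
  have [_ /(_ y (expdual phi))] := hL; move=> /(_ (proj2 (exp_carP hk hTh _) he)).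
  have -> : (fun x => dhat 1 (expdual phi) x y) = phi y *: expdual phi.
    by apply/funext => v; rewrite dhat_expdual.
  by rewrite opZ// => /(congr1 (fun f => f x)).
apply: in_exp_ext => //; first exact: in_expZ.
move=> n x; have [F [eF cF FE _]] := in_exp_global x hg.
have ef := entire0 (V := E).
have -> : tcoef (symbol phi *: expdual phi) 0 n x = symbol phi * (n`!%:R^-1 * phi x ^+ n).
  have [ee _ _] := he.
  have := tcoef_lin (symbol phi) 0 n ee ef; rewrite addr0 tcoef0 addr0 => ->.
  by rewrite tcoef_expdual.
have rec m : m.+1%:R * tcoef g 0 m.+1 x = phi x * tcoef g 0 m x.
  rewrite -!cF; have [_ <-] := cf_deriv m ltr01 (eF 1).
  rewrite -(cfZ _ _ ltr01 (eF 1)); congr (cf _ m); apply/funext => z.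
  rewrite FE -ode dhatE// (_ : 1`! = 1%N)// scale1r /tcoef; congr (cf _ 1); apply/funext => w.
  by rewrite FE scalerDl.
elim: n => [|n IH].
  by rewrite -cF (cf0 ltr01 (eF 1)) FE scale0r fact0 invr1 mul1r expr0 mulr1.
have n0 : n.+1%:R != 0 :> R[i] by rewrite pnatr_eq0.
apply: (mulfI n0); rewrite rec IH factS natrM invfM exprS.
have -> : n.+1%:R * (symbol phi * (n.+1%:R^-1 / n`!%:R * (phi x * phi x ^+ n))) =
  n.+1%:R / n.+1%:R * (phi x * (symbol phi * (n`!%:R^-1 * phi x ^+ n))) by ring.
by rewrite divff// mul1r.
Qed.

(** Applying L to exp(phi + z psi) gives symbol(phi + z psi) exp(phi + z psi),
    which is divisible by z^d; the coefficient of z^n on the other side is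
    L(psi^n exp phi) / n!. *)
Lemma op_expmon phi psi d n (g : R[i] -> R[i]) : ent g ->
  (forall z, symbol (phi + z *: psi) = z ^+ d * g z) -> (n < d)%N ->
  L (expmon n psi phi) = 0.
Proof.
move=> eg gE nd; apply/funext => x.
have [_ /(_ n)] := borel_line hk hTh hpi1 (op_eval_bounded x) phi psi.
have [eX _ _] := cexpP R.
have eXl : ent (fun z => cexp (phi x + psi x * z)).
  by move=> r; exact: apx_affine (lexx _) (eX _).
have -> : (fun z => borel_transform (fun f => L f x) (phi + z *: psi)) =
    (fun z => z ^+ d * (g z * cexp (phi x + psi x * z))).
  apply/funext => z; rewrite /borel_transform op_expdual fctE_Z gE -mulrA /expdual.
  have -> : (phi + z *: psi : dual E) x = phi x + z * psi x by [].
  by rewrite (mulrC z).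
rewrite (cf_mulX_lt ltr01 (apxM (eg 1) (eXl 1)) nd) => /esym/eqP.
by rewrite mulf_eq0 invr_eq0 pnatr_eq0 eqn0Ngt fact_gt0/= => /eqP.
Qed.

End Operator.
End ConvolutionOperator.

(** * Division on a normed space *)

Section LineDivision.
Variables (R : realType) (V : normedModType R[i]).
Implicit Types (p q b : V) (r e d M : R) (z w c : R[i]).

Lemma ent_leading (g : R[i] -> R[i]) : ent g -> (exists z, g z != 0) ->
  exists m g1, [/\ ent g1, g1 0 != 0 & forall z, g z = z ^+ m * g1 z].
Proof.
move=> eg [z0 gz0].
have ex : exists n, cf g n != 0.
  apply: contrapT => no; move/eqP: gz0; apply.
  have r0 : 0 < nrm z0 + 1 by rewrite ltr_wpDl ?nrm_ge0.
  apply: (apx_cf0 r0 (eg _)) => [n|]; last by rewrite ltrDl.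
  by apply/eqP; rewrite -[_ == _]negbK; apply/negP => gn; apply: no; exists n.
case: (ex_minnP ex) => m gm mmin.
have [|g1 eg1 gE] := @ent_factor R g 0 m eg.
  move=> i im; rewrite (_ : (fun z => g (0 + z)) = g); last by apply/funext => z; rewrite add0r.
  by apply/eqP; rewrite -[_ == _]negbK; apply/negP => /mmin; rewrite leqNgt im.
have gE' z : g z = z ^+ m * g1 z by rewrite gE subr0.
exists m, g1; split=> //; move: gm.
have -> : g = (fun z => z ^+ m * g1 z) by apply/funext.
by rewrite -{2}[m]addn0 (cf_mulX _ _ ltr01 (eg1 1)) (cf0 ltr01 (eg1 1)).
Qed.

(** Near 0 the zeros of an entire function that is not identically zero are
    isolated, with a quantitative lower bound on annuli. *)
Lemma ent_annulus (g : R[i] -> R[i]) : ent g -> (exists z, g z != 0) ->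
  exists2 s, 0 < s & forall r, 0 < r -> exists2 m, 0 < m &
    forall z, r <= nrm z -> nrm z <= s -> m <= nrm (g z).
Proof.
move=> eg /(ent_leading eg)[m [g1 [eg1 g10 gE]]].
have e0 : 0 < nrm (g1 0) / 2 by rewrite divr_gt0// nrm_gt0.
have [d d0 hd] := apx_unifcont ler01 (eg1 1) e0.
exists (Num.min 1 d) => [|r r0]; first by rewrite lt_min ltr01.
exists (r ^+ m * (nrm (g1 0) / 2)) => [|z rz]; first by rewrite mulr_gt0// exprn_gt0.
rewrite le_min => /andP[z1 zd]; rewrite gE nrmM nrmX ler_pM ?exprn_ge0 ?(ltW r0) ?(ltW e0)//.
  by rewrite lerXn2r ?nnegrE ?nrm_ge0// ltW.
have := hd z 0 z1; rewrite nrm0 subr0 => /(_ ler01 zd).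
have := nrm_tri (g1 0) (g1 z) 0; rewrite !subr0 (nrm_distC (g1 0)); lra.
Qed.

Variables F G : V -> R[i].
Hypotheses (eF : forall p b, ent (fun z => F (p + z *: b)))
  (eG : forall p b, ent (fun z => G (p + z *: b))) (hF : line_holo F) (hG : line_holo G)
  (ordGF : forall p b, ord_le (fun z => G (p + z *: b)) (fun z => F (p + z *: b))).

(** On a small circle |z| = r in a direction b in which G is not identically
    zero, G is bounded below, uniformly in the base point; the quotient on the
    disc inside is recovered from the circle by discrete Cauchy integrals,
    which depend holomorphically on the base point. *)
Lemma local_quotient p b : (exists z, G (p + z *: b) != 0) -> exists d M (H : V -> R[i]), 0 < d /\
  forall q, nrm (q - p) <= d -> [/\ F q = H q * G q, nrm (H q) <= M &
    forall b' r', nrm b' * r' <= d -> apx (fun z => H (q + z *: b')) r'].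
Proof.
move=> Gb.
have [s s0 hs] := ent_annulus (eG p b) Gb.
have [dF [MF [dF0 hFb]]] := hF p.
have [dG [K [dG0 K0 hlip]]] := line_holo_lip p hG.
pose d0 := Num.min dF dG.
have d00 : 0 < d0 by rewrite lt_min dF0.
have b1 : 0 < nrm b + 1 by rewrite ltr_wpDl ?nrm_ge0.
pose r := Num.min (s / 2) (d0 / 4 / (nrm b + 1)).
have r0 : 0 < r by rewrite lt_min !divr_gt0.
have rs : 2 * r <= s by rewrite mulrC -ler_pdivlMr// ge_min lexx.
have rb : 2 * r * nrm b <= d0 / 2.
  apply: (@le_trans _ _ (2 * (d0 / 4 / (nrm b + 1)) * (nrm b + 1))).
    apply: ler_pM; rewrite ?mulr_ge0 ?nrm_ge0 ?(ltW r0)// ?lerDl//.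
    by rewrite ler_wpM2l// ge_min lexx orbT.
  have -> : 2 * (d0 / 4 / (nrm b + 1)) * (nrm b + 1) = d0 / 2.
    by field; rewrite gt_eqF.
  by [].
have [m m0 hm] := hs r r0.
have K1 : 0 < K + 1 by rewrite ltr_wpDl.
pose d := Num.min (d0 / 2) (m / 2 / (K + 1)).
have dp : 0 < d by rewrite lt_min !divr_gt0.
have inball q z : nrm (q - p) <= d -> nrm z <= 2 * r -> nrm (q + z *: b - p) <= d0.
  move=> qd zr; rewrite addrAC (le_trans (nrmD _ _))// [leRHS]splitr lerD//.
    by rewrite (le_trans qd)// ge_min lexx.
  by rewrite nrmZ (le_trans _ rb)// ler_wpM2r ?nrm_ge0.
have Gm q z : nrm (q - p) <= d -> r <= nrm z -> nrm z <= 2 * r -> m / 2 <= nrm (G (q + z *: b)).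
  move=> qd rz zr; have pp : nrm (p - p) <= d by rewrite subrr nrm0 ltW.
  have lip : nrm (G (q + z *: b) - G (p + z *: b)) <= m / 2.
    apply: le_trans (hlip (p + z *: b) (q + z *: b) _ _) _.
    - by apply: le_trans (inball p z pp zr) _; rewrite ge_min lexx orbT.
    - by apply: le_trans (inball q z qd zr) _; rewrite ge_min lexx orbT.
    rewrite opprD addrACA subrr addr0 (le_trans (ler_wpM2l K0 qd))//.
    apply: (@le_trans _ _ ((K + 1) * (m / 2 / (K + 1)))); last by rewrite mulrC divfK// gt_eqF.
    by apply: ler_pM; rewrite ?(ltW dp) ?lerDl// ge_min lexx orbT.
  have := hm z rz (le_trans zr rs).
  have := nrm_tri (G (p + z *: b)) (G (q + z *: b)) 0; rewrite !subr0 (nrm_distC (G (p + _))); lra.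
have FM q z : nrm (q - p) <= d -> nrm z <= 2 * r -> nrm (F (q + z *: b)) <= MF.
  move=> qd zr; apply: (hFb _ _).1; apply: le_trans (inball q z qd zr) _; by rewrite ge_min lexx.
have MF0 : 0 <= MF.
  have pp : nrm (p - p) <= dF by rewrite subrr nrm0 ltW.
  by have [h _] := hFb p pp; apply: le_trans (nrm_ge0 _) h.
have [c cr] := complex_of_nrm (ltW r0).
have c0 : c != 0 by rewrite -nrm_gt0 cr.
have c2 : nrm c < 2 * r by rewrite cr; lra.
have r20 : 0 < 2 * r by rewrite mulr_gt0.
have quot q : nrm (q - p) <= d -> exists u, apx u (2 * r) /\
    forall z : R[i], nrm z <= 2 * r -> F (q + z *: b) = u z * G (q + z *: b).
  move=> qd; have Gc : G (q + c *: b) != 0.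
    by rewrite -nrm_gt0 (lt_le_trans _ (Gm q c qd _ (ltW c2))) ?divr_gt0 ?cr.
  by have [u au uE] := ent_division (eF q b) (eG q b) r20 (ltW c2) Gc (@ordGF q b); exists u.
pose A k (q : V) := avg k (fun w : R[i] => F (q + w *: b) / G (q + w *: b)) c 0.
have /choice[H hH] : forall q, exists v, nrm (q - p) <= d -> [/\ F q = v * G q,
    nrm v <= 2 * (MF / (m / 2)) &
    forall k, nrm (A k q - v) <= 2 * (MF / (m / 2)) * (1 / 2) ^+ (2 ^ k.+1)].
  move=> q; have [qd|nqd] := leP (nrm (q - p)) d; last by exists 0.
  have [u [au uE]] := quot q qd; exists (u 0) => _.
  have uM z : nrm z = 2 * r -> nrm (u z) <= MF / (m / 2).
    move=> zr; have zle : nrm z <= 2 * r by rewrite zr.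
    have Gz : m / 2 <= nrm (G (q + z *: b)) by apply: Gm => //; rewrite zr; lra.
    rewrite ler_pdivlMr ?divr_gt0// (le_trans (ler_wpM2l (nrm_ge0 _) Gz))// -nrmM -uE//.
    exact: FM.
  split; first by have := uE 0; rewrite nrm0 scale0r addr0 => /(_ (ltW r20)).
    have := weak_max_principle r20 au uM; move=> /(_ 0); rewrite nrm0 mul0r subr0 divr1 => /(_ r20).
    by move=> /le_trans; apply; rewrite ler_peMl ?divr_ge0 ?ler1n// ltW// divr_gt0.
  move=> k; have -> : A k q = avg k u c 0.
    rewrite /A /avg; congr (_ * _); apply: eq_bigr => l _.
    have wr : nrm (c * rou R k ^+ l) = r by rewrite nrm_vertex.
    have Gw : G (q + (c * rou R k ^+ l) *: b) != 0.
      rewrite -nrm_gt0 (lt_le_trans _ (Gm q _ qd _ _)) ?divr_gt0 ?wr//; lra.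
    by rewrite uE ?mulfK// wr; lra.
  rewrite -(cf0 r20 au).
  have := avg_cf (k := k) r20 au uM c0 c2 (expn_gt0 _ _ : (0 < 2 ^ k.+1)%N).
  rewrite expr0 divr1 cr => h; apply: (le_trans h).
  have -> : r / (2 * r) = 1 / 2 by field; rewrite gt_eqF.
  by rewrite le_eqVlt; apply/orP; left; apply/eqP; move: ((1 / 2) ^+ _) => t; field; lra.
exists (d / 2), (2 * (MF / (m / 2))), H; split; first by rewrite divr_gt0.
have d2 : d / 2 <= d by rewrite ler_pdivrMr// ler_pMr// ler1n.
move=> q qd2; have qd := le_trans qd2 d2; have [FE HM _] := hH q qd.
split=> // b' r' b'r; apply: apx_lim => e e0.
have t01 : 0 <= (1 / 2 : R) < 1 by lra.
have B0 : 0 < 2 * (MF / (m / 2)) + 1 by rewrite ltr_wpDl// mulr_ge0// divr_ge0// ltW// divr_gt0.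
have [N hN] := pow_small t01 (divr_gt0 e0 B0).
have inb z : nrm z <= r' -> nrm (q + z *: b' - p) <= d.
  move=> zr; rewrite addrAC (le_trans (nrmD _ _))// [leRHS]splitr lerD// nrmZ.
  by rewrite (le_trans _ b'r)// mulrC ler_wpM2l ?nrm_ge0.
exists (fun z => A N (q + z *: b')).
  rewrite /A /avg; apply: apxM; first exact: apx_cst.
  apply: (apx_sum (index_enum _) (F := fun (l : 'I_ _) z => _)) => l.
  apply: apxM; last exact: apx_cst.
  set w := c * _; have wr : nrm w = r by rewrite /w nrm_vertex.
  have [r'0|r'0] := leP 0 r'; last first.
    by move=> e' e'0; exists 0 => z zr; have := nrm_ge0 z; rewrite leNgt (le_lt_trans zr r'0).
  apply: apxM.
    by apply: apx_ext (eF (q + w *: b) b' r') => z _; rewrite addrAC.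
  apply: apxV => //.
    by apply: apx_ext (eG (q + w *: b) b' r') => z _; rewrite addrAC.
  move=> z zr; rewrite -nrm_gt0 (lt_le_trans _ (Gm _ w (inb z zr) _ _)) ?divr_gt0 ?wr//; lra.
move=> z zr; have [_ _ /(_ N)] := hH _ (inb z zr); rewrite nrm_distC => /le_trans; apply.
have kk : (N <= 2 ^ N.+1)%N by exact: ltnW (ltn_pow2 N).
apply: (@le_trans _ _ ((2 * (MF / (m / 2)) + 1) * (1 / 2) ^+ (2 ^ N.+1))).
  by rewrite ler_wpM2r ?exprn_ge0// lerDl.
by rewrite mulrC -ler_pdivlMr// hN.
Qed.

(** The local quotients agree on overlaps: on a line through q on which G is not
    identically zero they equal F / G off the isolated zeros of G, and a
    removable singularity has one value. *)
Theorem line_division : (exists p, G p != 0) ->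
  exists h, line_holo h /\ forall p, F p = h p * G p.
Proof.
move=> [p0 Gp0].
have dirp p : exists b, exists z, G (p + z *: b) != 0.
  by exists (p0 - p), 1; rewrite scale1r addrC subrK.
have /choice[Q hQ] : forall p, exists Q : R * R * (V -> R[i]), 0 < Q.1.1 /\
    forall q, nrm (q - p) <= Q.1.1 -> [/\ F q = Q.2 q * G q, nrm (Q.2 q) <= Q.1.2 &
      forall b' r', nrm b' * r' <= Q.1.1 -> apx (fun z => Q.2 (q + z *: b')) r'].
  move=> p; have [b hb] := dirp p; have [d [M [H hH]]] := local_quotient hb.
  by exists (d, M, H).
pose h p := (Q p).2 p.
have half d : 0 < d -> d / 2 <= d by move=> d0; rewrite ler_pdivrMr// ler_pMr// ler1n.
have hE p q : nrm (q - p) <= (Q p).1.1 / 2 -> h q = (Q p).2 q.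
  move=> qp2; have [b [z1 hb]] := dirp q.
  have [s s0 hs] := ent_annulus (eG q b) (ex_intro _ z1 hb).
  have [dp hp] := hQ p; have [dq hq] := hQ q.
  have qp := le_trans qp2 (half _ dp).
  have qq : nrm (q - q) <= (Q q).1.1 / 2 by rewrite subrr nrm0 divr_ge0// ltW.
  have [_ _ ap] := hp q qp; have [_ _ aq] := hq q (le_trans qq (half _ dq)).
  have b1 : 0 < nrm b + 1 by rewrite ltr_wpDl ?nrm_ge0.
  have fit d : 0 < d -> nrm b * (d / (nrm b + 1)) <= d.
    by move=> d0; rewrite mulr_fit ?nrm_ge0 ?(ltW d0).
  have rp0 : 0 < (Q p).1.1 / 2 / (nrm b + 1) by rewrite !divr_gt0.
  have rq0 : 0 < (Q q).1.1 / 2 / (nrm b + 1) by rewrite !divr_gt0.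
  have bp := fit _ (divr_gt0 dp (ltr0n R 2)); have bq := fit _ (divr_gt0 dq (ltr0n R 2)).
  have near (x y : V) d z : nrm (x - y) <= d / 2 -> nrm z <= d / 2 / (nrm b + 1) -> 0 < d ->
      nrm (x + z *: b - y) <= d.
    move=> xy zd d0; rewrite addrAC (le_trans (nrmD _ _))// [leRHS]splitr lerD// nrmZ.
    apply: le_trans (fit _ (divr_gt0 d0 (ltr0n R 2))); rewrite mulrC.
    by rewrite ler_wpM2l ?nrm_ge0.
  pose d := Num.min s (Num.min ((Q p).1.1 / 2 / (nrm b + 1)) ((Q q).1.1 / 2 / (nrm b + 1))).
  have d0 : 0 < d by rewrite !lt_min s0 rp0.
  have a1 := aq b _ (le_trans bq (half _ dq)); have a2 := ap b _ (le_trans bp (half _ dp)).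
  have := apx_eq0 rq0 rp0 d0 a1 a2; rewrite scale0r addr0; apply => z z0.
  rewrite !lt_min => /andP[/ltW zs /andP[/ltW zp /ltW zq]].
  have nz0 : 0 < nrm z by rewrite nrm_gt0.
  have [m m0 hm] := hs (nrm z) nz0.
  have Gz : G (q + z *: b) != 0 by rewrite -nrm_gt0 (lt_le_trans m0)// hm.
  apply: (mulIf Gz).
  have [<- _ _] := hp _ (near _ _ _ z qp2 zp dp).
  by have [<- _ _] := hq _ (near _ _ _ z qq zq dq).
exists h; split=> [p|p]; last first.
  have [d0 hq] := hQ p; have pp : nrm (p - p) <= (Q p).1.1 by rewrite subrr nrm0 ltW.
  by have [] := hq p pp.
have [dp hp] := hQ p; exists ((Q p).1.1 / 4), (Q p).1.2; split; first by rewrite divr_gt0.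
move=> q qp; have qp2 : nrm (q - p) <= (Q p).1.1 / 2 by lra.
have [_ hM ah] := hp q (le_trans qp2 (half _ dp)).
split; first by rewrite (hE p).
move=> b r br; apply: apx_ext (ah b r _) => [z zr|]; last by lra.
rewrite (hE p)// addrAC (le_trans (nrmD _ _))// nrmZ.
have : nrm z * nrm b <= nrm b * r by rewrite mulrC ler_wpM2l ?nrm_ge0.
lra.
Qed.

End LineDivision.

(** * Transforms of functionals and the dual growth condition *)

Section DualSpace.
Variables (R : realType) (E : normedModType R[i]) (k : \bar R) (Th : poly_spaces E).
Hypotheses (hk : (1%:E < k)%E) (hTh : holomorphy_type Th) (hpi1 : pi1_type Th).
Implicit Types (f g P Q : E -> R[i]) (x y : E) (a z w : R[i]) (r rho M : R) (phi psi : dual E).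

Let pb j := pbanach hTh j.
Let q := fine (hoelder_conjugate k).

Lemma opnorm_ge0 (F : Type) (X : set F) (n : F -> R) (T : F -> R[i]) : 0 <= opnorm X n T.
Proof.
rewrite /opnorm; set A := [set _ | _ in _].
have [hs|ns] := pselect (has_sup A); last by rewrite sup_out.
have [_ [f Xf _]] := hs.1; apply: le_trans (nrm_ge0 (T f)) _.
by apply: sup_upper_bound => //; exists f.
Qed.

(** The powers of linear functionals span a dense subspace. *)
Lemma borel_inj j T T' : sn_dual (pspace Th j) T -> sn_dual (pspace Th j) T' ->
  borel j T = borel j T' -> forall P, pcar Th j P -> T P = T' P.
Proof.
move=> /(sn_dual_le (pb j))[lT hT] /(sn_dual_le (pb j))[lT' hT'] BTT' P hP.
have [_ _ dj] := hpi1.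
apply/eqP; rewrite -subr_eq0; apply/eqP.
pose D P := T P - T' P.
have lD : linear_on (pcar Th j) D.
  move=> a f g pf pg; rewrite /D lT// lT'// -[a *: (T f - T' f)]/(a * (T f - T' f)).
  by rewrite -[a *: T f]/(a * T f) -[a *: T' f]/(a * T' f); ring.
apply: (dense_vanish (pb j) lD _ (dj j) _ hP).
  move=> f pf; rewrite (le_trans (nrmB _ _))// (le_trans (lerD (hT f pf) (hT' f pf)))//.
  by rewrite -mulrDl.
move=> _ /finite_poly_span[n [c [psi ->]]].
rewrite (linear_on_sum (pb j) _ lD) => [|i]; last exact: (subspaceZ (pb j) _ (pow_pcar hpi1 j (psi i))).
rewrite big1// => i _; rewrite (linear_onZ (pb j) _ lD (pow_pcar hpi1 j (psi i))) /D.
have /(congr1 (fun F => F (psi i))) := BTT'; rewrite /borel => ->.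
by rewrite subrr mulr0.
Qed.

(** The functional chosen in the definition of the dual norm. *)
Lemma pcar'_functional j (Q : dual E -> R[i]) : pcar' Th j Q ->
  exists S, [/\ linear_on (pcar Th j) S, borel j S = Q &
    forall P, pcar Th j P -> nrm (S P) <= pnorm' Th j Q * pnorm Th j P].
Proof.
move=> [T0 hT0 BT0].
have := @xgetPex _ (fun=> 0) [set T | sn_dual (pspace Th j) T /\ borel j T = Q].
case; first by exists T0.
set S := xget _ _ => hS BS; exists S.
by have [lS hSb] := sn_dual_le (pb j) hS; split.
Qed.

(** By injectivity of the Borel transform, the functional chosen in the
    definition of the dual norm is T itself. *)
Lemma pnorm'_le j T C : 0 <= C -> linear_on (pcar Th j) T ->
  (forall P, pcar Th j P -> nrm (T P) <= C * pnorm Th j P) ->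
  pcar' Th j (borel j T) /\ pnorm' Th j (borel j T) <= C.
Proof.
move=> C0 lT hT; have dT := sn_dual_intro (pb j) lT hT.
split; first by exists T.
have [|hS BS] := @xgetPex _ (fun=> 0) [set T' | sn_dual (pspace Th j) T' /\ borel j T' = borel j T].
  by exists T.
apply: (opnorm_bound (pb j)) => // P hP.
by rewrite (borel_inj hS dT BS hP) hT.
Qed.

Lemma pcar'Z j a (Q : dual E -> R[i]) : pcar' Th j Q -> pcar' Th j (a *: Q).
Proof.
move=> /pcar'_functional[S [lS <- hS]]; exists (fun P => a * S P) => //.
apply: (sn_dual_intro (pb j) (C := nrm a * pnorm' Th j (borel j S))).
  by move=> c f g pf pg; rewrite lS// -[c *: S f]/(c * S f) -[c *: (a * S f)]/(c * (a * S f)); ring.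
by move=> P hP; rewrite nrmM -mulrA ler_wpM2l ?nrm_ge0 ?hS.
Qed.

Lemma pcar'_tcoef (h : dual E -> R[i]) j : entire h ->
  pcar' Th j (dhat j h 0) <-> pcar' Th j (tcoef h 0 j).
Proof.
move=> eh; rewrite dhatE//; split=> hp; last exact: pcar'Z.
have fn0 : j`!%:R != 0 :> R[i] by rewrite pnatr_eq0 -lt0n fact_gt0.
by rewrite -[tcoef _ _ _]scale1r -(mulVf fn0) -scalerA; exact: pcar'Z.
Qed.

(** The weights for k and its conjugate exponent multiply to the factorials,
    up to a geometric factor, so that the transform of a functional satisfies
    the dual growth condition. *)
Lemma borel_in_Exp' T : bounded_functional k Th T -> Exp' Th q (borel_transform T).
Proof.
move=> bT; have [lT _] := bT; have [rho [C [rho0 C0 hC]]] := functional_pcar hk hTh bT.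
have eB := line_holo_entire (borel_line_holo hk hTh hpi1 bT).
have fR0 j : 0 < j`!%:R :> R by rewrite ltr0n fact_gt0.
have w0 j := ltW (weight_gt0 j hk).
pose Tj j P := j`!%:R^-1 * T P.
have TjE j : tcoef (borel_transform T) 0 j = borel j (Tj j).
  by apply/funext => psi; rewrite (borel_tcoef hk hTh hpi1 bT).
have lTj j : linear_on (pcar Th j) (Tj j).
  move=> a f g pf pg; rewrite /Tj lT; first by rewrite -[a *: _]/(a * _); ring.
    exact: pcar_in_exp hk hTh _ _ pf.
  exact: pcar_in_exp hk hTh _ _ pg.
have hTj j P : pcar Th j P -> nrm (Tj j P) <= C * (rho ^- j * weight k j) / j`!%:R * pnorm Th j P.
  move=> hP; rewrite /Tj nrmM nrmV nrm_nat ler_pdivrMl// (le_trans (hC j P hP))//.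
  rewrite le_eqVlt; apply/orP; left; apply/eqP; move: (rho ^- j * weight k j) => v.
  by field; rewrite gt_eqF.
have Cj0 j : 0 <= C * (rho ^- j * weight k j) / j`!%:R.
  by rewrite divr_ge0// mulr_ge0// mulr_ge0// invr_ge0 exprn_ge0// ltW.
have bd j := pnorm'_le (Cj0 j) (lTj j) (hTj j).
split=> //.
  by move=> j; apply/pcar'_tcoef => //; rewrite TjE; have [] := bd j.
have [q1 [c c0 wc]] := weight_conjugate hk; rewrite -/q in q1 wc.
have w'0 j : 0 <= weight q%:E j by rewrite powR_ge0.
have s0 : 0 < 2 * c / rho by rewrite divr_gt0 ?mulr_gt0.
exists (2 * c / rho) => //.
pose u j := (2 * c / rho) ^- j * weight q%:E j * pnorm' Th j (taylor_coef (borel_transform T) j).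
have u0 j : 0 <= u j.
  by rewrite !mulr_ge0 ?opnorm_ge0// invr_ge0 exprn_ge0// ltW.
have uC j : u j <= C * (1 / 2) ^+ j.
  rewrite /u taylor_coefE// TjE; have [_ hb] := bd j.
  have A0 : 0 <= (2 * c / rho) ^- j * weight q%:E j.
    by rewrite mulr_ge0// invr_ge0 exprn_ge0// ltW.
  rewrite (le_trans (ler_wpM2l A0 hb))//.
  have -> : (2 * c / rho) ^- j * weight q%:E j * (C * (rho ^- j * weight k j) / j`!%:R) =
      C * (1 / 2) ^+ j * (c ^- j * (weight k j * weight q%:E j) / j`!%:R).
    rewrite !expr_div_n !exprMn expr1n.
    move: (weight _ j) (weight _ j) => w1 w2; field.
    by rewrite !expf_neq0 ?gt_eqF.
  rewrite ler_piMr ?mulr_ge0 ?exprn_ge0// wc mulrA mulVf ?expf_neq0 ?gt_eqF// mul1r.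
  by rewrite ler_pdivrMr// mul1r euler_power_fact.
exact: (series_bounded_cvg u0 (dyadic_sum C0 uC)).1.
Qed.

(** If S_j is the functional with Borel transform the Taylor term h_j, then
    S f = sum_j j! S_j(f_j), where f_j is the Taylor term of f.  By the duality of
    the weights the growth of h is what makes this series converge and bounds it
    by a norm of f.  At the exponential of phi it is the Taylor series of h. *)
Lemma Exp'_functional (h : dual E -> R[i]) : Exp' Th q h ->
  exists2 S, bounded_functional k Th S & forall phi, S (expdual phi) = h phi.
Proof.
move=> [eh ph [rho rho0 ch]].
have [q1 [c c0 wc]] := weight_conjugate hk; rewrite -/q in q1 wc.
have [K K0 hK] := pi1_power hpi1.
have w'0 j : 0 < weight q%:E j.
  case: j => [|j]; first by rewrite weight0.
  by rewrite powR_gt0 ?divr_gt0 ?mulr_gt0 ?expR_gt0 ?(lt_le_trans _ q1).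
have fR0 j : 0 < j`!%:R :> R by rewrite ltr0n fact_gt0.
have fn0 j : j`!%:R != 0 :> R[i] by rewrite pnatr_eq0 -lt0n fact_gt0.
pose u j := rho ^- j * weight q%:E j * pnorm' Th j (taylor_coef h j).
have u0 j : 0 <= u j.
  by rewrite !mulr_ge0 ?opnorm_ge0 ?(ltW (w'0 j))// invr_ge0 exprn_ge0// ltW.
have [D hD] := cvg_series_bounded u0 ch.
have D0 : 0 <= D by apply: le_trans (u0 0%N) (hD 0%N).
have pD j : pnorm' Th j (tcoef h 0 j) <= D * rho ^+ j / weight q%:E j.
  rewrite ler_pdivlMr// mulrC; have := hD j; rewrite /u taylor_coefE// -mulrA.
  by rewrite ler_pdivrMl ?exprn_gt0// [_ * D]mulrC.
have /choice[S hS] : forall j, exists S, [/\ linear_on (pcar Th j) S, borel j S = tcoef h 0 j &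
    forall P, pcar Th j P -> nrm (S P) <= pnorm' Th j (tcoef h 0 j) * pnorm Th j P].
  by move=> j; apply: pcar'_functional; apply/pcar'_tcoef.
pose L := rho * expR 1 / c.
have L0 : 0 < L by rewrite divr_gt0// mulr_gt0// expR_gt0.
pose t f j := j`!%:R * S j (tcoef f 0 j).
have tb f j : in_exp k Th f -> nrm (t f j) <= D * (L ^+ j * wnorm k Th f j).
  move=> [_ pf _]; have [_ _ hSj] := hS j; have pn0 := fnorm_ge0 (pb j) (pf j).
  rewrite /t nrmM nrm_nat.
  apply: (@le_trans _ _ (j`!%:R * (D * rho ^+ j / weight q%:E j * pnorm Th j (tcoef f 0 j)))).
    by rewrite ler_wpM2l// (le_trans (hSj _ (pf j)))// ler_wpM2r.
  have -> : j`!%:R * (D * rho ^+ j / weight q%:E j * pnorm Th j (tcoef f 0 j)) =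
      D * rho ^+ j * pnorm Th j (tcoef f 0 j) * (j`!%:R / weight q%:E j).
    by move: (weight _ j) => w; ring.
  have -> : D * (L ^+ j * wnorm k Th f j) = D * rho ^+ j * pnorm Th j (tcoef f 0 j) *
      ((expR 1 / c) ^+ j * weight k j).
    rewrite /L /wnorm -mulrA exprMn; move: ((expR 1 / c) ^+ j) => v; ring.
  rewrite ler_wpM2l ?mulr_ge0 ?exprn_ge0 ?(ltW rho0)// ler_pdivrMr// -mulrA wc.
  rewrite expr_div_n mulrA divfK ?expf_neq0 ?gt_eqF//; exact: fact_euler_power.
have LV : 0 < L^-1 by rewrite invr_gt0.
have tsumb f n : in_exp k Th f -> \sum_(j < n) nrm (t f j) <= D * exp_norm Th k L^-1 f.
  move=> hf; rewrite (le_trans _ (ler_wpM2l D0 (exp_norm_partial hk hTh n hf LV)))//.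
  by rewrite mulr_sumr; apply: ler_sum => j _; rewrite exprVn invrK; exact: tb.
have /choice[Sf hSf] : forall f, exists v, in_exp k Th f -> ncvg (fun n => \sum_(j < n) t f j) v.
  move=> f; have [hf|nhf] := pselect (in_exp k Th f); last by exists 0.
  have [v hv] := abs_summable_cvg (fun n => tsumb f n hf); by exists v.
exists Sf.
  split=> [a f g hf hg|].
    apply: ncvg_unique (hSf _ (in_exp_lin hk hTh a hf hg)) _.
    have [ef pf _] := hf; have [eg pg _] := hg.
    have tE j : t (a *: f + g) j = a * t f j + t g j.
      have [lS _ _] := hS j.
      by rewrite /t tcoef_lin// lS// -[a *: S j _]/(a * S j _); ring.
    have -> : (fun n => \sum_(j < n) t (a *: f + g) j) =
        (fun n => a * \sum_(j < n) t f j + \sum_(j < n) t g j).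
      apply/funext => n; rewrite mulr_sumr -big_split/=; apply: eq_bigr => j _; exact: tE.
    exact: ncvg_lin (hSf f hf) (hSf g hg).
  exists L^-1, D; split=> // f hf; rewrite -[Sf f]subr0; apply: ncvg_le (hSf f hf) _.
  exists 0%N => n _; rewrite subr0 (le_trans (nrm_sum _ _ _))//; exact: tsumb.
move=> phi; apply: ncvg_unique (hSf _ (expdual_in_exp hk hTh hpi1 phi)) _.
have tE j : t (expdual phi) j = tcoef h 0 j phi.
  have [lS <- _] := hS j; rewrite /t tcoef_expdual (linear_onZ (pb j) _ lS (pow_pcar hpi1 j phi)).
  by rewrite mulrA divff// mul1r.
have [|F [_ _ _ /(_ 1)]] := @entire_global _ _ h phi eh; last first.
  rewrite scale1r; set v := fun N => _; set v' := fun n => _.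
  suff -> : v = v' by [].
  by apply/funext => n; apply: eq_bigr => j _; rewrite tE expr1n mulr1.
move=> r r0; have p1 : 0 < nrm phi + 1 by rewrite ltr_wpDl ?nrm_ge0.
have B0 : 0 < rho * K * (nrm phi + 1) * r by rewrite !mulr_gt0.
have [M hM] := weight_superexp q1 B0; exists (D * M) => n.
have [_ BS hSn] := hS n; have [hp hn] := hK phi n.
rewrite -[tcoef h 0 n]BS /borel (le_trans (ler_wpM2r (exprn_ge0 n (ltW r0)) (hSn _ hp)))//.
apply: (@le_trans _ _ (D * rho ^+ n / weight q%:E n * (K ^+ n * (nrm phi + 1) ^+ n) * r ^+ n)).
  rewrite ler_wpM2r ?exprn_ge0 ?(ltW r0)//.
  apply: ler_pM; [exact: opnorm_ge0|exact: fnorm_ge0 (pb n) _ hp|exact: pD|].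
  rewrite (le_trans hn)// ler_wpM2l ?exprn_ge0 ?(ltW K0)//.
  by rewrite lerXn2r ?nnegrE ?nrm_ge0 ?(ltW p1)// lerDl.
have -> : D * rho ^+ n / weight q%:E n * (K ^+ n * (nrm phi + 1) ^+ n) * r ^+ n =
    D * ((rho * K * (nrm phi + 1) * r) ^+ n / weight q%:E n).
  rewrite !exprMn; move: (weight _ n) ((nrm phi + 1) ^+ n) => w1 w2; ring.
by rewrite ler_wpM2l// ler_pdivrMr.
Qed.

End DualSpace.

(** * Hahn-Banach separation for a seminorm *)

Section HahnBanach.
Variables (R : realType) (W : lmodType R[i]) (D : set W) (p : W -> R).
Hypotheses (D_lin : forall (a : R[i]) x y, D x -> D y -> D (a *: x + y)).
Hypotheses (pD : forall x y, D x -> D y -> p (x + y) <= p x + p y)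
  (pZ : forall (r : R) x, 0 <= r -> D x -> p (r%:C%C *: x) = r * p x).
Implicit Types (G : set (W * R)) (x y : W) (u v r : R).

(** The graph of a real linear functional dominated by p, on a subspace of D;
    the domination makes the relation single-valued. *)
Definition dominated_graph G := [/\ G (0, 0),
  forall r x u y v, G (x, u) -> G (y, v) -> G (r%:C%C *: x + y, r * u + v),
  forall x u, G (x, u) -> D x &
  forall x u, G (x, u) -> u <= p x].

Lemma dominated_graph0 G : dominated_graph G -> D 0.
Proof. by case=> G0 _ GD _; exact: GD G0. Qed.

Lemma graph_fun G x u v : dominated_graph G -> G (x, u) -> G (x, v) -> u = v.
Proof.
move=> dG; have [G0 Glin GD Gp] := dG; have D00 := dominated_graph0 dG.
have p0 : p 0 = 0 by have := pZ (lexx 0) D00; rewrite scaler0 mul0r.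
suff le s t : G (x, s) -> G (x, t) -> s <= t.
  by move=> Gu Gv; apply/eqP; rewrite eq_le !le.
move=> Gs Gt; have := Gp _ _ (Glin (-1) _ _ _ _ Gt Gs).
by rewrite rmorphN rmorph1 scaleN1r addNr p0 mulN1r addrC subr_le0.
Qed.

(** Values c at x0 are admissible between the supremum of u - p (x - x0) and the
    infimum of p (y + x0) - v over the graph; the subadditivity of p puts the
    first below the second. *)
Lemma graph_extend G x0 : dominated_graph G -> D x0 -> (forall u, ~ G (x0, u)) ->
  exists G', [/\ dominated_graph G', G `<=` G' & exists u, G' (x0, u)].
Proof.
move=> dG Dx0 nG; have [G0 Glin GD Gp] := dG; have D00 := dominated_graph0 dG.
have DB x y : D x -> D y -> D (x - y).
  by move=> Dx Dy; rewrite addrC -scaleN1r; exact: D_lin.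
have DD x y : D x -> D y -> D (x + y) by move=> Dx Dy; rewrite -[x]scale1r; exact: D_lin.
have DZ (r : R[i]) x : D x -> D (r *: x) by move=> Dx; rewrite -[_ *: x]addr0; exact: D_lin.
pose B := [set s | exists x u, G (x, u) /\ s = u - p (x - x0)].
have key x u y v : G (x, u) -> G (y, v) -> u - p (x - x0) <= p (y + x0) - v.
  move=> Gx Gy; rewrite lerBlDr addrAC lerBrDr -lerBlDr.
  have Dx := GD _ _ Gx; have Dy := GD _ _ Gy.
  have := Gp _ _ (Glin 1 _ _ _ _ Gx Gy); rewrite scale1r mul1r.
  have -> : x + y = (y + x0) + (x - x0) by rewrite addrACA subrr addr0 addrC.
  by have := pD (DD _ _ Dy Dx0) (DB _ _ Dx Dx0); lra.
have hB : has_sup B.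
  split; first by exists (0 - p (0 - x0)), 0, 0.
  by exists (p (0 + x0) - 0) => _ [x [u [Gx ->]]]; exact: key Gx G0.
set c := sup B.
have c_lb x u : G (x, u) -> u - p (x - x0) <= c.
  by move=> Gx; apply: sup_upper_bound => //; exists x, u.
have c_ub y v : G (y, v) -> c <= p (y + x0) - v.
  by move=> Gy; apply: ge_sup; [exact: hB.1|move=> _ [x [u [Gx ->]]]; exact: key].
pose G' := [set z : W * R | exists x u r, G (x, u) /\ z = (x + r%:C%C *: x0, u + r * c)].
exists G'; split; last first.
- by exists c, 0, 0, 1; split=> //; rewrite !add0r scale1r mul1r.
- by move=> [x u] Gx; exists x, u, 0; split=> //; rewrite scale0r mul0r !addr0.
have GZ r x u : G (x, u) -> G (r%:C%C *: x, r * u).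
  by move=> Gx; have := Glin r _ _ _ _ Gx G0; rewrite !addr0.
split.
- by exists 0, 0, 0; split=> //; rewrite scale0r mul0r !addr0.
- move=> r _ _ _ _ [x [u [s [Gx [-> ->]]]]] [y [v [t [Gy [-> ->]]]]].
  exists (r%:C%C *: x + y), (r * u + v), (r * s + t); split; first exact: Glin.
  congr (_, _); last by ring.
  by rewrite scalerDr addrACA scalerA rmorphD rmorphM/= scalerDl.
- by move=> _ _ [x [u [r [Gx [-> _]]]]]; apply: DD; [exact: GD Gx|exact: DZ].
move=> _ _ [x [u [r [Gx [-> ->]]]]].
have Dx := GD _ _ Gx.
have [r0|r0|->] := ltgtP r 0; last first.
- by rewrite scale0r mul0r !addr0; exact: Gp.
- have := c_ub _ _ (GZ r^-1 _ _ Gx).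
  have DxV : D (r^-1%:C%C *: x + x0) by apply: DD => //; exact: DZ.
  have -> : x + r%:C%C *: x0 = r%:C%C *: (r^-1%:C%C *: x + x0).
    by rewrite scalerDr scalerA -rmorphM/= mulfV ?gt_eqF// scale1r.
  rewrite pZ ?(ltW r0)// => h; have := ler_wpM2l (ltW r0) h.
  by rewrite mulrBr mulrA mulfV ?gt_eqF// mul1r; lra.
have s0 : 0 < - r by rewrite oppr_gt0.
have := c_lb _ _ (GZ (- r)^-1 _ _ Gx).
have DxV : D ((- r)^-1%:C%C *: x - x0) by apply: DB => //; exact: DZ.
have -> : x + r%:C%C *: x0 = (- r)%:C%C *: ((- r)^-1%:C%C *: x - x0).
  by rewrite scalerBr scalerA -rmorphM/= mulfV ?gt_eqF// scale1r rmorphN scaleNr opprK.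
rewrite pZ ?(ltW s0)// => h; have := ler_wpM2l (ltW s0) h.
by rewrite mulrBr mulrA mulfV ?gt_eqF// mul1r; lra.
Qed.

(** Zorn's lemma; a maximal dominated graph is total on D by the extension
    lemma. *)
Lemma real_hahn_banach G0 : dominated_graph G0 ->
  exists l : W -> R, [/\ forall r x y, D x -> D y -> l (r%:C%C *: x + y) = r * l x + l y,
    forall x, D x -> l x <= p x & forall x u, G0 (x, u) -> l x = u].
Proof.
move=> dG0.
(* With G0 adjoined inside P, the empty chain is bounded by the empty set. *)
pose P G := dominated_graph (G0 `|` G).
have chain (F : set (set (W * R))) : F `<=` P -> total_on F subset -> P (\bigcup_(X in F) X).
  move=> FP tF; have [Fe|[X0 FX0]] : F = set0 \/ exists X, F X.
    by have [->|/set0P[X FX]] := eqVneq F set0; [left|right; exists X].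
    by rewrite /P Fe bigcup_set0 setU0.
  have up (x y : W * R) : (G0 `|` \bigcup_(X in F) X) x -> (G0 `|` \bigcup_(X in F) X) y ->
      exists X, [/\ F X, (G0 `|` X) x & (G0 `|` X) y].
    move=> [gx|[X FX Xx]] [gy|[Y FY Yy]].
    - by exists X0; split=> //; left.
    - by exists Y; split=> //; [left|right].
    - by exists X; split=> //; [right|left].
    - have [XY|YX] := tF X Y FX FY.
        by exists Y; split=> //; right=> //; exact: XY.
      by exists X; split=> //; right=> //; exact: YX.
  have sub X : F X -> G0 `|` X `<=` G0 `|` \bigcup_(X in F) X.
    by move=> FX z [gz|Xz]; [left|right; exists X].
  split.
  - by left; have [] := dG0.
  - move=> r x u y v hx hy; have [X [FX Xx Xy]] := up _ _ hx hy.
    by apply: (sub X FX); have [_ h _ _] := FP X FX; exact: h.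
  - move=> x u hx; have [X [FX Xx _]] := up _ _ hx hx.
    by have [_ _ h _] := FP X FX; exact: h Xx.
  - move=> x u hx; have [X [FX Xx _]] := up _ _ hx hx.
    by have [_ _ _ h] := FP X FX; exact: h.
have [A [PA Amax]] := Zorn_bigcup chain.
pose G := G0 `|` A.
have dG : dominated_graph G by [].
have full x : D x -> exists u, G (x, u).
  move=> Dx; apply: contrapT => nG.
  have [|G' [dG' GG' [u G'x]]] := graph_extend dG Dx; first by move=> u Gu; apply: nG; exists u.
  have PG' : P G'.
    by rewrite /P (_ : G0 `|` G' = G')//; apply/setUidPr => z gz; apply: GG'; left.
  have AG' : A `<` G'.
    split; last by move=> G'A; apply: nG; exists u; right; exact: G'A.
    by move=> z Az; apply: GG'; right.
  exact: Amax AG' PG'.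
have /choice[l hl] : forall x, exists u, D x -> G (x, u).
  move=> x; have [Dx|nD] := pselect (D x); last by exists 0.
  by have [u Gu] := full x Dx; exists u.
have [_ Glin GD Gp] := dG.
exists l; split=> [r x y Dx Dy|x Dx|x u Gx].
- apply: (graph_fun dG) (hl _ (D_lin _ Dx Dy)) _; apply: Glin; exact: hl.
- exact: Gp (hl x Dx).
- have Gx' : G (x, u) by left.
  exact: graph_fun dG (hl _ (GD _ _ Gx')) Gx'.
Qed.

(** The real functional y + a x0 -> Re(a) e on Y + C x0 is dominated by p because
    p (x0 - y) >= e on Y.  Its extension l is the real part of the complex linear
    functional x -> l x - i l (i x). *)
Theorem hahn_banach_separation (Y : set W) (x0 : W) (e : R) :
  (forall (a : R[i]) x, D x -> p (a *: x) = nrm a * p x) -> (forall x, D x -> 0 <= p x) ->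
  Y `<=` D -> Y 0 -> (forall (a : R[i]) x y, Y x -> Y y -> Y (a *: x + y)) -> D x0 ->
  0 < e -> (forall y, Y y -> e <= p (x0 - y)) ->
  exists X : W -> R[i], [/\ forall (a : R[i]) x y, D x -> D y -> X (a *: x + y) = a * X x + X y,
    forall x, D x -> nrm (X x) <= 2 * p x, forall y, Y y -> X y = 0 & X x0 != 0].
Proof.
move=> pc p0 YD Y0 Ylin Dx0 e0 sep.
have DZ (a : R[i]) x : D x -> D (a *: x).
  by move=> Dx; rewrite -[_ *: x]addr0; apply: D_lin => //; exact: YD.
pose G0 := [set z : W * R | exists y a, Y y /\ z = (y + a *: x0, complex.Re a * e)].
have dG0 : dominated_graph G0.
  split.
  - by exists 0, 0; split=> //; rewrite scale0r addr0 mul0r.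
  - move=> r _ _ _ _ [y [a [Yy [-> ->]]]] [y' [a' [Yy' [-> ->]]]].
    exists (r%:C%C *: y + y'), (r%:C%C * a + a'); split; first exact: Ylin.
    congr (_, _); first by rewrite scalerDr addrACA scalerA scalerDl.
    by case: a => a1 a2; case: a' => b1 b2 /=; ring.
  - by move=> _ _ [y [a [Yy [-> _]]]]; rewrite addrC; apply: D_lin => //; exact: YD.
  - move=> _ _ [y [a [Yy [-> ->]]]].
    have [->|a0] := eqVneq a 0; first by rewrite mul0r scale0r addr0 p0//; exact: YD.
    have -> : y + a *: x0 = a *: (x0 - (- a^-1) *: y).
      by rewrite scalerBr scalerA mulrN mulfV// scaleN1r opprK addrC.
    have Yy' : Y ((- a^-1) *: y) by rewrite -[_ *: y]addr0; exact: Ylin.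
    have DB : D (x0 - (- a^-1) *: y).
      by rewrite addrC -scaleN1r; apply: D_lin => //; exact: YD.
    rewrite pc//; apply: (@le_trans _ _ (nrm a * e)).
      by rewrite ler_wpM2r ?(ltW e0)// (le_trans (ler_norm _))// Re_le_nrm.
    by rewrite ler_wpM2l ?nrm_ge0// sep.
have [l [llin lp lG]] := real_hahn_banach dG0.
have l0 : l 0 = 0 by apply: lG; exists 0, 0; rewrite scale0r addr0 mul0r.
have lD x y : D x -> D y -> l (x + y) = l x + l y.
  by move=> Dx Dy; have := llin 1 x y Dx Dy; rewrite scale1r mul1r.
have lZ r x : D x -> l (r%:C%C *: x) = r * l x.
  by move=> Dx; have := llin r x 0 Dx (YD _ Y0); rewrite l0 !addr0.
pose I : R[i] := Complex 0 1.
have nI : nrm I = 1 by rewrite /nrm normc_def/= expr0n expr1n add0r sqrtr1.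
pose X x := Complex (l x) (- l (I *: x)).
have labs x : D x -> `|l x| <= p x.
  move=> Dx; rewrite ler_norml lp// andbT lerNl.
  have := lp _ (DZ (-1) _ Dx); rewrite pc// nrmN nrm1 mul1r.
  by have := lZ (-1) _ Dx; rewrite rmorphN rmorph1 => ->; rewrite mulN1r.
have XD x y : D x -> D y -> X (x + y) = X x + X y.
  move=> Dx Dy; rewrite /X scalerDr !lD//; try exact: DZ.
  by rewrite opprD.
have lc (a : R[i]) x : D x -> l (a *: x) = complex.Re a * l x + complex.Im a * l (I *: x).
  move=> Dx; have -> : a *: x = (complex.Re a)%:C%C *: x + (complex.Im a)%:C%C *: (I *: x).
    rewrite scalerA -scalerDl; congr (_ *: _).
    by case: a => a1 a2; rewrite /I /=; apply/eqP; rewrite eq_complex /=; apply/andP; split; apply/eqP; ring.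
  have DI := DZ I x Dx; by rewrite lD ?(lZ _ x Dx) ?(lZ _ _ DI)//; exact: DZ.
have XZ (a : R[i]) x : D x -> X (a *: x) = a * X x.
  move=> Dx; rewrite /X scalerA (lc a)// (lc (I * a))//.
  by case: a => a1 a2 /=; apply/eqP; rewrite eq_complex /=; apply/andP; split; apply/eqP; ring.
exists X; split=> [a x y Dx Dy|x Dx|y Yy|].
- by rewrite XD ?XZ//; exact: DZ.
- rewrite (le_trans (nrm_le_ReIm _))//= normrN mulr_natl mulr2n lerD ?labs//.
  by apply: (le_trans (labs _ (DZ I x Dx))); rewrite pc// nI mul1r.
- have lY y' : Y y' -> l y' = 0 by move=> Yy'; apply: lG; exists y', 0; rewrite scale0r addr0 mul0r.
  rewrite /X !lY ?oppr0//; by rewrite -[_ *: y]addr0; exact: Ylin.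
- have : l x0 = e by apply: lG; exists 0, 1; split=> //; rewrite scale1r add0r mul1r.
  by move=> le; apply/eqP => /(congr1 (@complex.Re R)) /=; rewrite le => /eqP; rewrite gt_eqF.
Qed.

End HahnBanach.

(** * Density of the exponential polynomial solutions *)

Section Density.
Variables (R : realType) (E : completeNormedModType R[i]) (k : \bar R) (Th : poly_spaces E).
Variable L : (E -> R[i]) -> E -> R[i].
Hypotheses (hk : (1%:E < k)%E) (hTh : holomorphy_type Th) (hpi1 : pi1_type Th)
  (hL : conv_op Th k L).
Implicit Types (f g : E -> R[i]) (phi psi : dual E) (X : (E -> R[i]) -> R[i]).

Lemma expmon_solution n psi phi : L (expmon n psi phi) = 0 ->
  exp_solutions Th k L (expmon n psi phi).
Proof.
move=> L0; split=> //.
  by apply/(exp_carP hk hTh); exact: expmon_in_exp hk hTh hpi1 _ _ _.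
by exists n, (fun x => psi x ^+ n), phi; split=> //; exact: pow_pcar.
Qed.

Lemma fspan_solutions g : fspan (exp_solutions Th k L) g -> in_exp k Th g /\ L g = 0.
Proof.
move=> [n [c [h [hh ->]]]].
have hi i : in_exp k Th (h i) by have [/(exp_carP hk hTh)] := hh i.
elim/big_ind : _ => [|u v [hu Lu] [hv Lv]|i _].
- by split; [exact: in_exp0|exact: (op0 hk hTh hL)].
- split; first exact: in_expD.
  by rewrite -[u]scale1r (op_lin hk hTh hL)// Lu Lv scaler0 addr0.
- split; first exact: in_expZ.
  by rewrite (opZ hk hTh hL)//; have [_ _ ->] := hh i; rewrite scaler0.
Qed.

Lemma fspan_lin (X : set (E -> R[i])) a f g :
  fspan X f -> fspan X g -> fspan X (a *: f + g).
Proof.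
move=> [n [c [u [Xu ->]]]] [m [d [v [Xv ->]]]].
pose pick (T : Type) (s : 'I_n -> T) (t : 'I_m -> T) (i : 'I_(n + m)) := match fintype.split i with inl j => s j | inr j => t j end.
exists (n + m)%N, (pick _ (fun i => a * c i) d), (pick _ u v); split.
  by move=> i; rewrite /pick; case: (fintype.split i).
rewrite big_split_ord/= scaler_sumr; congr (_ + _); apply: eq_bigr => i _.
  by rewrite /pick (unsplitK (inl i)) scalerA.
by rewrite /pick (unsplitK (inr i)).
Qed.

Lemma exp_norm_homog a f (rho : R) : in_exp k Th f -> 0 < rho ->
  exp_norm Th k rho (a *: f) = nrm a * exp_norm Th k rho f.
Proof.
move=> hf rho0; have [->|a0] := eqVneq a 0; first by rewrite scale0r nrm0 mul0r exp_norm0.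
apply/eqP; rewrite eq_le (exp_normZ hk hTh)//=.
have na : 0 < nrm a by rewrite lt_neqAle nrm_ge0 eq_sym nrm_eq0 a0.
have := exp_normZ hk hTh a^-1 (in_expZ hk hTh a hf) rho0.
rewrite scalerA mulVf// scale1r => h; rewrite -ler_pdivlMl//; apply: le_trans h _.
by rewrite nrmV.
Qed.

(** A zero of the symbol on a line, of order m at p + c b, makes the functions
    b^i exp(p + c b), i < m, solutions: X vanishes on them, and up to the factors
    i! its values there are the first m Taylor coefficients of its Borel transform
    at that point in the direction b. *)
Lemma borel_ord X : bounded_functional k Th X ->
  (forall n psi phi, L (expmon n psi phi) = 0 -> X (expmon n psi phi) = 0) ->
  forall p b, ord_le (fun z => symbol L (p + z *: b)) (fun z => borel_transform X (p + z *: b)).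
Proof.
move=> bX X0 p b c m g eg gE.
apply: ent_factor => [|i im]; first by have [] := borel_line hk hTh hpi1 bX p b.
have shift z : p + (c + z) *: b = (p + c *: b) + z *: b by rewrite scalerDl addrA.
under eq_fun do rewrite shift.
have [_ ->] := borel_line hk hTh hpi1 bX (p + c *: b) b.
rewrite X0 ?mulr0//; apply: (op_expmon hk hTh hpi1 hL (ent_shift c eg)) im => z.
by rewrite -shift gE addrC addKr.
Qed.

(** Where the Borel transform G of g -> L g 0 vanishes, the transform F of X
    vanishes to at least the same order, so F = h G with h entire.  By closedness
    under division h is the transform of a functional S; then X and g -> S (L g)
    have the same transform, hence coincide, and X vanishes where L does. *)
Lemma vanish_on_kernel X : division_closed (Exp' Th (fine (hoelder_conjugate k))) ->
  bounded_functional k Th X ->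
  (forall n psi phi, L (expmon n psi phi) = 0 -> X (expmon n psi phi) = 0) ->
  forall f, in_exp k Th f -> L f = 0 -> X f = 0.
Proof.
move=> hdiv bX X0 f hf Lf; pose T g := L g 0.
have bT : bounded_functional k Th T := op_eval_bounded hk hTh hL 0.
(* If G is identically zero, every exponential is a solution. *)
have [nz|/forallNP G0] := pselect (exists phi, symbol L phi != 0); last first.
  apply: (borel_injective hk hTh hpi1 bX) hf => phi; rewrite /borel_transform.
  have /negP := G0 phi; rewrite negbK => /eqP s0.
  rewrite expdualE; apply: X0; rewrite -expdualE (op_expdual hk hTh hpi1 hL).
  by rewrite s0 scale0r.
have [h [lh FhG]] := line_division (fun p b => (borel_line hk hTh hpi1 bX p b).1)
  (fun p b => (borel_line hk hTh hpi1 bT p b).1) (borel_line_holo hk hTh hpi1 bX)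
  (borel_line_holo hk hTh hpi1 bT) (borel_ord bX X0) nz.
have hE : Exp' Th (fine (hoelder_conjugate k)) h.
  apply: hdiv (borel_in_Exp' hk hTh hpi1 bX) (borel_in_Exp' hk hTh hpi1 bT) _ _ FhG.
    by move=> G0; have [phi] := nz; rewrite -[symbol L phi]/(borel_transform T phi) G0 eqxx.
  exact: line_holo_entire.
have [S bS Sh] := Exp'_functional hk hTh hpi1 hE.
have bSL := op_comp_bounded hk hTh hL bS.
have bU : bounded_functional k Th (fun g => X g - S (L g)).
  have [lX [r1 [C1 [r10 C10 h1]]]] := bX; have [lS [r2 [C2 [r20 C20 h2]]]] := bSL.
  split=> [a u v hu hv|].
    by rewrite lX// lS// mulrBr opprD addrACA.
  have m0 : 0 < Num.min r1 r2 by rewrite lt_min r10.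
  exists (Num.min r1 r2), (C1 + C2); split=> // [|g hg]; first exact: addr_ge0.
  rewrite (le_trans (nrmB _ _))// mulrDl lerD//.
    rewrite (le_trans (h1 _ hg))// ler_wpM2l// exp_norm_anti// ge_min lexx//.
  by rewrite (le_trans (h2 _ hg))// ler_wpM2l// exp_norm_anti// ge_min lexx orbT.
have := borel_injective hk hTh hpi1 bU _ hf.
rewrite Lf (functional0 hTh bS) subr0; apply => phi; rewrite /borel_transform.
rewrite (op_expdual hk hTh hpi1 hL) (functionalZ hTh _ bS) ?Sh; last exact: expdual_in_exp hk hTh hpi1 _.
apply/eqP; rewrite subr_eq0 mulrC; apply/eqP; exact: FhG.
Qed.

End Density.

Theorem theorem5p4 (R : realType) (E : completeNormedModType R[i])
    (k : \bar R) (Th : poly_spaces E) (L : (E -> R[i]) -> E -> R[i])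
    (hk : (1%:E < k)%E)
    (hTh : holomorphy_type Th)
    (hpi1 : pi1_type Th)
    (hpi2 : pi2_type Th k)
    (hdiv : division_closed (Exp' Th (fine (hoelder_conjugate k))))
    (hL : conv_op Th k L) :
  sn_dense (Exp0 Th k) (fspan (exp_solutions Th k L))
    [set f | exp_car Th k f /\ L f = 0].
Proof.
split=> [f /(fspan_solutions hk hTh hL)[hf Lf]|f [/(exp_carP hk hTh) hf Lf] U].
  by split=> //; apply/(exp_carP hk hTh).
move=> [n [i [e [e0 hU]]]].
(* The norm with the smallest parameter dominates the finitely many others. *)
pose rho := \big[Num.min/1]_(l < n) (i l)%:num.
have rho0 : 0 < rho by rewrite /rho; elim/big_ind : _ => // u v u0 v0; rewrite lt_min u0.
have rhoi l : rho <= (i l)%:num by rewrite /rho bigmin_le_cond.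
apply: contrapT => nU.
have sep g : fspan (exp_solutions Th k L) g -> e <= exp_norm Th k rho (f - g).
  move=> hg; rewrite leNgt; apply/negP => lte; apply: nU; exists g; split=> //.
  have [hg' _] := fspan_solutions hk hTh hL hg; apply: hU; split.
    exact/(exp_carP hk hTh).
  move=> l /=; have hfg := in_expB hk hTh hf hg'.
  rewrite -opprB -scaleN1r (exp_norm_homog hk hTh)// nrmN nrm1 mul1r.
  by apply: le_lt_trans lte; exact: exp_norm_anti.
have sol0 : fspan (exp_solutions Th k L) 0.
  by exists 0%N, (fun=> 0), (fun=> 0); split=> [[]//|]; rewrite big_ord0.
have pZ (a : R[i]) g : in_exp k Th g -> exp_norm Th k rho (a *: g) = nrm a * exp_norm Th k rho g.
  by move=> hg; exact: (exp_norm_homog hk hTh).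
have pZr (r : R) g : 0 <= r -> in_exp k Th g ->
    exp_norm Th k rho (r%:C%C *: g) = r * exp_norm Th k rho g.
  by move=> r0 hg; rewrite pZ// nrmc ger0_norm.
have pD g h : in_exp k Th g -> in_exp k Th h ->
    exp_norm Th k rho (g + h) <= exp_norm Th k rho g + exp_norm Th k rho h.
  by move=> hg hh; have := exp_norm_lin hk hTh 1 hg hh rho0; rewrite scale1r nrm1 mul1r.
have lin (a : R[i]) g h : in_exp k Th g -> in_exp k Th h -> in_exp k Th (a *: g + h).
  by move=> hg hh; exact: in_exp_lin.
have p0 g : in_exp k Th g -> 0 <= exp_norm Th k rho g by move=> hg; exact: exp_norm_ge0.
have sub : fspan (exp_solutions Th k L) `<=` in_exp k Th.
  by move=> g /(fspan_solutions hk hTh hL)[].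
have [X [Xlin Xb X0 /eqP[]]] := hahn_banach_separation lin pD pZr pZ p0 sub sol0
  (@fspan_lin _ _ _) hf e0 sep.
apply: (vanish_on_kernel hk hTh hpi1 hL hdiv) hf Lf.
  by split=> [a g h hg hh|]; [exact: Xlin|exists rho, 2].
move=> n' psi phi L0; apply: X0; exists 1%N, (fun=> 1), (fun=> expmon n' psi phi).
split=> [_|]; first exact: (expmon_solution hk hTh hpi1).
by rewrite big_ord1 scale1r.
Qed.
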